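(* Let $I\subseteq\mathbb{R}$ be an open interval, $a:I\to\mathbb{R}^+$ a real analytic function, and $z=s+it$. The only solution (on a neighbourhood of $I\equiv I\times\{0\}$ in $\mathbb{C}$) to the Cauchy problem $$\Delta(\log\phi)=-2\phi,\qquad \phi(s,0)=a(s),\qquad \phi_t(s,0)=0$$ is $$\phi(s,t)=\frac{4|g_z|^2}{(1+|g|^2)^2},\qquad\text{where}\qquad g(z)=\exp\left(i\int_{s_0}^z\sqrt{a}(\zeta)\,d\zeta\right),$$ $s_0\in I$ and $\sqrt{a}(z)$ is a holomorphic extension of $\sqrt{a(s)}$.
   Context: $\Delta=\partial_s^2+\partial_t^2$ and $g_z=dg/dz$. *)

(* Defs.v *)
(* Stdlib reals with Coquelicot; complex numbers are Coquelicot's [C]. *)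
From Stdlib Require Export Reals.
From Coquelicot Require Export Coquelicot.
Open Scope R_scope.

Definition open_interval (J : R -> Prop) : Prop :=
  open J /\ is_connected J.

Definition real_analytic_on (J : R -> Prop) (a : R -> R) : Prop :=
  forall x0 : R, J x0 ->
    exists c : nat -> R,
      locally x0 (fun x : R => is_pseries c (x - x0) (a x)).

Definition connected_set (W : C -> Prop) : Prop :=
  forall A B : C -> Prop, open A -> open B ->
    (forall z : C, W z -> A z \/ B z) ->
    (exists z : C, W z /\ A z) ->
    (exists z : C, W z /\ B z) ->
    exists z : C, W z /\ A z /\ B z.

Definition domain_around (J : R -> Prop) (W : C -> Prop) : Prop :=
  open W /\ connected_set W /\ (forall s : R, J s -> W (s, 0)).

Definition holomorphic_on (U : C -> Prop) (f : C -> C) : Prop :=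
  forall z : C, U z -> ex_derive (K := C_AbsRing) (V := C_NormedModule) f z.

Definition holomorphic_extension
    (J : R -> Prop) (f : R -> R) (U : C -> Prop) (F : C -> C) : Prop :=
  holomorphic_on U F /\ (forall s : R, J s -> F (s, 0) = RtoC (f s)).

Definition C1_path (U : C -> Prop) (gamma dgamma : R -> C) (p q : C) : Prop :=
  gamma 0 = p /\ gamma 1 = q /\
  (forall x : R, 0 <= x <= 1 -> U (gamma x)) /\
  (forall x : R,
     is_derive (K := R_AbsRing) (V := C_R_NormedModule) gamma x (dgamma x)) /\
  (forall x : R, continuous (U := C_UniformSpace) dgamma x).

(* [G z] is the integral of [f] from [p] to [z] along any path inside [U];
   path-independence, automatic for holomorphic [f] on simply connected [U],
   is what makes the notation meaningful. *)
Definition integral_from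
    (U : C -> Prop) (f : C -> C) (p : C) (G : C -> C) : Prop :=
  forall (z : C) (gamma dgamma : R -> C),
    C1_path U gamma dgamma p z ->
    is_RInt (V := C_R_NormedModule)
      (fun x : R => (f (gamma x) * dgamma x)%C) 0 1 (G z).

Definition Cexp (z : C) : C :=
  (exp (Re z) * cos (Im z), exp (Re z) * sin (Im z)).

Definition C2_on (W : C -> Prop) (f : R -> R -> R) : Prop :=
  forall s t : R, W (s, t) -> ex_diff_n f 2 s t.

Definition laplacian (f : R -> R -> R) (s t : R) : R :=
  partial_derive 2 0 f s t + partial_derive 0 2 f s t.

Definition liouville_cauchy_solution
    (J : R -> Prop) (a : R -> R) (W : C -> Prop) (phi : R -> R -> R) : Prop :=
  C2_on W phi /\
  (forall s t : R, W (s, t) -> 0 < phi s t) /\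
  (forall s t : R, W (s, t) ->
     laplacian (fun x y : R => ln (phi x y)) s t = - 2 * phi s t) /\
  (forall s : R, J s -> phi s 0 = a s /\ partial_derive 0 1 phi s 0 = 0).

Definition liouville_formula (g : C -> C) (s t : R) : R :=
  4 * Cmod (C_derive g (s, t)) ^ 2 / (1 + Cmod (g (s, t)) ^ 2) ^ 2.

(* [r] plays the role of the holomorphic square root of [a], and [G] that of
   its integral from the base point [s0]. *)
Definition sqrt_data
    (J : R -> Prop) (a : R -> R) (s0 : R)
    (U : C -> Prop) (r G : C -> C) : Prop :=
  domain_around J U /\
  holomorphic_extension J (fun s : R => sqrt (a s)) U r /\
  integral_from U r (RtoC s0) G.

(* Main.v *)
Require Import Defs.
From Stdlib Require Import Lra Lia Classical ClassicalEpsilon.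

(** For a solution psi put u = log psi.  The equation makes u_zz - u_z^2 / 2
    holomorphic, and on J this function is determined by the Cauchy data, so it is
    the same for any two solutions.  With Q = u_zz - u_z^2 / 2 given, the function
    f = psi^(-1/2) satisfies f_zz = - Q f / 2, which together with
    f * Laplace f = 1 + |grad f|^2 yields a linear first-order system for
    (f, f_s, f_t, Laplace f) along every segment; hence two solutions with the same
    Cauchy data coincide.  Since psi is only C^2, Q is not differentiated: it is
    exhibited as the complex derivative of u_z + P, where P is a primitive of the
    closed form e^u dz' / 2 - u_z^2 dz / 2 (z' the conjugate of z), and Cauchy's
    formula then makes it analytic.  The explicit formula reads
    phi = |sqrt a|^2 / cosh^2 (Im G), with G a primitive of sqrt a. *)

(** * Differentiability in the plane *)

(** Elliptic regularity followed by the Cauchy-Kovalevskaya theorem would also give uniqueness near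
    [J]. Passing to Q replaces both: the comparison of two [C^2] solutions becomes the identity
    theorem for one holomorphic function and a Gronwall estimate. Linearity makes this estimate
    valid on a whole disc, however large: the coefficients of the system are multiples of the real
    and imaginary parts of Q, the same for both solutions. Three obstacles lie outside the local
    argument. A competing solution lives on an arbitrary connected neighbourhood of [J] inside [U],
    so agreement must be continued from disc to disc. The function [r] may have zeros in [U], where
    the explicit formula vanishes and has no logarithm; positivity of the competitor keeps the
    continuation away from them. Finally, [G] is given only through integrals along C1 paths, so its
    differentiability has to be extracted from path independence. *)

Notation D2 := differentiable_pt_lim.

Definition cderiv (F : C -> C) (z d : C) : Prop :=
  is_derive (K := C_AbsRing) (V := C_NormedModule) F z d.

(** Stated with [Cmod] instead of filters, so that triangle inequalities apply directly;
    [ccont_continuous] gives the equivalence with the topological notion. *)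
Definition ccont (F : C -> C) (z : C) : Prop :=
  forall eps : R, 0 < eps ->
    exists delta : R, 0 < delta /\
      forall w : C, Cmod (w - z) < delta -> Cmod (F w - F z) < eps.

Definition disc (q : C) (rho : R) (z : C) : Prop := Cmod (z - q) < rho.

(** With a continuous derivative, Cauchy's formula follows by differentiation under the integral
    sign, without Goursat's theorem. A primitive of a continuous function, such as [G], is of this
    kind at once. *)
Definition C1_holomorphic (D : C -> Prop) (F F' : C -> C) : Prop :=
  forall z : C, D z -> cderiv F z (F' z) /\ ccont F' z.

Lemma Cmod_le_Rabs_sum (z : C) : Cmod z <= Rabs (fst z) + Rabs (snd z).
Proof.
  destruct z as [x y]; simpl. unfold Cmod; simpl.
  apply Rsqr_incr_0_var.
  - rewrite Rsqr_sqrt by nra. unfold Rsqr.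
    pose proof (Rabs_pos x); pose proof (Rabs_pos y).
    assert (Rabs x * Rabs x = x * x) by (rewrite <- Rabs_mult; apply Rabs_pos_eq; nra).
    assert (Rabs y * Rabs y = y * y) by (rewrite <- Rabs_mult; apply Rabs_pos_eq; nra).
    nra.
  - pose proof (Rabs_pos x); pose proof (Rabs_pos y); lra.
Qed.

Lemma Cmod_ge_fst (z : C) : Rabs (fst z) <= Cmod z.
Proof. apply re_le_Cmod. Qed.

Lemma Cmod_ge_snd (z : C) : Rabs (snd z) <= Cmod z.
Proof. eapply Rle_trans; [apply Rmax_r | apply Rmax_Cmod]. Qed.

Lemma Cmod_sub_sym (z w : C) : Cmod (z - w) = Cmod (w - z).
Proof. rewrite <- Cmod_opp. f_equal. ring. Qed.

Lemma Cmod_sub_triangle (x y z : C) : Cmod (x - z) <= Cmod (x - y) + Cmod (y - z).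
Proof. replace (x - z)%C with ((x - y) + (y - z))%C by ring. apply Cmod_triangle. Qed.

Lemma Cmod_minus_self (z : C) : Cmod (z - z) = 0.
Proof. replace (z - z)%C with (RtoC 0) by ring. apply Cmod_0. Qed.

Lemma Cmod_triangle_rev (x y : C) : Cmod x - Cmod y <= Cmod (x - y).
Proof.
  pose proof (Cmod_triangle (x - y) y) as H.
  replace (x - y + y)%C with x in H by ring. lra.
Qed.

Lemma locally_disc (P : C -> Prop) (z : C) :
  locally (T := C_UniformSpace) z P <->
  exists delta : R, 0 < delta /\ forall w : C, Cmod (w - z) < delta -> P w.
Proof.
  split.
  - intros [e He]. exists e. split; [apply cond_pos |].
    intros w Hw. apply He. apply C_NormedModule_mixin_compat1. exact Hw.
  - intros (d & Hd & H).
    (* Balls of the product structure are squares; half the radius keeps the square inside the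
       disc. *)
    exists (mkposreal (d / 2) ltac:(lra)). intros [u v] [Hu Hv].
    apply H. destruct z as [x y]. simpl in Hu, Hv.
    change (Rabs (minus u x) < d / 2) in Hu. change (Rabs (minus v y) < d / 2) in Hv.
    eapply Rle_lt_trans; [apply Cmod_le_Rabs_sum |]. simpl.
    unfold minus, plus, opp in Hu, Hv; simpl in Hu, Hv. unfold Rminus in *.
    lra.
Qed.

Lemma open_disc (W : C -> Prop) (z : C) :
  open (T := C_UniformSpace) W -> W z ->
  exists delta : R, 0 < delta /\ forall w : C, disc z delta w -> W w.
Proof. intros HW Hz. apply locally_disc. apply HW. exact Hz. Qed.

Lemma disc_is_open (q : C) (rho : R) : open (T := C_UniformSpace) (disc q rho).
Proof.
  intros z Hz. apply locally_disc. unfold disc in *.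
  exists (rho - Cmod (z - q)). split; [lra |]. intros w Hw.
  pose proof (Cmod_sub_triangle w z q). lra.
Qed.

Lemma locally_2d_disc (P : C -> Prop) (z : C) :
  locally_2d (fun u v => P (u, v)) (fst z) (snd z) <->
  exists delta : R, 0 < delta /\ forall w : C, Cmod (w - z) < delta -> P w.
Proof.
  rewrite <- locally_disc. rewrite locally_2d_locally. destruct z as [x y]; simpl.
  split; apply filter_imp; intros [u v]; auto.
Qed.

Lemma open_locally_2d (W : C -> Prop) (z : C) :
  open (T := C_UniformSpace) W -> W z ->
  locally_2d (fun u v => W (u, v)) (fst z) (snd z).
Proof. intros HW Hz. apply locally_2d_disc. apply open_disc; auto. Qed.

Lemma locally_2d_mono (P Q : R -> R -> Prop) x y :
  (forall u v, P u v -> Q u v) -> locally_2d P x y -> locally_2d Q x y.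
Proof. intros H. apply locally_2d_impl, locally_2d_forall. exact H. Qed.

Lemma ccont_iff_2d (F : C -> C) (z : C) :
  ccont F z <->
  continuity_2d_pt (fun u v => fst (F (u, v))) (fst z) (snd z) /\
  continuity_2d_pt (fun u v => snd (F (u, v))) (fst z) (snd z).
Proof.
  destruct z as [x y]. simpl. split.
  - intros H; split; intros eps; destruct (H eps (cond_pos eps)) as (d & Hd & Hw);
    apply (locally_2d_disc (fun w => Rabs (_ (F w) - _ (F (x, y))) < eps) (x, y));
    exists d; split; auto; intros w Hwz; specialize (Hw w Hwz);
    (eapply Rle_lt_trans; [| exact Hw]).
    + apply (Cmod_ge_fst (F w - F (x, y))).
    + apply (Cmod_ge_snd (F w - F (x, y))).
  - intros [H1 H2] eps Heps.
    specialize (H1 (mkposreal (eps / 2) ltac:(lra))).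
    specialize (H2 (mkposreal (eps / 2) ltac:(lra))). simpl in H1, H2.
    apply (locally_2d_disc (fun w => Rabs (fst (F w) - fst (F (x, y))) < eps / 2) (x, y)) in H1.
    apply (locally_2d_disc (fun w => Rabs (snd (F w) - snd (F (x, y))) < eps / 2) (x, y)) in H2.
    destruct H1 as (d1 & Hd1 & H1); destruct H2 as (d2 & Hd2 & H2).
    exists (Rmin d1 d2). split; [apply Rmin_pos; auto |]. intros w Hw.
    specialize (H1 w (Rlt_le_trans _ _ _ Hw (Rmin_l _ _))).
    specialize (H2 w (Rlt_le_trans _ _ _ Hw (Rmin_r _ _))).
    eapply Rle_lt_trans; [apply Cmod_le_Rabs_sum |]. simpl. unfold Rminus in *. lra.
Qed.

(** * Calculus of differentials of real functions of two variables *)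

Lemma D2_derive_1 f x y a b : D2 f x y a b -> is_derive (fun u => f u y) x a.
Proof.
  intros H. apply is_derive_Reals.
  replace a with (a * 1 + b * 0) by ring.
  apply (derivable_pt_lim_comp_2d f (fun u => u) (fun _ => y) x a b 1 0); auto.
  - apply derivable_pt_lim_id.
  - apply derivable_pt_lim_const.
Qed.

Lemma D2_derive_2 f x y a b : D2 f x y a b -> is_derive (fun v => f x v) y b.
Proof.
  intros H. apply is_derive_Reals.
  replace b with (a * 0 + b * 1) by ring.
  apply (derivable_pt_lim_comp_2d f (fun _ => x) (fun u => u) y a b 0 1); auto.
  - apply derivable_pt_lim_const.
  - apply derivable_pt_lim_id.
Qed.

Lemma D2_path f (g h : R -> R) t a b g' h' :
  D2 f (g t) (h t) a b -> is_derive g t g' -> is_derive h t h' ->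
  is_derive (fun u => f (g u) (h u)) t (a * g' + b * h').
Proof.
  intros H1 H2 H3. apply is_derive_Reals. apply derivable_pt_lim_comp_2d; auto;
  apply is_derive_Reals; auto.
Qed.

Lemma D2_continuity f x y a b : D2 f x y a b -> continuity_2d_pt f x y.
Proof. intros H. apply differentiable_continuity_pt. exists a, b. exact H. Qed.

Lemma D2_of_partials f a b x y :
  locally_2d (fun u v => is_derive (fun s => f s v) u (a u v)) x y ->
  is_derive (fun t => f x t) y b ->
  continuity_2d_pt a x y ->
  D2 f x y (a x y) b.
Proof.
  intros H1 H2 H3. apply filterdiff_differentiable_pt_lim.
  eapply filterdiff_ext_lin.
  - apply (is_derive_filterdiff f x y a b).
    + apply locally_2d_locally in H1. exact H1.
    + exact H2.
    + apply continuity_2d_pt_filterlim in H3. exact H3.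
  - intros [u v]. simpl. reflexivity.
Qed.

Lemma D2_comp1 (g : R -> R) f x y a b g' :
  D2 f x y a b -> is_derive g (f x y) g' ->
  D2 (fun u v => g (f u v)) x y (g' * a) (g' * b).
Proof.
  intros H1 H2.
  replace (g' * a) with (g' * a + 0 * a) by ring.
  replace (g' * b) with (g' * b + 0 * b) by ring.
  (* A dummy second argument turns [g] into an outer function of two variables. *)
  apply (differentiable_pt_lim_comp (fun u _ => g u) f f x y g' 0 a b a b); auto.
  apply differentiable_pt_lim_proj1_0. apply is_derive_Reals. exact H2.
Qed.

Lemma D2_plus f g x y a b c d :
  D2 f x y a b -> D2 g x y c d -> D2 (fun u v => f u v + g u v) x y (a + c) (b + d).
Proof.
  intros H1 H2.
  replace (a + c) with (1 * a + 1 * c) by ring.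
  replace (b + d) with (1 * b + 1 * d) by ring.
  apply (differentiable_pt_lim_comp Rplus f g); auto.
  intros eps. apply locally_2d_forall. intros u v.
  replace (_ - _) with 0 by ring. rewrite Rabs_R0.
  apply Rmult_le_pos; [left; apply cond_pos |].
  eapply Rle_trans; [apply Rabs_pos | apply Rmax_l].
Qed.

Lemma D2_const c x y : D2 (fun _ _ => c) x y 0 0.
Proof.
  intros eps. apply locally_2d_forall. intros u v.
  replace (_ - _) with 0 by ring. rewrite Rabs_R0.
  apply Rmult_le_pos; [left; apply cond_pos |].
  eapply Rle_trans; [apply Rabs_pos | apply Rmax_l].
Qed.

Lemma D2_fst x y : D2 (fun u _ => u) x y 1 0.
Proof. apply differentiable_pt_lim_proj1_0. apply derivable_pt_lim_id. Qed.

Lemma D2_snd x y : D2 (fun _ v => v) x y 0 1.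
Proof.
  intros eps. apply locally_2d_forall. intros u v.
  replace (_ - _) with 0 by ring. rewrite Rabs_R0.
  apply Rmult_le_pos; [left; apply cond_pos |].
  eapply Rle_trans; [apply Rabs_pos | apply Rmax_l].
Qed.

Lemma D2_scal k f x y a b : D2 f x y a b -> D2 (fun u v => k * f u v) x y (k * a) (k * b).
Proof.
  intros H. apply (D2_comp1 (fun t => k * t)); auto.
  auto_derive; auto. ring.
Qed.

Lemma D2_opp f x y a b : D2 f x y a b -> D2 (fun u v => - f u v) x y (- a) (- b).
Proof.
  intros H. replace (- a) with (-1 * a) by ring. replace (- b) with (-1 * b) by ring.
  eapply differentiable_pt_lim_ext; [| apply (D2_scal (-1)); exact H].
  apply locally_2d_forall. intros; ring.
Qed.

Lemma D2_minus f g x y a b c d :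
  D2 f x y a b -> D2 g x y c d -> D2 (fun u v => f u v - g u v) x y (a - c) (b - d).
Proof. intros H1 H2. apply D2_plus; auto. apply D2_opp; auto. Qed.

Lemma D2_sqr f x y a b :
  D2 f x y a b -> D2 (fun u v => f u v * f u v) x y (2 * f x y * a) (2 * f x y * b).
Proof.
  intros H. apply (D2_comp1 (fun t => t * t)); auto.
  auto_derive; auto. ring.
Qed.

(* Polarization reduces the product to squares. *)
Lemma D2_mult f g x y a b c d :
  D2 f x y a b -> D2 g x y c d ->
  D2 (fun u v => f u v * g u v) x y (a * g x y + f x y * c) (b * g x y + f x y * d).
Proof.
  intros H1 H2.
  pose proof (D2_scal (/4) _ _ _ _ _
    (D2_minus _ _ _ _ _ _ _ _ (D2_sqr _ _ _ _ _ (D2_plus _ _ _ _ _ _ _ _ H1 H2))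
                       (D2_sqr _ _ _ _ _ (D2_minus _ _ _ _ _ _ _ _ H1 H2)))) as H.
  cbv beta in H.
  match type of H with D2 _ _ _ ?p ?q =>
    replace (a * g x y + f x y * c) with p by field;
    replace (b * g x y + f x y * d) with q by field end.
  eapply differentiable_pt_lim_ext; [| exact H].
  apply locally_2d_forall. intros; simpl; field.
Qed.

Lemma D2_inv f x y a b :
  D2 f x y a b -> f x y <> 0 ->
  D2 (fun u v => / f u v) x y (- a / (f x y) ^ 2) (- b / (f x y) ^ 2).
Proof.
  intros H Hn.
  replace (- a / (f x y) ^ 2) with ((- / (f x y) ^ 2) * a) by (field; auto).
  replace (- b / (f x y) ^ 2) with ((- / (f x y) ^ 2) * b) by (field; auto).
  apply (D2_comp1 Rinv); auto.
  auto_derive; auto. field; auto.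
Qed.

Lemma D2_div f g x y a b c d :
  D2 f x y a b -> D2 g x y c d -> g x y <> 0 ->
  D2 (fun u v => f u v / g u v) x y
     ((a * g x y - f x y * c) / (g x y) ^ 2) ((b * g x y - f x y * d) / (g x y) ^ 2).
Proof.
  intros H1 H2 Hn.
  pose proof (D2_mult _ _ _ _ _ _ _ _ H1 (D2_inv _ _ _ _ _ H2 Hn)) as H.
  match type of H with D2 _ _ _ ?p ?q =>
    replace ((a * g x y - f x y * c) / (g x y) ^ 2) with p by (field; auto);
    replace ((b * g x y - f x y * d) / (g x y) ^ 2) with q by (field; auto) end.
  exact H.
Qed.

Lemma D2_eq f x y a b a' b' : D2 f x y a' b' -> a' = a -> b' = b -> D2 f x y a b.
Proof. intros; subst; auto. Qed.

(** * Derivative rules on the real line *)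

Lemma ex_derive_continuous_R (u : R -> R) x : ex_derive u x -> continuous u x.
Proof. apply (ex_derive_continuous (K := R_AbsRing) (V := R_NormedModule)). Qed.

Lemma is_derive_const_R (c x : R) : is_derive (fun _ : R => c) x 0.
Proof. apply (is_derive_const (K := R_AbsRing) (V := R_NormedModule)). Qed.

Lemma is_derive_plus_R (u v : R -> R) x a b :
  is_derive u x a -> is_derive v x b -> is_derive (fun y => u y + v y) x (a + b).
Proof. apply (is_derive_plus (K := R_AbsRing) (V := R_NormedModule)). Qed.

Lemma is_derive_minus_R (u v : R -> R) x a b :
  is_derive u x a -> is_derive v x b -> is_derive (fun y => u y - v y) x (a - b).
Proof. apply (is_derive_minus (K := R_AbsRing) (V := R_NormedModule)). Qed.

Lemma is_derive_opp_R (u : R -> R) x a : is_derive u x a -> is_derive (fun y => - u y) x (- a).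
Proof. apply (is_derive_opp (K := R_AbsRing) (V := R_NormedModule)). Qed.

Lemma is_derive_comp_R (u v : R -> R) x a b :
  is_derive u (v x) a -> is_derive v x b -> is_derive (fun y => u (v y)) x (b * a).
Proof. apply (is_derive_comp (K := R_AbsRing) (V := R_NormedModule)). Qed.

Lemma is_derive_mult_R (u v : R -> R) x a b :
  is_derive u x a -> is_derive v x b -> is_derive (fun y => u y * v y) x (a * v x + u x * b).
Proof. intros Hu Hv. apply (is_derive_mult (K := R_AbsRing)); auto. intros; apply Rmult_comm. Qed.

(** * Complex derivatives *)

Lemma cderiv_eps (F : C -> C) (z d : C) :
  cderiv F z d <->
  forall eps : R, 0 < eps -> exists delta : R, 0 < delta /\
    forall w : C, Cmod (w - z) < delta ->
      Cmod (F w - F z - d * (w - z)) <= eps * Cmod (w - z).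
Proof.
  assert (E : forall w, minus (minus (F w) (F z)) (scal (minus w z) d)
                = (F w - F z - d * (w - z))%C).
  { intros w. change (F w - F z - (w - z) * d = F w - F z - d * (w - z))%C. ring. }
  split.
  - intros [_ H] eps Heps.
    destruct (H z (fun P HP => HP) (mkposreal eps Heps)) as [e He].
    exists e. split; [apply cond_pos |]. intros w Hw. specialize (He w).
    simpl in He. rewrite <- E.
    exact (He Hw).
  - intros H. split.
    + apply is_linear_scal_l.
    + intros x Hx eps.
      assert (z = x) as <-.
      { apply (@is_filter_lim_locally_unique C_AbsRing (AbsRing_NormedModule C_AbsRing)). exact Hx. }
      destruct (H eps (cond_pos eps)) as (dl & Hd & Hw).
      exists (mkposreal dl Hd). intros w Hb. specialize (Hw w Hb).
      rewrite <- E in Hw. exact Hw.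
Qed.

(** The Cauchy-Riemann equations sit in the two pairs of partial derivatives. Through this
    equivalence the product and chain rules for complex derivatives are read off from the real
    ones. *)
Lemma cderiv_D2 (F : C -> C) (z d : C) :
  cderiv F z d <->
  D2 (fun u v => fst (F (u, v))) (fst z) (snd z) (fst d) (- snd d) /\
  D2 (fun u v => snd (F (u, v))) (fst z) (snd z) (snd d) (fst d).
Proof.
  rewrite cderiv_eps. destruct z as [x y]; destruct d as [p q]. simpl.
  split.
  - intros H.
    assert (K : forall eps : posreal, exists delta, 0 < delta /\ forall w,
       Cmod (w - (x, y)) < delta ->
       Cmod (F w - F (x, y) - (p, q) * (w - (x, y))) <=
          eps * Rmax (Rabs (fst w - x)) (Rabs (snd w - y))).
    (* [Cmod] is at most the sum of the two coordinates, hence at most twice their maximum. *)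
    { intros eps. destruct (H (eps / 2)) as (d & Hd & Hw).
      { pose proof (cond_pos eps); lra. }
      exists d; split; auto. intros w Hwd. eapply Rle_trans; [apply Hw; auto |].
      pose proof (Cmod_le_Rabs_sum (w - (x, y))) as K. simpl in K.
      pose proof (Rmax_l (Rabs (fst w - x)) (Rabs (snd w - y))).
      pose proof (Rmax_r (Rabs (fst w - x)) (Rabs (snd w - y))).
      pose proof (cond_pos eps). unfold Rminus in *. nra. }
    split; intros eps; destruct (K eps) as (d & Hd & Hw).
    + apply (locally_2d_disc (fun w => Rabs (fst (F w) - fst (F (x, y)) -
          (p * (fst w - x) + - q * (snd w - y))) <= eps * Rmax (Rabs (fst w - x)) (Rabs (snd w - y))) (x, y)).
      exists d; split; auto. intros w Hwd. eapply Rle_trans; [| apply Hw; auto].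
      eapply Rle_trans; [| apply Cmod_ge_fst]. right. f_equal. simpl. ring.
    + apply (locally_2d_disc (fun w => Rabs (snd (F w) - snd (F (x, y)) -
          (q * (fst w - x) + p * (snd w - y))) <= eps * Rmax (Rabs (fst w - x)) (Rabs (snd w - y))) (x, y)).
      exists d; split; auto. intros w Hwd. eapply Rle_trans; [| apply Hw; auto].
      eapply Rle_trans; [| apply Cmod_ge_snd]. right. f_equal. simpl. ring.
  - intros [H1 H2] eps Heps.
    specialize (H1 (mkposreal (eps / 2) ltac:(lra))).
    specialize (H2 (mkposreal (eps / 2) ltac:(lra))). simpl in H1, H2.
    apply (locally_2d_disc (fun w => Rabs (fst (F w) - fst (F (x, y)) -
          (p * (fst w - x) + - q * (snd w - y))) <= eps / 2 * Rmax (Rabs (fst w - x)) (Rabs (snd w - y))) (x, y)) in H1.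
    apply (locally_2d_disc (fun w => Rabs (snd (F w) - snd (F (x, y)) -
          (q * (fst w - x) + p * (snd w - y))) <= eps / 2 * Rmax (Rabs (fst w - x)) (Rabs (snd w - y))) (x, y)) in H2.
    destruct H1 as (d1 & Hd1 & H1); destruct H2 as (d2 & Hd2 & H2).
    exists (Rmin d1 d2). split; [apply Rmin_pos; auto |]. intros w Hw.
    specialize (H1 w (Rlt_le_trans _ _ _ Hw (Rmin_l _ _))).
    specialize (H2 w (Rlt_le_trans _ _ _ Hw (Rmin_r _ _))).
    assert (M : Rmax (Rabs (fst w - x)) (Rabs (snd w - y)) <= Cmod (w - (x, y))).
    { apply (Rmax_Cmod (w - (x, y))%C). }
    eapply Rle_trans; [apply Cmod_le_Rabs_sum |]. simpl.
    replace (fst (F w) + - fst (F (x, y)) + - (p * (fst w + - x) - q * (snd w + - y)))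
      with (fst (F w) - fst (F (x, y)) - (p * (fst w - x) + - q * (snd w - y))) by ring.
    replace (snd (F w) + - snd (F (x, y)) + - (p * (snd w + - y) + q * (fst w + - x)))
      with (snd (F w) - snd (F (x, y)) - (q * (fst w - x) + p * (snd w - y))) by ring.
    nra.
Qed.

Lemma cderiv_ccont (F : C -> C) (z d : C) : cderiv F z d -> ccont F z.
Proof.
  intros H. apply cderiv_D2 in H. apply ccont_iff_2d.
  split; eapply D2_continuity; apply H.
Qed.

Lemma cderiv_eq F z d d' : cderiv F z d' -> d' = d -> cderiv F z d.
Proof. intros; subst; auto. Qed.

Lemma cderiv_ext_disc (F G : C -> C) (z d : C) (rho : R) :
  0 < rho -> (forall w, disc z rho w -> F w = G w) -> cderiv F z d -> cderiv G z d.
Proof.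
  intros Hr HE H. apply cderiv_eps. intros eps Heps.
  destruct (proj1 (cderiv_eps _ _ _) H eps Heps) as (dl & Hd & Hw).
  exists (Rmin dl rho). split; [apply Rmin_pos; auto |]. intros w Hwd.
  rewrite <- (HE w), <- (HE z).
  - apply Hw. eapply Rlt_le_trans; [exact Hwd | apply Rmin_l].
  - unfold disc. rewrite Cmod_minus_self. auto.
  - unfold disc. eapply Rlt_le_trans; [exact Hwd | apply Rmin_r].
Qed.

Lemma cderiv_unique F z d d' : cderiv F z d -> cderiv F z d' -> d = d'.
Proof.
  intros H1 H2. apply is_C_derive_unique in H1. apply is_C_derive_unique in H2. congruence.
Qed.

Lemma cderiv_const c z : cderiv (fun _ => c) z 0.
Proof.
  apply cderiv_eps. intros eps Heps. exists 1; split; [lra |]. intros w _.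
  replace (c - c - 0 * (w - z))%C with (RtoC 0) by ring. rewrite Cmod_0.
  apply Rmult_le_pos; [lra | apply Cmod_ge_0].
Qed.

Lemma cderiv_id z : cderiv (fun w => w) z 1.
Proof.
  apply cderiv_eps. intros eps Heps. exists 1; split; [lra |]. intros w _.
  replace (w - z - 1 * (w - z))%C with (RtoC 0) by ring. rewrite Cmod_0.
  apply Rmult_le_pos; [lra | apply Cmod_ge_0].
Qed.

Lemma cderiv_plus F G z a b :
  cderiv F z a -> cderiv G z b -> cderiv (fun w => F w + G w)%C z (a + b)%C.
Proof.
  intros H1 H2. apply (is_derive_plus (K := C_AbsRing) (V := C_NormedModule) F G z a b); auto.
Qed.

Lemma cderiv_minus F G z a b :
  cderiv F z a -> cderiv G z b -> cderiv (fun w => F w - G w)%C z (a - b)%C.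
Proof.
  intros H1 H2. apply (is_derive_minus (K := C_AbsRing) (V := C_NormedModule) F G z a b); auto.
Qed.

Lemma cderiv_mult F G z a b :
  cderiv F z a -> cderiv G z b ->
  cderiv (fun w => F w * G w)%C z (a * G z + F z * b)%C.
Proof.
  intros H1 H2. apply cderiv_D2. apply cderiv_D2 in H1. apply cderiv_D2 in H2.
  destruct H1 as [A1 A2]; destruct H2 as [B1 B2].
  destruct z as [x y]; simpl in *. split.
  - eapply D2_eq.
    + apply D2_minus; apply D2_mult; eassumption.
    + simpl; ring.
    + simpl; ring.
  - eapply D2_eq.
    + apply D2_plus; apply D2_mult; eassumption.
    + simpl; ring.
    + simpl; ring.
Qed.

Lemma cderiv_scal F z a c : cderiv F z a -> cderiv (fun w => c * F w)%C z (c * a)%C.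
Proof.
  intros H. eapply cderiv_eq; [apply cderiv_mult; [apply (cderiv_const c) | exact H] |]. cbv beta; ring.
Qed.

Lemma cderiv_comp F G z a b :
  cderiv F z a -> cderiv G (F z) b -> cderiv (fun w => G (F w)) z (b * a)%C.
Proof.
  intros H1 H2. apply cderiv_D2. apply cderiv_D2 in H1. apply cderiv_D2 in H2.
  destruct H1 as [A1 A2]; destruct H2 as [B1 B2].
  destruct z as [x y]; simpl in *.
  set (f := fun u v => fst (F (u, v))) in *. set (g := fun u v => snd (F (u, v))) in *.
  assert (EF : forall u v, F (u, v) = (f u v, g u v)).
  { intros. unfold f, g. destruct (F (u, v)); reflexivity. }
  split.
  - eapply D2_eq.
    + eapply differentiable_pt_lim_ext.
      2: apply (differentiable_pt_lim_comp (fun u v => fst (G (u, v))) f g x y); eassumption.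
      apply locally_2d_forall. intros u v. rewrite EF. reflexivity.
    + simpl; ring.
    + simpl; ring.
  - eapply D2_eq.
    + eapply differentiable_pt_lim_ext.
      2: apply (differentiable_pt_lim_comp (fun u v => snd (G (u, v))) f g x y); eassumption.
      apply locally_2d_forall. intros u v. rewrite EF. reflexivity.
    + simpl; ring.
    + simpl; ring.
Qed.

Lemma ccont_const c z : ccont (fun _ => c) z.
Proof. eapply cderiv_ccont. apply cderiv_const. Qed.

Lemma ccont_id z : ccont (fun w => w) z.
Proof. eapply cderiv_ccont. apply cderiv_id. Qed.

Lemma ccont_plus F G z : ccont F z -> ccont G z -> ccont (fun w => F w + G w)%C z.
Proof.
  rewrite !ccont_iff_2d. intros [A1 A2] [B1 B2].
  split; simpl; apply continuity_2d_pt_plus; auto.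
Qed.

Lemma ccont_minus F G z : ccont F z -> ccont G z -> ccont (fun w => F w - G w)%C z.
Proof.
  rewrite !ccont_iff_2d. intros [A1 A2] [B1 B2].
  split; simpl; apply continuity_2d_pt_minus; auto.
Qed.

Lemma ccont_mult F G z : ccont F z -> ccont G z -> ccont (fun w => F w * G w)%C z.
Proof.
  rewrite !ccont_iff_2d. intros [A1 A2] [B1 B2].
  split; simpl.
  - apply continuity_2d_pt_minus; apply continuity_2d_pt_mult; auto.
  - apply continuity_2d_pt_plus; apply continuity_2d_pt_mult; auto.
Qed.

Lemma ccont_inv F z : ccont F z -> F z <> 0 -> ccont (fun w => / F w)%C z.
Proof.
  rewrite !ccont_iff_2d. intros [A1 A2] H0.
  assert (N : fst (F z) ^ 2 + snd (F z) ^ 2 <> 0).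
  { intros E. apply H0. destruct (F z) as [u v]. simpl in E.
    assert (u = 0) by nra. assert (v = 0) by nra. subst. reflexivity. }
  destruct z as [x y]; simpl in *.
  assert (K : continuity_2d_pt (fun u v => / (fst (F (u, v)) ^ 2 + snd (F (u, v)) ^ 2)) x y).
  { apply continuity_2d_pt_inv; auto.
    apply continuity_2d_pt_plus; simpl;
    (apply continuity_2d_pt_mult; [| apply continuity_2d_pt_mult]);
    auto using continuity_2d_pt_const. }
  split; unfold Rdiv; apply continuity_2d_pt_mult; auto. apply continuity_2d_pt_opp; auto.
Qed.

Lemma ccont_comp F G z : ccont F z -> ccont G (F z) -> ccont (fun w => G (F w)) z.
Proof.
  intros HF HG eps Heps. destruct (HG eps Heps) as (d & Hd & H1).
  destruct (HF d Hd) as (d' & Hd' & H2). exists d'; split; auto.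
Qed.

Lemma ccont_ext_disc (F G : C -> C) (z : C) (rho : R) :
  0 < rho -> (forall w, disc z rho w -> F w = G w) -> ccont F z -> ccont G z.
Proof.
  intros Hr HE H eps Heps. destruct (H eps Heps) as (dl & Hd & Hw).
  exists (Rmin dl rho). split; [apply Rmin_pos; auto |]. intros w Hwd.
  rewrite <- (HE w), <- (HE z).
  - apply Hw. eapply Rlt_le_trans; [exact Hwd | apply Rmin_l].
  - unfold disc. rewrite Cmod_minus_self. auto.
  - unfold disc. eapply Rlt_le_trans; [exact Hwd | apply Rmin_r].
Qed.

Lemma ccont_continuous F z :
  ccont F z <-> continuous (T := C_UniformSpace) (U := C_UniformSpace) F z.
Proof.
  split.
  - intros H P HP. apply locally_disc in HP. destruct HP as (d & Hd & HP).
    apply locally_disc. destruct (H d Hd) as (d' & Hd' & H'). exists d'; split; auto.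
  - intros H eps Heps.
    assert (L : locally (T := C_UniformSpace) (F z) (fun w => Cmod (w - F z) < eps)).
    { apply locally_disc. exists eps; split; auto. }
    apply H in L. apply locally_disc in L. exact L.
Qed.

Lemma ex_cderiv_ccont F z : (exists d, cderiv F z d) -> ccont F z.
Proof. intros [d H]. eapply cderiv_ccont; eauto. Qed.

(** * Complex power series *)

(** [Series] is total, so this has a value even for divergent series; the laws below therefore carry
    [abs_summable] or a summable majorant. *)
Definition CSeries (u : nat -> C) : C :=
  (Series (fun n => fst (u n)), Series (fun n => snd (u n))).

Definition abs_summable (u : nat -> C) : Prop := ex_series (fun n => Cmod (u n)).

Lemma ex_series_dominated (a b : nat -> R) :
  (forall n, Rabs (a n) <= b n) -> ex_series b -> ex_series a.
Proof. intros H. apply (ex_series_le (K := R_AbsRing) (V := R_CompleteNormedModule)). exact H. Qed.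

Lemma abs_summable_fst u : abs_summable u -> ex_series (fun n => Rabs (fst (u n))).
Proof.
  intros H. apply ex_series_dominated with (2 := H). intros n. rewrite Rabs_Rabsolu. apply Cmod_ge_fst.
Qed.

Lemma abs_summable_snd u : abs_summable u -> ex_series (fun n => Rabs (snd (u n))).
Proof.
  intros H. apply ex_series_dominated with (2 := H). intros n. rewrite Rabs_Rabsolu. apply Cmod_ge_snd.
Qed.

Lemma abs_summable_le u (b : nat -> R) :
  (forall n, Cmod (u n) <= b n) -> ex_series b -> abs_summable u.
Proof.
  intros H. apply ex_series_dominated. intros n.
  rewrite Rabs_pos_eq; [apply H | apply Cmod_ge_0].
Qed.

(** The factor 2 comes from bounding the two coordinates separately; the estimates that follow
    tolerate it. *)
Lemma CSeries_bound u (b : nat -> R) :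
  (forall n, Cmod (u n) <= b n) -> ex_series b -> Cmod (CSeries u) <= 2 * Series b.
Proof.
  intros H Hb. pose proof (abs_summable_le u b H Hb) as Hu.
  eapply Rle_trans; [apply Cmod_le_Rabs_sum |]. simpl.
  assert (H1 : Rabs (Series (fun n => fst (u n))) <= Series b).
  { eapply Rle_trans; [apply Series_Rabs; apply abs_summable_fst; auto |].
    apply Series_le; auto. intros n. split; [apply Rabs_pos |].
    eapply Rle_trans; [apply Cmod_ge_fst | auto]. }
  assert (H2 : Rabs (Series (fun n => snd (u n))) <= Series b).
  { eapply Rle_trans; [apply Series_Rabs; apply abs_summable_snd; auto |].
    apply Series_le; auto. intros n. split; [apply Rabs_pos |].
    eapply Rle_trans; [apply Cmod_ge_snd | auto]. }
  lra.
Qed.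

Lemma abs_summable_minus u v :
  abs_summable u -> abs_summable v -> abs_summable (fun n => u n - v n)%C.
Proof.
  intros Hu Hv. apply abs_summable_le with (fun n => Cmod (u n) + Cmod (v n)).
  - intros n. eapply Rle_trans; [apply Cmod_triangle |]. rewrite Cmod_opp. lra.
  - apply (ex_series_plus (K := R_AbsRing) (V := R_NormedModule) _ _ Hu Hv).
Qed.

Lemma abs_summable_scal c u : abs_summable u -> abs_summable (fun n => c * u n)%C.
Proof.
  intros Hu. apply abs_summable_le with (fun n => Cmod c * Cmod (u n)).
  - intros n. rewrite Cmod_mult. lra.
  - apply (ex_series_scal (K := R_AbsRing) (V := R_NormedModule) (Cmod c) _ Hu).
Qed.

Lemma abs_summable_incr_1 u : abs_summable u <-> abs_summable (fun n => u (S n)).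
Proof. apply (ex_series_incr_1 (K := R_AbsRing) (V := R_NormedModule)). Qed.

Lemma CSeries_ext u v : (forall n, u n = v n) -> CSeries u = CSeries v.
Proof.
  intros H. unfold CSeries. f_equal; apply Series_ext; intros n; rewrite H; auto.
Qed.

Lemma CSeries_minus u v :
  abs_summable u -> abs_summable v ->
  CSeries (fun n => u n - v n)%C = (CSeries u - CSeries v)%C.
Proof.
  intros Hu Hv. unfold CSeries. simpl. apply injective_projections; simpl.
  - rewrite <- Series_opp, <- Series_plus.
    + apply Series_ext; reflexivity.
    + apply ex_series_Rabs, abs_summable_fst, Hu.
    + apply (ex_series_opp (V := R_NormedModule)). apply ex_series_Rabs, abs_summable_fst, Hv.
  - rewrite <- Series_opp, <- Series_plus.
    + apply Series_ext; reflexivity.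
    + apply ex_series_Rabs, abs_summable_snd, Hu.
    + apply (ex_series_opp (V := R_NormedModule)). apply ex_series_Rabs, abs_summable_snd, Hv.
Qed.

Lemma CSeries_scal c u :
  abs_summable u -> CSeries (fun n => c * u n)%C = (c * CSeries u)%C.
Proof.
  intros Hu. destruct c as [p q]. unfold CSeries. simpl.
  pose proof (ex_series_Rabs _ (abs_summable_fst _ Hu)) as H1.
  pose proof (ex_series_Rabs _ (abs_summable_snd _ Hu)) as H2.
  assert (SC : forall c a, ex_series a -> ex_series (fun n : nat => c * a n)).
  { intros. apply (ex_series_scal (K := R_AbsRing) (V := R_NormedModule)); auto. }
  apply injective_projections; simpl.
  - rewrite <- !Series_scal_l, <- Series_minus; auto.
  - rewrite <- !Series_scal_l, <- Series_plus; auto.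
Qed.

Lemma CSeries_incr_1 u :
  abs_summable u -> CSeries u = (u O + CSeries (fun n => u (S n)))%C.
Proof.
  intros Hu. unfold CSeries. apply injective_projections; simpl; apply Series_incr_1.
  - apply ex_series_Rabs, abs_summable_fst, Hu.
  - apply ex_series_Rabs, abs_summable_snd, Hu.
Qed.

(** * Geometric majorants *)

Lemma ex_series_geom_scal (M q : R) : Rabs q < 1 -> ex_series (fun n => M * q ^ n).
Proof.
  intros Hq. apply (ex_series_scal (K := R_AbsRing) (V := R_NormedModule)).
  exists (/ (1 - q)). apply is_series_geom. auto.
Qed.

Lemma CSeries_geom_bound u (M q : R) :
  Rabs q < 1 -> (forall n, Cmod (u n) <= M * q ^ n) -> Cmod (CSeries u) <= 2 * (M / (1 - q)).
Proof.
  intros Hq H. unfold Rdiv. rewrite <- (Series_geom q Hq), <- Series_scal_l.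
  apply CSeries_bound; auto. apply ex_series_geom_scal. auto.
Qed.

(** Bernoulli's inequality with [/ q = 1 + h]: from [1 + n * h <= (/ q) ^ n] one gets
    [n * q ^ n <= / h]. *)
Lemma linear_geom_bounded (q : R) :
  0 < q < 1 -> exists K, 0 < K /\ forall n, (INR n + 1) * q ^ n <= K.
Proof.
  intros [H0 H1]. set (h := / q - 1).
  assert (Hh : 0 < h). { unfold h. apply Rlt_0_minus, (Rmult_lt_reg_r q); auto. rewrite Rinv_l; lra. }
  exists (1 + / h). split; [pose proof (Rinv_0_lt_compat _ Hh); lra |]. intros n.
  pose proof (poly n h Hh) as P. replace (1 + h) with (/ q) in P by (unfold h; ring).
  rewrite pow_inv in P. assert (Hq : 0 < q ^ n) by (apply pow_lt; auto).
  apply (Rmult_le_compat_r (q ^ n)) in P; [| lra]. rewrite Rinv_l in P by lra.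
  pose proof (pos_INR n).
  assert (E : h * / h = 1) by (apply Rinv_r; lra).
  assert (q ^ n <= 1). { rewrite <- (pow1 n). apply pow_incr; lra. }
  assert (INR n * q ^ n = / h * (h * (INR n * q ^ n))) by (field; lra).
  assert (0 < / h) by (apply Rinv_0_lt_compat; auto).
  nra.
Qed.

(** Write [q = t ^ 4] with [t * t = sqrt q]: two factors [t ^ n] absorb one linear factor each, and
    [sqrt q ^ n] is left over. *)
Lemma quadratic_geom_dominated (q : R) :
  0 < q < 1 -> exists K, 0 < K /\ forall n, (INR n + 1) ^ 2 * q ^ n <= K * (sqrt q) ^ n.
Proof.
  intros Hq. set (s := sqrt q). set (t := sqrt s).
  assert (Hs : 0 < s < 1).
  { unfold s. split; [apply sqrt_lt_R0; lra |]. rewrite <- sqrt_1. apply sqrt_lt_1; lra. }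
  assert (Ht : 0 < t < 1).
  { unfold t. split; [apply sqrt_lt_R0; lra |]. rewrite <- sqrt_1. apply sqrt_lt_1; lra. }
  destruct (linear_geom_bounded t Ht) as (K & HK & H).
  exists (K * K). split; [nra |]. intros n.
  assert (E1 : q = s * s) by (unfold s; rewrite sqrt_sqrt; lra).
  assert (E2 : s = t * t) by (unfold t; rewrite sqrt_sqrt; lra).
  specialize (H n). rewrite E1 at 1. rewrite Rpow_mult_distr.
  assert (0 < s ^ n) by (apply pow_lt; lra).
  assert (E3 : s ^ n = t ^ n * t ^ n) by (rewrite E2, Rpow_mult_distr; auto).
  pose proof (pos_INR n). assert (0 < t ^ n) by (apply pow_lt; lra).
  replace ((INR n + 1) ^ 2 * (s ^ n * s ^ n)) with
    (((INR n + 1) * t ^ n) * ((INR n + 1) * t ^ n) * s ^ n) by (rewrite E3; ring).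
  apply Rmult_le_compat_r; [lra |]. apply Rmult_le_compat; nra.
Qed.

Definition PS (a : nat -> C) (z : C) : C := CSeries (fun n => a n * z ^ n)%C.

Definition PS' (a : nat -> C) (n : nat) : C := (INR (S n) * a (S n))%C.

(** Bounded terms at radius [r] are what Abel's lemma turns into absolute convergence at every
    smaller modulus. Convergence at one real point and Cauchy's estimates both supply such a
    bound. *)
Definition coef_bounded (a : nat -> C) (r : R) : Prop :=
  0 < r /\ exists M, 0 < M /\ forall n, Cmod (a n) * r ^ n <= M.

Lemma coef_bounded_term a r : coef_bounded a r ->
  exists M, 0 < M /\ forall n z rho, Cmod z <= rho -> Cmod (a n * z ^ n) <= M * (rho / r) ^ n.
Proof.
  intros [Hr (M & HM & H)]. exists M. split; auto. intros n z rho Hz.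
  rewrite Cmod_mult, Cmod_pow. unfold Rdiv. rewrite Rpow_mult_distr, pow_inv.
  assert (0 < r ^ n) by (apply pow_lt; auto).
  assert (E : Cmod (a n) = (Cmod (a n) * r ^ n) * / r ^ n) by (field; lra).
  assert (Cmod z ^ n <= rho ^ n). { apply pow_incr. split; auto. apply Cmod_ge_0. }
  assert (0 <= Cmod z ^ n) by (apply pow_le, Cmod_ge_0).
  pose proof (Cmod_ge_0 (a n)).
  rewrite E. replace (M * (rho ^ n * / r ^ n)) with (M * / r ^ n * rho ^ n) by ring.
  apply Rmult_le_compat; auto.
  - rewrite <- E. auto.
  - apply Rmult_le_compat_r; auto. left. apply Rinv_0_lt_compat; auto.
Qed.

Lemma ratio_range x r : 0 <= x < r -> 0 <= x / r < 1.
Proof.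
  intros H. split; [apply Rdiv_le_0_compat; lra |].
  apply (Rmult_lt_reg_r r); [lra |]. unfold Rdiv. rewrite Rmult_assoc, Rinv_l; lra.
Qed.

Lemma PS_abs_summable a r z :
  coef_bounded a r -> Cmod z < r -> abs_summable (fun n => a n * z ^ n)%C.
Proof.
  intros Ha Hz. destruct (coef_bounded_term a r Ha) as (M & HM & H).
  apply abs_summable_le with (fun n => M * (Cmod z / r) ^ n).
  - intros n. apply H. lra.
  - pose proof (Cmod_ge_0 z). destruct (ratio_range (Cmod z) r ltac:(lra)).
    apply ex_series_geom_scal. rewrite Rabs_pos_eq; lra.
Qed.

(** The linear factor from differentiation is absorbed by the powers of [r1 / r], which is why the
    radius has to shrink. *)
Lemma coef_bounded_PS' a r r1 : coef_bounded a r -> 0 < r1 < r -> coef_bounded (PS' a) r1.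
Proof.
  intros [Hr (M & HM & H)] [H0 H1]. split; auto.
  destruct (linear_geom_bounded (r1 / r)) as (K & HK & HL).
  { split; [apply Rdiv_lt_0_compat; lra | apply ratio_range; lra]. }
  assert (Hir : 0 < / r) by (apply Rinv_0_lt_compat; auto).
  exists (M * / r * K). split; [apply Rmult_lt_0_compat; nra |]. intros n. unfold PS'.
  rewrite Cmod_mult, Cmod_R, Rabs_pos_eq by apply pos_INR.
  specialize (H (S n)). specialize (HL n).
  unfold Rdiv in HL. rewrite Rpow_mult_distr, pow_inv in HL. rewrite S_INR.
  simpl in H.
  assert (P : 0 < r ^ n) by (apply pow_lt; auto).
  assert (Pi : 0 < / r ^ n) by (apply Rinv_0_lt_compat; auto).
  replace ((INR n + 1) * Cmod (a (S n)) * r1 ^ n) with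
   ((Cmod (a (S n)) * (r * r ^ n)) * / r * ((INR n + 1) * (r1 ^ n * / r ^ n))) by (field; lra).
  apply Rmult_le_compat; auto.
  - apply Rmult_le_pos; [| lra]. apply Rmult_le_pos; [apply Cmod_ge_0 | nra].
  - pose proof (pos_INR n). assert (0 < r1 ^ n) by (apply pow_lt; auto).
    apply Rmult_le_pos; nra.
  - apply Rmult_le_compat_r; [lra |]. exact H.
Qed.

(** The natural bound carries [rho] to the power [m - 1]; multiplying by [rho] avoids the truncated
    exponent. In the induction the new remainder is [w] times the old one plus
    [INR (S m) * z ^ m * (w - z) ^ 2]. *)
Lemma pow_taylor_remainder (z w : C) (rho : R) (m : nat) :
  Cmod z <= rho -> Cmod w <= rho ->
  rho * Cmod (w ^ S m - z ^ S m - INR (S m) * z ^ m * (w - z)) <=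
  (INR m + 1) ^ 2 * rho ^ m * Cmod (w - z) ^ 2.
Proof.
  intros Hz Hw. assert (Hr : 0 <= rho) by (pose proof (Cmod_ge_0 z); lra).
  induction m as [| m IH].
  - replace (w ^ 1 - z ^ 1 - INR 1 * z ^ 0 * (w - z))%C with (RtoC 0).
    + rewrite Cmod_0. simpl. pose proof (Cmod_ge_0 (w - z)). nra.
    + simpl. ring.
  - assert (E : (w ^ S (S m) - z ^ S (S m) - INR (S (S m)) * z ^ S m * (w - z) =
      w * (w ^ S m - z ^ S m - INR (S m) * z ^ m * (w - z)) +
      INR (S m) * z ^ m * ((w - z) * (w - z)))%C).
    { rewrite (S_INR (S m)). rewrite RtoC_plus. rewrite !Cpow_S. ring. }
    rewrite E. eapply Rle_trans; [apply Rmult_le_compat_l; [auto | apply Cmod_triangle] |].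
    rewrite !Cmod_mult, Cmod_pow, Cmod_R, Rabs_pos_eq by apply pos_INR.
    assert (Hzm : Cmod z ^ m <= rho ^ m) by (apply pow_incr; split; auto; apply Cmod_ge_0).
    rewrite (S_INR m) in *. simpl (rho ^ S m).
    set (d := Cmod (w - z)) in *. assert (0 <= d) by apply Cmod_ge_0.
    match goal with |- context [Cmod w * ?X] => set (e := X) in * end.
    assert (0 <= e) by apply Cmod_ge_0.
    assert (0 <= rho ^ m) by (apply pow_le; auto).
    pose proof (pos_INR m). pose proof (Cmod_ge_0 w). pose proof (Cmod_ge_0 z).
    assert (A1 : rho * (Cmod w * e) <= rho * ((INR m + 1) ^ 2 * rho ^ m * d ^ 2)).
    { apply Rle_trans with (rho * (rho * e)); apply Rmult_le_compat_l; nra. }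
    assert (A2 : rho * ((INR m + 1) * Cmod z ^ m * (d * d)) <= rho * ((INR m + 1) * rho ^ m * (d * d))).
    { apply Rmult_le_compat_l; auto. apply Rmult_le_compat_r; [nra |].
      apply Rmult_le_compat_l; nra. }
    assert (A3 : 0 <= rho * rho ^ m * (d * d)) by (apply Rmult_le_pos; nra).
    nra.
Qed.

(** The second-order remainders of the single terms are summed: on the disc of radius [rho] their
    sum is at most a constant times [Cmod (w - z) ^ 2]. *)
Theorem PS_cderiv a r z :
  coef_bounded a r -> Cmod z < r -> cderiv (PS a) z (PS (PS' a) z).
Proof.
  intros Ha Hz. pose proof Ha as [Hr0 _].
  pose proof (Cmod_ge_0 z) as Hz0.
  set (rho := (Cmod z + r) / 2).
  assert (Hrho : Cmod z < rho < r) by (unfold rho; lra).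
  (* The derived coefficients are bounded only at radii smaller than [r], and this one still exceeds
     [Cmod z]. *)
  set (rho' := (rho + r) / 2).
  assert (Hrho' : rho < rho' < r) by (unfold rho'; lra).
  assert (Ha' : coef_bounded (PS' a) rho') by (apply coef_bounded_PS' with r; auto; lra).
  destruct Ha as [Hr (M & HM & HaM)].
  assert (Ha : coef_bounded a r) by (split; eauto).
  assert (Hq : 0 < rho / r < 1).
  { split; [apply Rdiv_lt_0_compat; lra | apply ratio_range; lra]. }
  destruct (quadratic_geom_dominated _ Hq) as (K & HK & HKn).
  set (s := sqrt (rho / r)) in *.
  assert (Hs : 0 < s < 1).
  { unfold s. split; [apply sqrt_lt_R0; lra |]. rewrite <- sqrt_1. apply sqrt_lt_1; lra. }
  (* The coefficient is at most [M / r ^ S n], the remainder of the power contributes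
     [rho ^ n / rho], and [K] trades the quadratic factor for the ratio [s]. *)
  set (B := M / (rho * r) * K).
  assert (HB : 0 < B).
  { unfold B. apply Rmult_lt_0_compat; auto. apply Rdiv_lt_0_compat; auto. apply Rmult_lt_0_compat; lra. }
  assert (Key : forall w, Cmod w <= rho ->
    Cmod (PS a w - PS a z - PS (PS' a) z * (w - z)) <= 2 * (B / (1 - s)) * Cmod (w - z) ^ 2).
  { intros w Hw.
    pose proof (PS_abs_summable a r z Ha ltac:(lra)) as S1.
    pose proof (PS_abs_summable a r w Ha ltac:(lra)) as S2.
    pose proof (PS_abs_summable (PS' a) rho' z Ha' ltac:(lra)) as S3.
    unfold PS. rewrite (CSeries_incr_1 _ S1), (CSeries_incr_1 _ S2).
    pose proof (proj1 (abs_summable_incr_1 _) S1) as T1.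
    pose proof (proj1 (abs_summable_incr_1 _) S2) as T2.
    rewrite (Cmult_comm (CSeries _) (w - z)).
    rewrite <- (CSeries_scal (w - z) _ S3).
    match goal with |- Cmod ?e <= _ => replace e with
      (CSeries (fun n => a (S n) * w ^ S n) - CSeries (fun n => a (S n) * z ^ S n) -
       CSeries (fun n => (w - z) * (PS' a n * z ^ n)))%C by (simpl; ring) end.
    rewrite <- (CSeries_minus _ _ T2 T1).
    rewrite <- (CSeries_minus _ _ (abs_summable_minus _ _ T2 T1) (abs_summable_scal (w - z) _ S3)).
    replace (2 * (B / (1 - s)) * Cmod (w - z) ^ 2) with (2 * ((B * Cmod (w - z) ^ 2) / (1 - s)))
      by (field; lra).
    apply CSeries_geom_bound. { rewrite Rabs_pos_eq; lra. }
    intros n. unfold PS'.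
    replace (a (S n) * w ^ S n - a (S n) * z ^ S n - (w - z) * (INR (S n) * a (S n) * z ^ n))%C
      with (a (S n) * (w ^ S n - z ^ S n - INR (S n) * z ^ n * (w - z)))%C by ring.
    rewrite Cmod_mult.
    pose proof (pow_taylor_remainder z w rho n ltac:(lra) ltac:(lra)) as P.
    match type of P with rho * ?X <= _ => set (e := X) in * end.
    assert (He : 0 <= e) by apply Cmod_ge_0.
    specialize (HaM (S n)). specialize (HKn n). set (d := Cmod (w - z)) in *.
    assert (Hd : 0 <= d) by apply Cmod_ge_0.
    assert (Prn : 0 < r ^ n) by (apply pow_lt; auto).
    assert (E1 : Cmod (a (S n)) <= M / (r * r ^ n)).
    { apply (Rmult_le_reg_r (r * r ^ n)); [nra |]. unfold Rdiv.
      rewrite Rmult_assoc, Rinv_l by nra. simpl in HaM. lra. }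
    assert (E2 : e <= (INR n + 1) ^ 2 * rho ^ n * d ^ 2 / rho).
    { apply (Rmult_le_reg_l rho); [lra |]. unfold Rdiv.
      replace (rho * ((INR n + 1) ^ 2 * rho ^ n * d ^ 2 * / rho)) with ((INR n + 1) ^ 2 * rho ^ n * d ^ 2)
        by (field; lra). exact P. }
    eapply Rle_trans. { apply Rmult_le_compat; [apply Cmod_ge_0 | auto | exact E1 | exact E2]. }
    replace (M / (r * r ^ n) * ((INR n + 1) ^ 2 * rho ^ n * d ^ 2 / rho)) with
      (M / (rho * r) * d ^ 2 * ((INR n + 1) ^ 2 * (rho / r) ^ n)).
    - unfold B. replace (M / (rho * r) * K * d ^ 2 * s ^ n) with (M / (rho * r) * d ^ 2 * (K * s ^ n)) by ring.
      apply Rmult_le_compat_l; auto.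
      apply Rmult_le_pos; [| nra]. left. apply Rdiv_lt_0_compat; auto. apply Rmult_lt_0_compat; lra.
    - unfold Rdiv. rewrite Rpow_mult_distr, pow_inv. field. repeat split; lra. }
  apply cderiv_eps. intros eps Heps.
  set (Q := 2 * (B / (1 - s))) in *.
  assert (HQ : 0 < Q). { unfold Q. apply Rmult_lt_0_compat; [lra |]. apply Rdiv_lt_0_compat; lra. }
  exists (Rmin (rho - Cmod z) (eps / Q)). split.
  { apply Rmin_pos; [lra |]. apply Rdiv_lt_0_compat; auto. }
  intros w Hw.
  assert (H1 : Cmod (w - z) < rho - Cmod z) by (eapply Rlt_le_trans; [exact Hw | apply Rmin_l]).
  assert (H2 : Cmod (w - z) < eps / Q) by (eapply Rlt_le_trans; [exact Hw | apply Rmin_r]).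
  pose proof (Cmod_triangle_rev w z).
  eapply Rle_trans; [apply Key; lra |].
  pose proof (Cmod_ge_0 (w - z)).
  assert (Q * Cmod (w - z) <= eps).
  { apply Rlt_le. apply (Rmult_lt_compat_l Q) in H2; auto.
    replace (Q * (eps / Q)) with eps in H2 by (field; lra). exact H2. }
  simpl. rewrite Rmult_1_r, <- Rmult_assoc. apply Rmult_le_compat_r; auto.
Qed.

Lemma PS_C1_holomorphic a r q :
  coef_bounded a r ->
  C1_holomorphic (disc q r) (fun z => PS a (z - q)%C) (fun z => PS (PS' a) (z - q)%C).
Proof.
  intros Ha z Hz. unfold disc in Hz.
  assert (Ds : cderiv (fun z => z - q)%C z 1).
  { eapply cderiv_eq; [apply cderiv_minus; [apply cderiv_id | apply cderiv_const] |]. ring. }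
  pose proof (Cmod_ge_0 (z - q)). split.
  - eapply cderiv_eq; [apply (cderiv_comp (fun z => z - q)%C (PS a)); [exact Ds |] |].
    + apply (PS_cderiv a r); auto.
    + ring.
  - apply ccont_comp with (F := (fun z => z - q)%C).
    + eapply cderiv_ccont; exact Ds.
    + eapply cderiv_ccont. apply (PS_cderiv (PS' a) ((Cmod (z - q) + r) / 2)); [| lra].
      apply coef_bounded_PS' with r; auto. lra.
Qed.

(** * Curves in the complex plane *)

(** Coordinatewise, so that real one-variable rules apply; [pderiv_is_derive] identifies it with the
    derivative used in [C1_path]. *)
Definition pderiv (g : R -> C) (t : R) (d : C) : Prop :=
  is_derive (fun s => fst (g s)) t (fst d) /\ is_derive (fun s => snd (g s)) t (snd d).

Definition pcont (g : R -> C) (t : R) : Prop :=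
  continuous (T := R_UniformSpace) (U := C_UniformSpace) g t.

Lemma pderiv_is_derive g t d :
  pderiv g t d <-> is_derive (K := R_AbsRing) (V := C_R_NormedModule) g t d.
Proof.
  split.
  - intros [H1 H2]. destruct d as [p q]. simpl in *.
    apply (filterdiff_ext (K := R_AbsRing) (U := R_NormedModule) (V := C_R_NormedModule)
       (fun s => (fst (g s), snd (g s)))).
    { intros s. destruct (g s); reflexivity. }
    apply (filterdiff_ext_lin (K := R_AbsRing) (U := R_NormedModule) (V := C_R_NormedModule) _
      (fun y => (scal y p, scal y q))).
    2: { intros y. reflexivity. }
    apply (filterdiff_comp'_2 (K := R_AbsRing) (T := R_NormedModule) (U := R_NormedModule) (V := R_NormedModule)
       (W := C_R_NormedModule) (fun s => fst (g s)) (fun s => snd (g s)) (fun a b => (a, b)) t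
       (fun y => scal y p) (fun y => scal y q) (fun a b => (a, b))); auto.
    apply (filterdiff_ext (K := R_AbsRing) (fun x => x)).
    { intros [a b]; reflexivity. }
    apply (filterdiff_ext_lin (K := R_AbsRing) _ (fun x => x)).
    + apply filterdiff_id.
    + intros [a b]; reflexivity.
  - intros H. split.
    + apply (filterdiff_ext_lin (K := R_AbsRing) (U := R_NormedModule) (V := R_NormedModule) _
        (fun y => fst (scal (V := C_R_NormedModule) y d))).
      * apply (filterdiff_comp' (K := R_AbsRing) (U := R_NormedModule) (V := C_R_NormedModule)
          (W := R_NormedModule) g (fun z => fst z)); auto.
        apply filterdiff_linear, is_linear_fst.
      * reflexivity.
    + apply (filterdiff_ext_lin (K := R_AbsRing) (U := R_NormedModule) (V := R_NormedModule) _
        (fun y => snd (scal (V := C_R_NormedModule) y d))).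
      * apply (filterdiff_comp' (K := R_AbsRing) (U := R_NormedModule) (V := C_R_NormedModule)
          (W := R_NormedModule) g (fun z => snd z)); auto.
        apply filterdiff_linear, is_linear_snd.
      * reflexivity.
Qed.

Lemma pcont_iff g t :
  pcont g t <-> continuous (fun s => fst (g s)) t /\ continuous (fun s => snd (g s)) t.
Proof.
  split.
  - intros H. split.
    + apply (continuous_comp g fst); [exact H |].
      apply (continuous_fst (U := R_UniformSpace) (V := R_UniformSpace)).
    + apply (continuous_comp g snd); [exact H |].
      apply (continuous_snd (U := R_UniformSpace) (V := R_UniformSpace)).
  - intros [H1 H2].
    apply (continuous_ext (T := R_UniformSpace) (U := C_UniformSpace) (fun s => (fst (g s), snd (g s)))).
    { intros s. destruct (g s); reflexivity. }
    apply (continuous_comp_2 (U := R_UniformSpace) (V := R_UniformSpace) (W := R_UniformSpace)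
     (X := C_UniformSpace) (fun s => fst (g s)) (fun s => snd (g s)) (fun a b => (a, b))); auto.
    apply (continuous_ext (T := C_UniformSpace) (U := C_UniformSpace) (fun s => s)).
    { intros [a b]; reflexivity. }
    apply continuous_id.
Qed.

Lemma pderiv_pcont g t d : pderiv g t d -> pcont g t.
Proof.
  intros [H1 H2]. apply pcont_iff.
  split; apply ex_derive_continuous_R; eexists; eauto.
Qed.

Lemma pderiv_eq g t d d' : pderiv g t d' -> d' = d -> pderiv g t d.
Proof. intros; subst; auto. Qed.

Lemma pderiv_comp F g t d e :
  cderiv F (g t) d -> pderiv g t e -> pderiv (fun s => F (g s)) t (d * e)%C.
Proof.
  intros H [G1 G2]. apply cderiv_D2 in H. destruct H as [H1 H2]. split.
  - apply (is_derive_ext (fun s => fst (F (fst (g s), snd (g s))))).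
    { intros s. rewrite <- surjective_pairing. reflexivity. }
    pose proof (D2_path (fun u v => fst (F (u, v))) _ _ _ _ _ _ _ H1 G1 G2) as K.
    simpl. replace (fst d * fst e - snd d * snd e) with (fst d * fst e + - snd d * snd e) by ring.
    exact K.
  - apply (is_derive_ext (fun s => snd (F (fst (g s), snd (g s))))).
    { intros s. rewrite <- surjective_pairing. reflexivity. }
    pose proof (D2_path (fun u v => snd (F (u, v))) _ _ _ _ _ _ _ H2 G1 G2) as K.
    simpl. replace (fst d * snd e + snd d * fst e) with (snd d * fst e + fst d * snd e) by ring.
    exact K.
Qed.

Lemma pcont_comp F g t : ccont F (g t) -> pcont g t -> pcont (fun s => F (g s)) t.
Proof.
  intros H1 H2. apply (continuous_comp g F); auto. apply ccont_continuous. exact H1.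
Qed.

Lemma pderiv_const c t : pderiv (fun _ => c) t 0.
Proof. split; apply is_derive_const_R. Qed.

Lemma pderiv_plus f g t a b :
  pderiv f t a -> pderiv g t b -> pderiv (fun s => f s + g s)%C t (a + b)%C.
Proof.
  intros [A1 A2] [B1 B2]. split; simpl; apply is_derive_plus_R; auto.
Qed.

Lemma pderiv_mult f g t a b :
  pderiv f t a -> pderiv g t b -> pderiv (fun s => f s * g s)%C t (a * g t + f t * b)%C.
Proof.
  intros [A1 A2] [B1 B2].
  assert (M : forall (u v : R -> R) p q, is_derive u t p -> is_derive v t q ->
    is_derive (fun s => u s * v s) t (p * v t + u t * q)).
  { intros. apply is_derive_mult_R; auto. }
  split; simpl.
  - eapply is_derive_ext; [intros s; reflexivity |].
    replace (fst a * fst (g t) - snd a * snd (g t) + (fst (f t) * fst b - snd (f t) * snd b)) with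
      ((fst a * fst (g t) + fst (f t) * fst b) - (snd a * snd (g t) + snd (f t) * snd b)) by ring.
    apply is_derive_minus_R; apply M; auto.
  - replace (fst a * snd (g t) + snd a * fst (g t) + (fst (f t) * snd b + snd (f t) * fst b)) with
      ((fst a * snd (g t) + fst (f t) * snd b) + (snd a * fst (g t) + snd (f t) * fst b)) by ring.
    apply is_derive_plus_R; apply M; auto.
Qed.

Lemma pderiv_scal c g t b : pderiv g t b -> pderiv (fun s => c * g s)%C t (c * b)%C.
Proof.
  intros H. eapply pderiv_eq; [apply pderiv_mult; [apply (pderiv_const c) | exact H] |]. cbv beta; ring.
Qed.

Lemma pderiv_RtoC g t b : is_derive g t b -> pderiv (fun s => RtoC (g s)) t (RtoC b).
Proof.
  intros H; split; simpl; auto. apply is_derive_const_R.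
Qed.

Lemma pderiv_pow g t b n :
  pderiv g t b -> pderiv (fun s => g s ^ S n)%C t (INR (S n) * g t ^ n * b)%C.
Proof.
  intros H. induction n as [| n IH].
  - eapply pderiv_eq; [apply (pderiv_mult _ _ _ _ _ H (pderiv_const 1 t)) |]. simpl; ring.
  - eapply pderiv_eq; [apply (pderiv_mult _ _ _ _ _ H IH) |].
    rewrite (S_INR (S n)), RtoC_plus. rewrite !Cpow_S. ring.
Qed.

Lemma pcont_const c t : pcont (fun _ => c) t.
Proof. eapply pderiv_pcont, pderiv_const. Qed.

Lemma pcont_plus f g t : pcont f t -> pcont g t -> pcont (fun s => f s + g s)%C t.
Proof.
  rewrite !pcont_iff. intros [A1 A2] [B1 B2]. split; simpl;
  apply (continuous_plus (K := R_AbsRing) (V := R_NormedModule)); auto.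
Qed.

Lemma pcont_mult f g t : pcont f t -> pcont g t -> pcont (fun s => f s * g s)%C t.
Proof.
  rewrite !pcont_iff. intros [A1 A2] [B1 B2]. split; simpl.
  - apply (continuous_minus (K := R_AbsRing) (V := R_NormedModule));
    apply (continuous_mult (K := R_AbsRing)); auto.
  - apply (continuous_plus (K := R_AbsRing) (V := R_NormedModule));
    apply (continuous_mult (K := R_AbsRing)); auto.
Qed.

Lemma pcont_inv f t : pcont f t -> f t <> 0 -> pcont (fun s => / f s)%C t.
Proof.
  intros H H0. apply pcont_comp with (F := Cinv); auto.
  apply ccont_inv with (F := fun w => w); auto. apply ccont_id.
Qed.

(** * Integrals of complex-valued functions of a real variable *)

Definition CInt (f : R -> C) (a b : R) : C :=
  (RInt (fun t => fst (f t)) a b, RInt (fun t => snd (f t)) a b).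

Definition pcont_on (f : R -> C) (a b : R) : Prop := forall t, Rmin a b <= t <= Rmax a b -> pcont f t.

Lemma pcont_ex_RInt f a b : pcont_on f a b ->
  ex_RInt (fun t => fst (f t)) a b /\ ex_RInt (fun t => snd (f t)) a b.
Proof.
  intros H. split; apply (ex_RInt_continuous (V := R_CompleteNormedModule));
  intros t Ht; apply H in Ht; apply pcont_iff in Ht; apply Ht.
Qed.

Lemma CInt_ext f g a b :
  (forall t, Rmin a b <= t <= Rmax a b -> f t = g t) -> CInt f a b = CInt g a b.
Proof.
  intros H. unfold CInt. f_equal; apply RInt_ext; intros t Ht; rewrite H; auto; lra.
Qed.

Lemma CInt_plus f g a b :
  pcont_on f a b -> pcont_on g a b ->
  CInt (fun t => f t + g t)%C a b = (CInt f a b + CInt g a b)%C.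
Proof.
  intros Hf Hg. destruct (pcont_ex_RInt _ _ _ Hf), (pcont_ex_RInt _ _ _ Hg).
  unfold CInt. apply injective_projections; simpl;
  apply (RInt_plus (V := R_CompleteNormedModule)); auto.
Qed.

Lemma CInt_scal c f a b :
  pcont_on f a b -> CInt (fun t => c * f t)%C a b = (c * CInt f a b)%C.
Proof.
  intros Hf. destruct (pcont_ex_RInt _ _ _ Hf) as [H1 H2].
  assert (S1 : forall k u, ex_RInt u a b -> ex_RInt (fun t => k * u t) a b).
  { intros. apply (ex_RInt_scal (V := R_NormedModule)); auto. }
  assert (S2 : forall k u, ex_RInt u a b -> RInt (fun t => k * u t) a b = k * RInt u a b).
  { intros. apply (RInt_scal (V := R_CompleteNormedModule)); auto. }
  unfold CInt. apply injective_projections; simpl.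
  - rewrite <- !S2 by auto. apply (RInt_minus (V := R_CompleteNormedModule)); auto.
  - rewrite <- !S2 by auto. apply (RInt_plus (V := R_CompleteNormedModule)); auto.
Qed.

Lemma CInt_bound f a b B :
  a <= b -> pcont_on f a b -> (forall t, a <= t <= b -> Cmod (f t) <= B) ->
  Cmod (CInt f a b) <= 2 * ((b - a) * B).
Proof.
  intros Hab Hf HB. destruct (pcont_ex_RInt _ _ _ Hf) as [H1 H2].
  eapply Rle_trans; [apply Cmod_le_Rabs_sum |]. simpl.
  assert (A : forall u, ex_RInt u a b -> (forall t, a <= t <= b -> Rabs (u t) <= B) ->
    Rabs (RInt u a b) <= (b - a) * B).
  { intros u Hu Hb. apply (norm_RInt_le_const u a b _ B Hab).
    - exact Hb.
    - apply (RInt_correct (V := R_CompleteNormedModule)); auto. }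
  assert (Rabs (RInt (fun t => fst (f t)) a b) <= (b - a) * B).
  { apply A; auto. intros t Ht. eapply Rle_trans; [apply Cmod_ge_fst | auto]. }
  assert (Rabs (RInt (fun t => snd (f t)) a b) <= (b - a) * B).
  { apply A; auto. intros t Ht. eapply Rle_trans; [apply Cmod_ge_snd | auto]. }
  lra.
Qed.

Lemma CInt_pderiv f f' a b :
  (forall t, Rmin a b <= t <= Rmax a b -> pderiv f t (f' t)) -> pcont_on f' a b ->
  CInt f' a b = (f b - f a)%C.
Proof.
  intros H1 H2. unfold CInt. apply injective_projections; simpl.
  - apply is_RInt_unique. apply (is_RInt_derive (V := R_CompleteNormedModule) (fun t => fst (f t))).
    + intros t Ht. apply H1; auto.
    + intros t Ht. apply H2 in Ht. apply pcont_iff in Ht. apply Ht.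
  - apply is_RInt_unique. apply (is_RInt_derive (V := R_CompleteNormedModule) (fun t => snd (f t))).
    + intros t Ht. apply H1; auto.
    + intros t Ht. apply H2 in Ht. apply pcont_iff in Ht. apply Ht.
Qed.

Lemma CInt_is_RInt f a b :
  pcont_on f a b -> is_RInt (V := C_R_NormedModule) f a b (CInt f a b).
Proof.
  intros Hf. destruct (pcont_ex_RInt _ _ _ Hf) as [H1 H2].
  apply is_RInt_fct_extend_pair; apply (RInt_correct (V := R_CompleteNormedModule)); auto.
Qed.

Lemma is_RInt_CInt f a b l :
  is_RInt (V := C_R_NormedModule) f a b l -> l = CInt f a b.
Proof.
  intros H. destruct l as [p q]. unfold CInt. symmetry. apply injective_projections; simpl.
  - apply is_RInt_unique. apply (is_RInt_fct_extend_fst _ _ _ _ H).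
  - apply is_RInt_unique. apply (is_RInt_fct_extend_snd _ _ _ _ H).
Qed.

(** * Cauchy's formula and Taylor expansion *)

Lemma CInt_param (Phi Phi1 : R -> R -> C) (a b l0 : R) :
  locally l0 (fun l : R => forall t, pderiv (fun k => Phi k t) l (Phi1 l t)) ->
  (forall t, ccont (fun p => Phi1 (fst p) (snd p)) (l0, t)) ->
  locally l0 (fun l : R => pcont_on (Phi l) a b) ->
  pderiv (fun l => CInt (Phi l) a b) l0 (CInt (Phi1 l0) a b).
Proof.
  intros H1 H2 H3.
  assert (A : forall (pr : C -> R), (pr = fst \/ pr = snd) ->
     is_derive (fun l => RInt (fun t => pr (Phi l t)) a b) l0 (RInt (fun t => pr (Phi1 l0 t)) a b)).
  { intros pr Hpr.
    assert (D : locally l0 (fun l : R => forall t, is_derive (fun k => pr (Phi k t)) l (pr (Phi1 l t)))).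
    { revert H1. apply filter_imp. intros l Hl t. destruct (Hl t) as [A1 A2].
      destruct Hpr as [-> | ->]; auto. }
    assert (E : RInt (fun t => Derive (fun u => pr (Phi u t)) l0) a b = RInt (fun t => pr (Phi1 l0 t)) a b).
    { apply RInt_ext. intros t _. apply is_derive_unique. apply (locally_singleton _ _ D). }
    rewrite <- E.
    apply (is_derive_RInt_param (fun l t => pr (Phi l t))).
    - revert D. apply filter_imp. intros l Hl t _. eexists; apply Hl.
    - intros t _. apply continuity_2d_pt_ext_loc with (fun l t => pr (Phi1 l t)).
      + apply locally_2d_locally.
        destruct D as [e De]. exists e. intros [u v] [Hu Hv]. simpl.
        symmetry. apply is_derive_unique. apply De. exact Hu.
      + specialize (H2 t). apply ccont_iff_2d in H2. simpl in H2.
        destruct Hpr as [-> | ->]; apply H2.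
    - revert H3. apply filter_imp. intros l Hl. apply pcont_ex_RInt in Hl.
      destruct Hpr as [-> | ->]; apply Hl. }
  split; simpl; apply A; auto.
Qed.

(** * Parametrised circles *)

Definition ce (t : R) : C := (cos t, sin t).

Lemma Cmod_ce t : Cmod (ce t) = 1.
Proof.
  unfold Cmod, ce. simpl. pose proof (sin2_cos2 t) as E. unfold Rsqr in E.
  replace (cos t * (cos t * 1) + sin t * (sin t * 1)) with 1 by lra. apply sqrt_1.
Qed.

Lemma pderiv_ce t : pderiv ce t (Ci * ce t)%C.
Proof.
  split; simpl; auto_derive; auto; ring.
Qed.

Lemma ce_2PI : ce (2 * PI) = ce 0.
Proof. unfold ce. rewrite cos_2PI, sin_2PI, cos_0, sin_0. reflexivity. Qed.

Definition circ (r t : R) : C := (r * ce t)%C.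

Lemma Cmod_circ r t : 0 <= r -> Cmod (circ r t) = r.
Proof. intros H. unfold circ. rewrite Cmod_mult, Cmod_R, Cmod_ce, Rabs_pos_eq; lra. Qed.

Lemma circ_neq_0 r t : 0 < r -> circ r t <> 0.
Proof. intros H E. pose proof (Cmod_circ r t) as K. rewrite E, Cmod_0 in K. lra. Qed.

Lemma pderiv_circ r t : pderiv (circ r) t (Ci * circ r t)%C.
Proof.
  eapply pderiv_eq; [apply (pderiv_scal r), pderiv_ce |]. unfold circ. ring.
Qed.

Lemma pcont_circ r t : pcont (circ r) t.
Proof. eapply pderiv_pcont, pderiv_circ. Qed.

Lemma circ_2PI r : circ r (2 * PI) = circ r 0.
Proof. unfold circ. rewrite ce_2PI. reflexivity. Qed.

Lemma circ_sub_neq_0 r t z : Cmod z < r -> (circ r t - z)%C <> 0.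
Proof.
  intros H E. assert (circ r t = z) as Ez.
  { replace (circ r t) with ((circ r t - z) + z)%C by ring. rewrite E. ring. }
  assert (0 <= r) by (pose proof (Cmod_ge_0 z); lra).
  rewrite <- Ez, Cmod_circ in H; lra.
Qed.

Lemma ccont_of_pcont_snd (g : R -> C) (p : C) :
  pcont g (snd p) -> ccont (fun w => g (snd w)) p.
Proof.
  intros H. apply ccont_continuous.
  apply (continuous_comp (U := C_UniformSpace) (V := R_UniformSpace) (W := C_UniformSpace) snd g).
  - apply (continuous_snd (U := R_UniformSpace) (V := R_UniformSpace)).
  - exact H.
Qed.

Lemma ccont_RtoC_fst (p : C) : ccont (fun w => RtoC (fst w)) p.
Proof.
  apply ccont_iff_2d. simpl. split; [apply continuity_2d_pt_id1 | apply continuity_2d_pt_const].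
Qed.

Lemma pderiv_RtoC_id t : pderiv (fun s => RtoC s) t 1.
Proof. apply pderiv_RtoC with (g := fun s => s). apply (is_derive_id (K := R_AbsRing)). Qed.

Section Cauchy.

Variables (q : C) (rho r : R) (F F' : C -> C).
Hypothesis HF : C1_holomorphic (disc q rho) F F'.
Hypothesis Hr : 0 < r < rho.

(** A homotopy of closed curves: [l = 1] is the circle of radius [r] about [q], and [l = 0] is the
    constant curve at [q + z]. *)
Let cen (z : C) (l t : R) : C := (q + (z + l * (circ r t - z)))%C.

Lemma cen_disc z : Cmod z < r ->
  exists e, 0 < e /\ forall l t, - e < l < 1 + e -> disc q rho (cen z l t).
Proof.
  (* For this [e] one has [Rabs (1 - l) + Rabs l < 1 + 2 * e], so the distance to [q] stays below
     [(1 + 2 * e) * r = rho]. The margin around the unit interval serves the derivatives at [l = 0]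
     and [l = 1]. *)
  intros Hz. exists ((rho - r) / (2 * r)). split.
  { apply Rdiv_lt_0_compat; lra. }
  intros l t Hl. unfold disc, cen.
  replace (q + (z + l * (circ r t - z)) - q)%C with (RtoC (1 - l) * z + RtoC l * circ r t)%C
    by (rewrite RtoC_minus; ring).
  eapply Rle_lt_trans; [apply Cmod_triangle |].
  rewrite !Cmod_mult, !Cmod_R, Cmod_circ by lra.
  assert (E : (rho - r) / (2 * r) * (2 * r) = rho - r) by (field; lra).
  assert (He : 0 < (rho - r) / (2 * r)) by (apply Rdiv_lt_0_compat; lra).
  set (e := (rho - r) / (2 * r)) in *. pose proof (Cmod_ge_0 z).
  assert (Rabs (1 - l) * Cmod z <= Rabs (1 - l) * r).
  { apply Rmult_le_compat_l; [apply Rabs_pos | lra]. }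
  assert (Rabs (1 - l) + Rabs l < 1 + 2 * e).
  { unfold Rabs; destruct (Rcase_abs (1 - l)), (Rcase_abs l); lra. }
  nra.
Qed.

Lemma pderiv_cen_l z l t : pderiv (fun k => cen z k t) l (circ r t - z)%C.
Proof.
  unfold cen. eapply pderiv_eq.
  - apply pderiv_plus; [apply pderiv_const |].
    apply pderiv_plus; [apply pderiv_const |].
    apply pderiv_mult; [apply pderiv_RtoC_id | apply pderiv_const].
  - cbv beta. ring.
Qed.

Lemma pderiv_cen_t z l t : pderiv (fun s => cen z l s) t (l * (Ci * circ r t))%C.
Proof.
  unfold cen. eapply pderiv_eq.
  - apply pderiv_plus; [apply pderiv_const |].
    apply pderiv_plus; [apply pderiv_const |].
    apply pderiv_scal. apply pderiv_plus; [apply pderiv_circ | apply pderiv_const].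
  - ring.
Qed.

Lemma ccont_cen z p : ccont (fun w => cen z (fst w) (snd w)) p.
Proof.
  unfold cen. apply ccont_plus; [apply ccont_const |]. apply ccont_plus; [apply ccont_const |].
  apply ccont_mult; [apply ccont_RtoC_fst |].
  apply ccont_minus; [| apply ccont_const]. apply ccont_of_pcont_snd. apply pcont_circ.
Qed.

(** Times [l * Ci], the integrand is the [t]-derivative of [F (cen z l t)] along a closed curve. At
    [l = 0] this factor cannot be divided out; there [F'] is constant along the curve and [circ]
    itself integrates to 0. *)
Lemma CInt_cen_deriv_zero z l :
  Cmod z < r -> 0 <= l <= 1 ->
  CInt (fun t => F' (cen z l t) * circ r t)%C 0 (2 * PI) = 0.
Proof.
  intros Hz Hl. destruct (cen_disc z Hz) as (e & He & HD).
  assert (P1 : forall t, pcont (fun t => F' (cen z l t) * circ r t)%C t).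
  { intros t. apply pcont_mult; [| apply pcont_circ].
    apply pcont_comp; [apply HF, HD; lra |]. eapply pderiv_pcont, pderiv_cen_t. }
  assert (C0 : CInt (circ r) 0 (2 * PI) = 0).
  { assert (K : (Ci * CInt (circ r) 0 (2 * PI))%C = 0).
    { rewrite <- CInt_scal by (intros t _; apply pcont_circ).
      rewrite (CInt_pderiv (circ r)).
      - rewrite circ_2PI. ring.
      - intros t _. apply pderiv_circ.
      - intros t _. apply pcont_mult; [apply pcont_const | apply pcont_circ]. }
    replace (CInt (circ r) 0 (2 * PI)) with (- Ci * (Ci * CInt (circ r) 0 (2 * PI)))%C.
    - rewrite K. ring.
    - apply injective_projections; simpl; ring. }
  destruct (Req_dec l 0) as [-> | Hn].
  - rewrite (CInt_ext _ (fun t => F' (q + z) * circ r t)%C).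
    + rewrite CInt_scal by (intros t _; apply pcont_circ). rewrite C0. ring.
    + intros t _. unfold cen. do 2 f_equal. ring.
  - assert (K : (l * Ci * CInt (fun t => F' (cen z l t) * circ r t) 0 (2 * PI))%C = 0).
    { rewrite <- CInt_scal by (intros t _; apply P1).
      rewrite (CInt_ext _ (fun t => F' (cen z l t) * (l * (Ci * circ r t)))%C) by (intros; ring).
      rewrite (CInt_pderiv (fun t => F (cen z l t))).
      - unfold cen. rewrite circ_2PI. ring.
      - intros t _. apply pderiv_comp; [apply HF, HD; lra | apply pderiv_cen_t].
      - intros t _. apply pcont_mult.
        + apply pcont_comp; [apply HF, HD; lra |]. eapply pderiv_pcont, pderiv_cen_t.
        + apply pcont_mult; [apply pcont_const |]. apply pcont_mult; [apply pcont_const | apply pcont_circ]. }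
    assert (N : (l * Ci)%C <> 0).
    { apply Cmult_neq_0.
      - intros E. apply Hn. apply RtoC_inj. exact E.
      - intros E. apply (f_equal snd) in E. simpl in E. lra. }
    rewrite <- (Cmult_1_l (CInt _ _ _)), <- (Cinv_l _ N), <- Cmult_assoc, K. ring.
Qed.

Lemma pcont_kernel z t : Cmod z < r -> pcont (fun t => circ r t / (circ r t - z))%C t.
Proof.
  intros Hz. apply pcont_mult; [apply pcont_circ |].
  apply pcont_inv; [| apply circ_sub_neq_0; auto].
  apply pcont_plus; [apply pcont_circ | apply pcont_const].
Qed.

(** Cauchy's formula before the kernel integral is evaluated. Moving the argument of [F] along the
    homotopy, the [l]-derivative produces the factor [circ r t - z], which cancels the denominator
    and leaves the vanishing integral of [CInt_cen_deriv_zero]. *)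
Lemma Cauchy_kernel z :
  Cmod z < r ->
  CInt (fun t => F (q + circ r t) * (circ r t / (circ r t - z)))%C 0 (2 * PI) =
  (F (q + z) * CInt (fun t => circ r t / (circ r t - z)) 0 (2 * PI))%C.
Proof.
  intros Hz. destruct (cen_disc z Hz) as (e & He & HD).
  set (Phi := fun l t => (F (cen z l t) * (circ r t / (circ r t - z)))%C).
  assert (Dz : forall l, 0 <= l <= 1 -> pderiv (fun k => CInt (Phi k) 0 (2 * PI)) l 0).
  { intros l Hl.
    assert (L : locally l (fun k : R => - e < k < 1 + e)).
    { exists (mkposreal e He). intros k Hk. change (Rabs (k - l) < e) in Hk.
      apply Rabs_def2 in Hk. lra. }
    rewrite <- (CInt_cen_deriv_zero z l Hz Hl).
    apply (CInt_param Phi (fun l t => F' (cen z l t) * circ r t)%C).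
    - revert L. apply filter_imp. intros k Hk t. unfold Phi. eapply pderiv_eq.
      + apply pderiv_mult; [| apply pderiv_const].
        apply pderiv_comp; [apply HF, HD; auto | apply pderiv_cen_l].
      + cbv beta. field. apply circ_sub_neq_0; auto.
    - intros t. apply ccont_mult.
      + apply (ccont_comp (fun p => cen z (fst p) (snd p)) F'); [apply ccont_cen |].
        apply HF, HD. simpl. lra.
      + apply ccont_of_pcont_snd, pcont_circ.
    - revert L. apply filter_imp. intros k Hk t _. unfold Phi. apply pcont_mult.
      + eapply pderiv_pcont. apply pderiv_comp; [apply HF, HD; auto | apply pderiv_cen_t].
      + apply pcont_kernel; auto. }
  assert (E : CInt (Phi 0) 0 (2 * PI) = CInt (Phi 1) 0 (2 * PI)).
  { apply injective_projections.
    - apply (eq_is_derive (V := R_NormedModule) (fun l => fst (CInt (Phi l) 0 (2 * PI)))); [| lra].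
      intros t Ht. apply (Dz t Ht).
    - apply (eq_is_derive (V := R_NormedModule) (fun l => snd (CInt (Phi l) 0 (2 * PI)))); [| lra].
      intros t Ht. apply (Dz t Ht). }
  rewrite <- CInt_scal by (intros t _; apply pcont_kernel; auto).
  transitivity (CInt (Phi 1) 0 (2 * PI)).
  - apply CInt_ext. intros t _. unfold Phi, cen. do 2 f_equal. ring.
  - rewrite <- E. apply CInt_ext. intros t _. unfold Phi, cen. do 2 f_equal. ring.
Qed.

End Cauchy.

Fixpoint csum (u : nat -> C) (n : nat) : C :=
  match n with O => 0 | S m => csum u m + u m end.

Section Expansion.

Variables (r B : R) (h : R -> C).
Hypothesis Hr : 0 < r.
Hypothesis Hh : forall t, pcont h t.
Hypothesis HB : forall t, 0 <= t <= 2 * PI -> Cmod (h t) <= B.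

(** A Taylor coefficient without the factor [/ (2 * PI)]. The boundary function [h] is any
    continuous one: [F] on the circle for Taylor's theorem, the constant 1 for the kernel
    integral. *)
Definition cauchy_coef (n : nat) : C := CInt (fun t => h t * (/ circ r t) ^ n)%C 0 (2 * PI).

Lemma pcont_pow f t n : pcont f t -> pcont (fun s => f s ^ n)%C t.
Proof.
  intros H. induction n; simpl; [apply pcont_const | apply pcont_mult; auto].
Qed.

Lemma pcont_inv_circ t : pcont (fun s => / circ r s)%C t.
Proof. apply pcont_inv; [apply pcont_circ | apply circ_neq_0; auto]. Qed.

Lemma cauchy_coef_bound n : Cmod (cauchy_coef n) * r ^ n <= 2 * (2 * PI * B).
Proof.
  pose proof PI_RGT_0 as HP.
  assert (P : 0 < r ^ n) by (apply pow_lt; auto).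
  assert (Cmod (cauchy_coef n) <= 2 * ((2 * PI - 0) * (B * / r ^ n))).
  { apply CInt_bound; [lra | |].
    - intros t _. apply pcont_mult; auto. apply pcont_pow, pcont_inv_circ.
    - intros t Ht. rewrite Cmod_mult, Cmod_pow, Cmod_inv, Cmod_circ, pow_inv;
        [| lra | apply circ_neq_0; auto].
      apply Rmult_le_compat_r; auto. left; apply Rinv_0_lt_compat; auto. }
  apply (Rmult_le_compat_r (r ^ n)) in H; [| lra].
  eapply Rle_trans; [exact H |]. right. field. lra.
Qed.

(** The kernel [circ / (circ - z)] is a geometric series in [z / circ]; after [N] terms the rest is
    [(z / circ) ^ N] times the kernel, and the kernel is at most [r / (r - Cmod z)] on the
    circle. *)
Lemma cauchy_expansion z N :
  Cmod z < r ->
  Cmod (CInt (fun t => h t * (circ r t / (circ r t - z)))%C 0 (2 * PI) -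
        csum (fun n => z ^ n * cauchy_coef n)%C N) <=
  2 * (2 * PI * (B * (r / (r - Cmod z)))) * (Cmod z / r) ^ N.
Proof.
  intros Hz. pose proof PI_RGT_0 as HP.
  set (rem := fun N => CInt (fun t => (z * / circ r t) ^ N * (h t * (circ r t / (circ r t - z))))%C 0 (2 * PI)).
  assert (PK : forall t, pcont (fun t => h t * (circ r t / (circ r t - z)))%C t).
  { intros t. apply pcont_mult; auto. apply pcont_kernel; auto. }
  assert (PR : forall N t, pcont (fun t => (z * / circ r t) ^ N * (h t * (circ r t / (circ r t - z))))%C t).
  { intros M t. apply pcont_mult; auto. apply pcont_pow. apply pcont_mult; [apply pcont_const | apply pcont_inv_circ]. }
  assert (E : CInt (fun t => h t * (circ r t / (circ r t - z)))%C 0 (2 * PI) =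
    (csum (fun n => z ^ n * cauchy_coef n) N + rem N)%C).
  { clear HB. induction N as [| N IH].
    - simpl. rewrite Cplus_0_l. apply CInt_ext. intros t _. simpl. ring.
    - rewrite IH. simpl csum. rewrite <- Cplus_assoc. f_equal.
      unfold cauchy_coef, rem. rewrite <- CInt_scal, <- CInt_plus.
      + apply CInt_ext. intros t _. rewrite Cpow_mult_l. rewrite Cpow_S.
        rewrite Cpow_mult_l. field. split; [apply circ_sub_neq_0; auto | apply circ_neq_0; auto].
      + intros t _. apply pcont_mult; [apply pcont_const |]. apply pcont_mult; auto.
        apply pcont_pow, pcont_inv_circ.
      + intros t _. apply PR.
      + intros t _. apply pcont_mult; auto. apply pcont_pow, pcont_inv_circ. }
  rewrite E. replace (csum (fun n => z ^ n * cauchy_coef n)%C N + rem N -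
     csum (fun n => z ^ n * cauchy_coef n)%C N)%C with (rem N) by ring.
  replace (2 * (2 * PI * (B * (r / (r - Cmod z)))) * (Cmod z / r) ^ N) with
    (2 * ((2 * PI - 0) * ((Cmod z / r) ^ N * (B * (r / (r - Cmod z)))))) by ring.
  apply CInt_bound; [lra | intros t _; apply PR |].
  intros t Ht. pose proof (Cmod_ge_0 z).
  rewrite Cmod_mult, Cmod_pow, Cmod_mult, Cmod_inv, Cmod_circ by (try lra; apply circ_neq_0; auto).
  apply Rmult_le_compat_l. { apply pow_le. apply Rdiv_le_0_compat; lra. }
  rewrite Cmod_mult. apply Rmult_le_compat; auto using Cmod_ge_0.
  rewrite Cmod_div by (apply circ_sub_neq_0; auto). rewrite Cmod_circ by lra.
  apply Rmult_le_compat_l; [lra |]. apply Rinv_le_contravar; [lra |].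
  pose proof (Cmod_triangle_rev (circ r t) z) as T. rewrite Cmod_circ in T by lra. exact T.
Qed.

End Expansion.

Lemma geom_small (M s eps : R) : 0 <= s < 1 -> 0 < eps -> 0 <= M ->
  exists N0, forall N, (N0 <= N)%nat -> M * s ^ N < eps.
Proof.
  intros Hs He HM.
  destruct (pow_lt_1_zero s) with (y := eps / (M + 1)) as [N H].
  { rewrite Rabs_pos_eq; lra. }
  { apply Rdiv_lt_0_compat; lra. }
  exists N. intros n Hn. specialize (H n Hn).
  assert (0 <= s ^ n) by (apply pow_le; lra). rewrite Rabs_pos_eq in H by auto.
  apply (Rmult_lt_compat_r (M + 1)) in H; [| lra].
  replace (eps / (M + 1) * (M + 1)) with eps in H by (field; lra). nra.
Qed.

(** The expansion of the constant 1: the coefficient of index 0 is [2 * PI], the others are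
    integrals of derivatives over a closed curve, and the remainder tends to 0. *)
Lemma kernel_integral r z :
  Cmod z < r -> CInt (fun t => circ r t / (circ r t - z))%C 0 (2 * PI) = RtoC (2 * PI).
Proof.
  intros Hz. pose proof (Cmod_ge_0 z) as Hz0. pose proof PI_RGT_0 as HP.
  assert (Hr : 0 < r) by lra.
  assert (C0 : cauchy_coef r (fun _ => RtoC 1) 0 = RtoC (2 * PI)).
  { unfold cauchy_coef, CInt. simpl. apply injective_projections; simpl;
    rewrite RInt_const; unfold scal; simpl; unfold mult; simpl; ring. }
  assert (Cn : forall n, cauchy_coef r (fun _ => RtoC 1) (S n) = 0).
  { intros n. unfold cauchy_coef.
    assert (D : forall t, pderiv (fun s => (/ circ r s) ^ S n)%C t (- (INR (S n) * Ci) * (1 * (/ circ r t) ^ S n))%C).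
    { intros t.
      assert (D1 : pderiv (fun s => / circ r s)%C t (- Ci * / circ r t)%C).
      (* The inverse of a point of the circle is a multiple of its conjugate, so it is
         differentiated without a quotient rule. *)
      { assert (Q : forall s, (/ circ r s)%C = (/ RtoC r * ce (- s))%C).
        { intros s.
          assert (Q1 : (circ r s * (/ r * ce (- s)))%C = 1).
          { unfold circ. replace (r * ce s * (/ r * ce (- s)))%C with ((r * / r) * (ce s * ce (- s)))%C by ring.
            rewrite Cinv_r. 2: { intros E. apply RtoC_inj in E. lra. }
            unfold ce. rewrite cos_neg, sin_neg. pose proof (sin2_cos2 s) as E. unfold Rsqr in E.
            apply injective_projections; simpl; lra. }
          rewrite <- (Cmult_1_r (/ circ r s)), <- Q1, Cmult_assoc, Cinv_l, Cmult_1_l; auto.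
          apply circ_neq_0; auto. }
        rewrite Q.
        assert (D0 : pderiv (fun s => / r * ce (- s))%C t (/ r * (- Ci * ce (- t)))%C).
        { apply pderiv_scal. split; simpl; auto_derive; auto; ring. }
        destruct D0 as [D01 D02].
        apply (pderiv_eq _ _ _ (/ r * (- Ci * ce (- t)))%C); [| ring].
        split.
        - eapply is_derive_ext; [| exact D01]. intros s. rewrite Q. reflexivity.
        - eapply is_derive_ext; [| exact D02]. intros s. rewrite Q. reflexivity. }
      eapply pderiv_eq; [apply (pderiv_pow _ _ _ n D1) |]. rewrite Cpow_S. ring. }
    assert (P : forall t, pcont (fun t => 1 * (/ circ r t) ^ S n)%C t).
    { intros t. apply pcont_mult; [apply pcont_const |]. apply pcont_pow, pcont_inv_circ; auto. }
    assert (K : (- (INR (S n) * Ci) * CInt (fun t => 1 * (/ circ r t) ^ S n) 0 (2 * PI))%C = 0).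
    { rewrite <- CInt_scal by (intros t _; apply P).
      rewrite (CInt_pderiv (fun s => (/ circ r s) ^ S n)%C).
      - rewrite circ_2PI. ring.
      - intros t _. apply D.
      - intros t _. apply pcont_mult; [apply pcont_const | apply P]. }
    assert (N1 : RtoC (INR (S n)) <> 0).
    { intros E. apply RtoC_inj in E. pose proof (pos_INR n). rewrite S_INR in E. lra. }
    assert (N2 : Ci <> 0).
    { intros E. apply (f_equal snd) in E. simpl in E. lra. }
    match goal with |- ?X = _ => replace X with (- / (INR (S n) * Ci) * (- (INR (S n) * Ci) * X))%C
       by (field; auto) end.
    rewrite K. ring. }
  assert (S : forall N, csum (fun n => z ^ n * cauchy_coef r (fun _ => RtoC 1) n)%C (S N) = RtoC (2 * PI)).
  { induction N as [| N IH].
    - simpl. rewrite C0. ring.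
    - change (csum (fun n => z ^ n * cauchy_coef r (fun _ => RtoC 1) n)%C (S N) +
        z ^ S N * cauchy_coef r (fun _ => RtoC 1) (S N) = RtoC (2 * PI))%C.
      rewrite IH, Cn. ring. }
  set (X := CInt _ _ _).
  destruct (Req_dec (Cmod (X - RtoC (2 * PI))) 0) as [E | E].
  { apply Cmod_eq_0 in E. replace X with (X - RtoC (2 * PI) + RtoC (2 * PI))%C by ring. rewrite E. ring. }
  (* All partial sums equal [2 * PI], so the geometric error bound eventually falls below the fixed
     positive distance. *)
  exfalso. pose proof (Cmod_ge_0 (X - RtoC (2 * PI))).
  pose proof (ratio_range (Cmod z) r ltac:(lra)) as Hs.
  destruct (geom_small (2 * (2 * PI * (1 * (r / (r - Cmod z))))) (Cmod z / r)
    (Cmod (X - RtoC (2 * PI)))) as [N HN]; auto; try lra.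
  { assert (0 < r / (r - Cmod z)) by (apply Rdiv_lt_0_compat; lra).
    apply Rmult_le_pos; [lra |]. apply Rmult_le_pos; lra. }
  specialize (HN (Datatypes.S N) ltac:(lia)).
  pose proof (cauchy_expansion r 1 (fun _ => RtoC 1) Hr (fun t => pcont_const 1 t)
    (fun t _ => Req_le _ _ Cmod_1) z (Datatypes.S N) Hz) as K.
  rewrite S in K. rewrite (CInt_ext _ (fun t => circ r t / (circ r t - z))%C) in K by (intros; ring).
  fold X in K. lra.
Qed.

Lemma CSeries_of_approx u l M s :
  0 <= s < 1 -> (forall N, Cmod (l - csum u N) <= M * s ^ N) -> CSeries u = l.
Proof.
  intros Hs H.
  assert (M0 : 0 <= M).
  { specialize (H O). simpl in H. pose proof (Cmod_ge_0 (l - 0)). lra. }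
  assert (A : forall (pr : C -> R), (pr = fst \/ pr = snd) -> Series (fun n => pr (u n)) = pr l).
  { intros pr Hpr. apply is_series_unique.
    assert (Q : forall n, sum_n (fun n => pr (u n)) n = pr (csum u (S n))).
    { induction n as [| n IH].
      - rewrite sum_O. simpl. destruct Hpr as [-> | ->]; simpl; ring.
      - rewrite sum_Sn, IH. change (csum u (S (S n))) with (csum u (S n) + u (S n))%C.
        destruct Hpr as [-> | ->]; reflexivity. }
    apply (is_lim_seq_ext (fun n => pr (csum u (S n))) _ (pr l)).
    { intros n. symmetry. apply Q. }
    apply (is_lim_seq_incr_1 (fun n => pr (csum u n))).
    apply is_lim_seq_Reals. intros eps Heps.
    destruct (geom_small M s eps Hs Heps M0) as [N HN]. exists N. intros n Hn.
    unfold Rdist. eapply Rle_lt_trans; [| apply (HN n Hn)]. eapply Rle_trans; [| apply H].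
    rewrite Rabs_minus_sym.
    destruct Hpr as [-> | ->]; [apply (Cmod_ge_fst (l - csum u n)) | apply (Cmod_ge_snd (l - csum u n))]. }
  unfold CSeries. rewrite (A fst), (A snd); auto. destruct l; reflexivity.
Qed.

(** [cauchy_expansion] for [F] on the circle, whose left side equals [2 * PI * F (q + z)] by
    [Cauchy_kernel] and [kernel_integral]; dividing by [2 * PI] gives the coefficients. *)
Theorem holomorphic_Taylor q rho r F F' :
  C1_holomorphic (disc q rho) F F' -> 0 < r < rho ->
  exists a, coef_bounded a r /\ forall z, Cmod z < r ->
    F (q + z)%C = PS a z /\
    exists M s, 0 <= s < 1 /\ forall N, Cmod (F (q + z)%C - csum (fun n => a n * z ^ n)%C N) <= M * s ^ N.
Proof.
  intros HF Hr. pose proof PI_RGT_0 as HP.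
  set (h := fun t => F (q + circ r t)%C).
  assert (D : forall t, disc q rho (q + circ r t)%C).
  { intros t. unfold disc. replace (q + circ r t - q)%C with (circ r t) by ring. rewrite Cmod_circ; lra. }
  assert (Hh : forall t, pcont h t).
  { intros t. unfold h. apply pcont_comp.
    - eapply cderiv_ccont. apply HF. apply D.
    - apply pcont_plus; [apply pcont_const | apply pcont_circ]. }
  assert (HB : exists B, 0 < B /\ forall t, 0 <= t <= 2 * PI -> Cmod (h t) <= B).
  { assert (Hb : forall u : R -> R, (forall t, continuous u t) ->
      exists B, forall t, 0 <= t <= 2 * PI -> Rabs (u t) <= B).
    { intros u Hu. destruct (continuity_ab_maj (fun t => Rabs (u t)) 0 (2 * PI)) as [x Hx].
      - lra.
      - intros t _. apply continuity_pt_filterlim.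
        apply (continuous_comp u Rabs); [apply Hu | apply continuous_Rabs].
      - exists (Rabs (u x)). intros t Ht. apply Hx; auto. }
    destruct (Hb (fun t => fst (h t))) as [B1 H1]. { intros t. apply pcont_iff, Hh. }
    destruct (Hb (fun t => snd (h t))) as [B2 H2]. { intros t. apply pcont_iff, Hh. }
    exists (B1 + B2 + 1). split.
    - specialize (H1 0 ltac:(lra)). specialize (H2 0 ltac:(lra)).
      pose proof (Rabs_pos (fst (h 0))). pose proof (Rabs_pos (snd (h 0))). lra.
    - intros t Ht. pose proof (Cmod_le_Rabs_sum (h t)). specialize (H1 t Ht). specialize (H2 t Ht). lra. }
  destruct HB as (B & HB0 & HB).
  set (a := fun n => (/ RtoC (2 * PI) * cauchy_coef r h n)%C).
  assert (N2 : RtoC (2 * PI) <> 0). { intros E. apply RtoC_inj in E. lra. }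
  assert (App : forall z, Cmod z < r -> exists M s, 0 <= s < 1 /\
      forall N, Cmod (F (q + z)%C - csum (fun n => a n * z ^ n)%C N) <= M * s ^ N).
  { intros z Hz. pose proof (Cmod_ge_0 z).
    exists (/ (2 * PI) * (2 * (2 * PI * (B * (r / (r - Cmod z)))))), (Cmod z / r). split.
    - apply ratio_range; lra.
    - intros N. pose proof (cauchy_expansion r B h ltac:(lra) Hh HB z N Hz) as K.
      unfold h in K at 1. rewrite (Cauchy_kernel q rho r F F' HF Hr z Hz) in K.
      rewrite kernel_integral in K by auto.
      assert (E : (F (q + z) - csum (fun n => a n * z ^ n) N =
         / RtoC (2 * PI) * (F (q + z) * RtoC (2 * PI) - csum (fun n => z ^ n * cauchy_coef r h n) N))%C).
      { assert (E1 : (csum (fun n => a n * z ^ n) N = / RtoC (2 * PI) * csum (fun n => z ^ n * cauchy_coef r h n) N)%C).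
        { clear K. induction N as [| N IH]; simpl; [ring |]. rewrite IH. unfold a. ring. }
        rewrite E1. field. auto. }
      rewrite E, Cmod_mult, Cmod_inv, Cmod_R, Rabs_pos_eq by (auto; lra).
      rewrite Rmult_assoc. apply Rmult_le_compat_l; auto.
      left. apply Rinv_0_lt_compat. lra. }
  exists a. split.
  - split; [lra |]. exists (/ (2 * PI) * (2 * (2 * PI * B))).
    assert (0 < / (2 * PI)) by (apply Rinv_0_lt_compat; lra).
    split. { apply Rmult_lt_0_compat; auto. apply Rmult_lt_0_compat; [lra |]. apply Rmult_lt_0_compat; lra. }
    intros n. unfold a. rewrite Cmod_mult, Cmod_inv, Cmod_R, Rabs_pos_eq by (auto; lra).
    rewrite Rmult_assoc. apply Rmult_le_compat_l; [lra |].
    apply cauchy_coef_bound; auto. lra.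
  - intros z Hz. split; auto. destruct (App z Hz) as (M & s & Hs & K).
    symmetry. apply (CSeries_of_approx _ _ M s); auto.
Qed.

(** * Identity theorem *)

Lemma coef_bounded_shift a r : coef_bounded a r -> coef_bounded (fun n => a (S n)) r.
Proof.
  intros [Hr (M & HM & H)]. split; auto. exists (M / r). split; [apply Rdiv_lt_0_compat; auto |].
  intros n. specialize (H (S n)). simpl in H. apply (Rmult_le_reg_r r); auto.
  unfold Rdiv. rewrite (Rmult_assoc M), Rinv_l by lra. lra.
Qed.

Lemma PS_peel a r z :
  coef_bounded a r -> Cmod z < r -> PS a z = (a O + z * PS (fun n => a (S n)) z)%C.
Proof.
  intros Ha Hz. unfold PS. rewrite CSeries_incr_1 by (eapply PS_abs_summable; eauto).
  simpl. f_equal; [ring |]. rewrite <- CSeries_scal.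
  - apply CSeries_ext. intros n. ring.
  - apply PS_abs_summable with r; auto. apply coef_bounded_shift; auto.
Qed.

(** The point 0 is left out of the hypothesis because the induction in [PS_zero_coef] divides by
    [x]; continuity recovers the value there. *)
Lemma PS_zero_constant_coef a r d :
  coef_bounded a r -> 0 < d -> (forall x, Rabs x < d -> x <> 0 -> PS a (RtoC x) = 0) -> a O = 0.
Proof.
  intros Ha Hd H. pose proof Ha as [Hr _].
  assert (E0 : PS a 0 = a O).
  { rewrite (PS_peel a r); [ring | auto | rewrite Cmod_0; auto]. }
  rewrite <- E0.
  assert (Cc : ccont (PS a) 0).
  { eapply cderiv_ccont. apply (PS_cderiv a r); auto. rewrite Cmod_0; auto. }
  destruct (Req_dec (Cmod (PS a 0)) 0) as [E | E]; [apply Cmod_eq_0; auto |].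
  exfalso. pose proof (Cmod_ge_0 (PS a 0)).
  destruct (Cc (Cmod (PS a 0))) as (e & He & K); [lra |].
  set (x := Rmin e d / 2). assert (0 < Rmin e d) by (apply Rmin_pos; auto).
  pose proof (Rmin_l e d). pose proof (Rmin_r e d).
  specialize (K (RtoC x)). rewrite H in K.
  - replace (0 - PS a 0)%C with (- PS a 0)%C in K by ring. rewrite Cmod_opp in K.
    apply (Rlt_irrefl (Cmod (PS a 0))). apply K.
    replace (RtoC x - 0)%C with (RtoC x) by ring. rewrite Cmod_R, Rabs_pos_eq; unfold x; lra.
  - rewrite Rabs_pos_eq; unfold x; lra.
  - unfold x; lra.
Qed.

Lemma PS_zero_coef a r d :
  coef_bounded a r -> 0 < d <= r -> (forall x, Rabs x < d -> x <> 0 -> PS a (RtoC x) = 0) ->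
  forall n, a n = 0.
Proof.
  intros Ha Hd H n. revert a Ha H. induction n as [| n IH]; intros a Ha H.
  - apply (PS_zero_constant_coef a r d); auto. lra.
  - assert (A0 : a O = 0) by (apply (PS_zero_constant_coef a r d); auto; lra).
    apply (IH (fun n => a (S n))).
    + apply coef_bounded_shift; auto.
    + intros x Hx Hx0. pose proof (H x Hx Hx0) as K.
      rewrite (PS_peel a r) in K; [| auto | rewrite Cmod_R; lra].
      rewrite A0, Cplus_0_l in K.
      assert (Nx : RtoC x <> 0) by (intros E; apply Hx0, RtoC_inj; exact E).
      match goal with |- ?X = _ => replace X with (/ RtoC x * (RtoC x * X))%C by (field; auto) end.
      rewrite K. ring.
Qed.

(** Since the segment of zeros passes through the centre, one Taylor expansion at [q] reaches each
    point of the disc. *)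
Theorem holomorphic_identity q rho F F' d :
  C1_holomorphic (disc q rho) F F' -> 0 < d ->
  (forall x, Rabs x < d -> F (q + RtoC x)%C = 0) ->
  forall z, disc q rho z -> F z = 0.
Proof.
  intros HF Hd H z Hz. unfold disc in Hz. pose proof (Cmod_ge_0 (z - q)).
  destruct (holomorphic_Taylor q rho ((Cmod (z - q) + rho) / 2) F F' HF ltac:(lra)) as (a & Ha & HT).
  set (r := (Cmod (z - q) + rho) / 2) in *.
  assert (Hr : 0 < r) by (unfold r; lra).
  assert (A0 : forall n, a n = 0).
  { apply (PS_zero_coef a r (Rmin d r)); auto.
    - split; [apply Rmin_pos; auto | apply Rmin_r].
    - intros x Hx _. pose proof (Rmin_l d r). pose proof (Rmin_r d r).
      destruct (HT (RtoC x)) as [E _]; [rewrite Cmod_R; lra |].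
      rewrite <- E. apply H. lra. }
  destruct (HT (z - q)%C) as [E _]; [unfold r; lra |].
  replace (q + (z - q))%C with z in E by ring. rewrite E.
  unfold PS. rewrite (CSeries_ext _ (fun n => 0 * (a n * (z - q) ^ n))%C).
  - rewrite CSeries_scal; [ring |]. apply PS_abs_summable with r; auto. unfold r; lra.
  - intros n. rewrite A0. ring.
Qed.

(** Near each point [F] is a power series, so [F'] is one too. The radius of expansion varies with
    the point; [C_derive F'] glues the local second derivatives, by uniqueness of the derivative. *)
Lemma holomorphic_derivative q rho F F' :
  C1_holomorphic (disc q rho) F F' ->
  exists F'', C1_holomorphic (disc q rho) F' F''.
Proof.
  intros HF.
  assert (L : forall z, disc q rho z -> exists d : C, cderiv F' z d /\
    exists F2 e, 0 < e /\ (forall w, disc z e w -> disc q rho w /\ cderiv F' w (F2 w)) /\ ccont F2 z).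
  { intros z Hz. unfold disc in Hz. pose proof (Cmod_ge_0 (z - q)).
    set (r := (Cmod (z - q) + rho) / 2) in *.
    assert (Hr : Cmod (z - q) < r < rho) by (unfold r; lra).
    destruct (holomorphic_Taylor q rho r F F' HF ltac:(lra)) as (a & Ha & HT).
    assert (EF : forall w, disc q r w -> F w = PS a (w - q)%C).
    { intros w Hw. destruct (HT (w - q)%C Hw) as [E _]. rewrite <- E. f_equal. ring. }
    pose proof (PS_C1_holomorphic a r q Ha) as HP.
    assert (EF' : forall w, disc q r w -> F' w = PS (PS' a) (w - q)%C).
    { intros w Hw. apply (cderiv_unique F w).
      - apply HF. unfold disc in *. lra.
      - apply cderiv_ext_disc with (fun w => PS a (w - q)%C) (r - Cmod (w - q)).
        + unfold disc in Hw; lra.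
        + intros v Hv. symmetry. apply EF. unfold disc in *.
          pose proof (Cmod_sub_triangle v w q). lra.
        + apply HP; auto. }
    set (r1 := (Cmod (z - q) + r) / 2).
    assert (Hr1 : Cmod (z - q) < r1 < r) by (unfold r1; lra).
    pose proof (PS_C1_holomorphic (PS' a) r1 q (coef_bounded_PS' a r r1 Ha ltac:(lra))) as HP'.
    assert (K : forall w, disc q r1 w -> cderiv F' w (PS (PS' (PS' a)) (w - q)%C)).
    { intros w Hw. apply cderiv_ext_disc with (fun w => PS (PS' a) (w - q)%C) (r1 - Cmod (w - q)).
      - unfold disc in Hw; lra.
      - intros v Hv. symmetry. apply EF'. unfold disc in *.
          pose proof (Cmod_sub_triangle v w q). lra.
      - apply HP'; auto. }
    exists (PS (PS' (PS' a)) (z - q)%C). split; [apply K; unfold disc; lra |].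
    exists (fun w => PS (PS' (PS' a)) (w - q)%C), (r1 - Cmod (z - q)).
    split; [lra |]. split.
    - intros w Hw. pose proof (Cmod_sub_triangle w z q). unfold disc in *. split; [lra | apply K; unfold disc; lra].
    - apply HP'. unfold disc; lra. }
  exists (fun z => C_derive F' z). intros z Hz.
  destruct (L z Hz) as (d & Hd & F2 & e & He & HF2 & Hc). split.
  - rewrite (is_C_derive_unique _ _ _ Hd). exact Hd.
  - apply ccont_ext_disc with F2 e; auto.
    intros w Hw. symmetry. apply is_C_derive_unique. apply HF2; auto.
Qed.

(** * Closed forms *)

Lemma Cmod_le_coord x y x' y' :
  Rabs x <= Rabs x' -> Rabs y <= Rabs y' -> Cmod (x, y) <= Cmod (x', y').
Proof.
  intros H1 H2. unfold Cmod; simpl. apply sqrt_le_1_alt.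
  apply Rsqr_le_abs_1 in H1. apply Rsqr_le_abs_1 in H2. unfold Rsqr in *. lra.
Qed.

(** Moving coordinates towards those of the centre stays in the disc; this keeps the broken paths
    and the rays issuing from the centre inside. *)
Lemma disc_coord q rho s t s' t' :
  disc q rho (s, t) -> Rabs (s' - fst q) <= Rabs (s - fst q) -> Rabs (t' - snd q) <= Rabs (t - snd q) ->
  disc q rho (s', t').
Proof.
  unfold disc. destruct q as [a b]. simpl. intros H H1 H2.
  eapply Rle_lt_trans; [| exact H].
  apply (Cmod_le_coord (s' - a) (t' - b) (s - a) (t - b)); auto.
Qed.

Lemma between_Rabs a b x : Rmin a b <= x <= Rmax a b -> Rabs (x - a) <= Rabs (b - a).
Proof.
  unfold Rmin, Rmax, Rabs. destruct (Rle_dec a b), (Rcase_abs (x - a)), (Rcase_abs (b - a)); lra.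
Qed.

Lemma continuity_2d_pt_snd f x y : continuity_2d_pt f x y -> continuous (fun v => f x v) y.
Proof.
  intros H. apply continuity_2d_pt_filterlim in H.
  apply (continuous_comp (U := R_UniformSpace) (V := prod_UniformSpace R_UniformSpace R_UniformSpace)
    (W := R_UniformSpace) (fun v => (x, v)) (fun z => f (fst z) (snd z))); [| exact H].
  apply (continuous_comp_2 (U := R_UniformSpace) (fun _ : R => x) (fun v : R => v) (fun a b => (a, b))).
  - apply continuous_const.
  - apply continuous_id.
  - apply continuous_ext with (fun z : R * R => z); [intros []; reflexivity | apply continuous_id].
Qed.

Lemma continuity_2d_pt_fst f x y : continuity_2d_pt f x y -> continuous (fun u => f u y) x.
Proof.
  intros H. apply continuity_2d_pt_filterlim in H.
  apply (continuous_comp (U := R_UniformSpace) (V := prod_UniformSpace R_UniformSpace R_UniformSpace)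
    (W := R_UniformSpace) (fun u => (u, y)) (fun z => f (fst z) (snd z))); [| exact H].
  apply (continuous_comp_2 (U := R_UniformSpace) (fun u : R => u) (fun _ : R => y) (fun a b => (a, b))).
  - apply continuous_id.
  - apply continuous_const.
  - apply continuous_ext with (fun z : R * R => z); [intros []; reflexivity | apply continuous_id].
Qed.

Lemma disc_locally_2d q rho s t : disc q rho (s, t) -> locally_2d (fun u v => disc q rho (u, v)) s t.
Proof. intros H. apply (open_locally_2d (disc q rho) (s, t) (disc_is_open q rho) H). Qed.

(** Poincare's lemma for [X ds + Y dt], integrating horizontally from the centre and then
    vertically. Closedness is the common cross derivative [Z], so that no other partial derivatives
    of [X] and [Y] enter. Differentiating the vertical integral in [s] gives the integral of [Z],
    that is [X s t - X s b]. *)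
Lemma closed_form_primitive q rho (X Y Z : R -> R -> R) :
  (forall s t, disc q rho (s, t) ->
     continuity_2d_pt X s t /\ continuity_2d_pt Y s t /\ continuity_2d_pt Z s t /\
     is_derive (fun t => X s t) t (Z s t) /\ is_derive (fun s => Y s t) s (Z s t)) ->
  exists P : R -> R -> R, forall s t, disc q rho (s, t) -> D2 P s t (X s t) (Y s t).
Proof.
  intros H. destruct q as [a b].
  set (P := fun s t => RInt (fun x => X x b) a s + RInt (fun y => Y s y) b t).
  assert (In1 : forall s t x, disc (a, b) rho (s, t) -> Rmin a s <= x <= Rmax a s -> disc (a, b) rho (x, b)).
  { intros s t x Hd Hx. apply (disc_coord (a, b) rho s t); auto; simpl.
    - apply between_Rabs; auto.
    - rewrite Rminus_diag, Rabs_R0. apply Rabs_pos. }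
  assert (In2 : forall s t y, disc (a, b) rho (s, t) -> Rmin b t <= y <= Rmax b t -> disc (a, b) rho (s, y)).
  { intros s t y Hd Hy. apply (disc_coord (a, b) rho s t); auto; simpl; [lra |].
    apply between_Rabs; auto. }
  assert (Int1 : forall s t, disc (a, b) rho (s, t) -> ex_RInt (fun x => X x b) a s).
  { intros s t Hd. apply (ex_RInt_continuous (V := R_CompleteNormedModule)). intros x Hx.
    apply (continuity_2d_pt_fst X). apply H. apply (In1 s t); auto. }
  assert (Int2 : forall s t, disc (a, b) rho (s, t) -> ex_RInt (fun y => Y s y) b t).
  { intros s t Hd. apply (ex_RInt_continuous (V := R_CompleteNormedModule)). intros y Hy.
    apply (continuity_2d_pt_snd Y). apply H. apply (In2 s t); auto. }
  assert (Ps : forall s t, disc (a, b) rho (s, t) -> is_derive (fun x => P x t) s (X s t)).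
  { intros s t Hd. pose proof (disc_locally_2d _ _ _ _ Hd) as L.
    apply locally_2d_1d_const_y in L.
    assert (E : X s t = X s b + RInt (fun y => Derive (fun u => Y u y) s) b t).
    { rewrite (RInt_ext _ (fun y => Z s y)).
      - assert (R1 : RInt (fun y => Z s y) b t = X s t - X s b).
        { apply is_RInt_unique. apply (is_RInt_derive (V := R_CompleteNormedModule) (fun y => X s y)).
          - intros y Hy. apply H. apply (In2 s t); auto.
          - intros y Hy. apply (continuity_2d_pt_snd Z). apply H. apply (In2 s t); auto. }
        rewrite R1. ring.
      - intros y Hy. apply is_derive_unique. apply H. apply (In2 s t); auto. lra. }
    rewrite E. unfold P. apply is_derive_plus_R.
    - apply (is_derive_RInt (V := R_NormedModule) (fun x => X x b) (fun x => RInt (fun x => X x b) a x) a).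
      + revert L. apply filter_imp. intros x Hx.
        apply (RInt_correct (V := R_CompleteNormedModule)). apply (Int1 x t); auto.
      + apply (continuity_2d_pt_fst X). apply H. apply (In1 s t); auto. unfold Rmin, Rmax; destruct (Rle_dec a s); lra.
    - apply (is_derive_RInt_param (fun s y => Y s y)).
      + revert L. apply filter_imp. intros x Hx y Hy. eexists. apply H. apply (In2 x t); auto.
      + intros y Hy. assert (Hy' := In2 s t y Hd Hy).
        apply continuity_2d_pt_ext_loc with Z; [| apply H; auto].
        apply locally_2d_mono with (2 := disc_locally_2d _ _ _ _ Hy').
        intros u v Huv. symmetry. apply is_derive_unique. apply H; auto.
      + revert L. apply filter_imp. intros x Hx. apply (Int2 x t); auto. }
  exists P. intros s t Hd. pose proof (disc_locally_2d _ _ _ _ Hd) as L.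
  apply D2_of_partials.
  - apply locally_2d_mono with (2 := L). intros u v Huv. apply Ps; auto.
  - unfold P. replace (Y s t) with (0 + Y s t) by ring.
    apply is_derive_plus_R.
    + apply is_derive_const_R.
    + apply locally_2d_1d_const_x in L.
      apply (is_derive_RInt (V := R_NormedModule) (fun y => Y s y) (fun y => RInt (fun y => Y s y) b y) b).
      * revert L. apply filter_imp. intros y Hy.
        apply (RInt_correct (V := R_CompleteNormedModule)). apply (Int2 s y); auto.
      * apply (continuity_2d_pt_snd Y). apply H; auto.
  - apply H; auto.
Qed.

(** * Twice continuously differentiable functions *)

(** Named partial derivatives in place of iterated [Derive] let the calculus proceed by formulas;
    the single [f12] has Schwarz's theorem built in. *)
Definition jet2 (D : C -> Prop) (f f1 f2 f11 f12 f22 : R -> R -> R) : Prop :=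
  forall s t, D (s, t) ->
    D2 f s t (f1 s t) (f2 s t) /\ D2 f1 s t (f11 s t) (f12 s t) /\ D2 f2 s t (f12 s t) (f22 s t) /\
    continuity_2d_pt f11 s t /\ continuity_2d_pt f12 s t /\ continuity_2d_pt f22 s t.

Lemma jet2_continuity D f f1 f2 f11 f12 f22 s t :
  jet2 D f f1 f2 f11 f12 f22 -> D (s, t) ->
  continuity_2d_pt f s t /\ continuity_2d_pt f1 s t /\ continuity_2d_pt f2 s t.
Proof.
  intros H Hd. destruct (H s t Hd) as (A & B & E & _).
  repeat split; eapply D2_continuity; eauto.
Qed.

Lemma continuity_2d_pt_comp1 (g : R -> R) f s t :
  continuous g (f s t) -> continuity_2d_pt f s t -> continuity_2d_pt (fun u v => g (f u v)) s t.
Proof. intros H1 H2. apply continuity_1d_2d_pt_comp; auto. apply continuity_pt_filterlim. exact H1. Qed.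

Lemma jet2_comp1 D f f1 f2 f11 f12 f22 (g g' g'' : R -> R) :
  jet2 D f f1 f2 f11 f12 f22 ->
  (forall s t, D (s, t) -> is_derive g (f s t) (g' (f s t)) /\ is_derive g' (f s t) (g'' (f s t)) /\
     continuous g'' (f s t)) ->
  jet2 D (fun s t => g (f s t))
    (fun s t => g' (f s t) * f1 s t) (fun s t => g' (f s t) * f2 s t)
    (fun s t => g'' (f s t) * f1 s t * f1 s t + g' (f s t) * f11 s t)
    (fun s t => g'' (f s t) * f1 s t * f2 s t + g' (f s t) * f12 s t)
    (fun s t => g'' (f s t) * f2 s t * f2 s t + g' (f s t) * f22 s t).
Proof.
  intros H Hg s t Hd. destruct (jet2_continuity _ _ _ _ _ _ _ s t H Hd) as (C0 & C1 & C2).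
  destruct (H s t Hd) as (A & A1 & A2 & C11 & C12 & C22). destruct (Hg s t Hd) as (G1 & G2 & G3).
  assert (Cg' : continuity_2d_pt (fun s t => g' (f s t)) s t).
  { apply continuity_2d_pt_comp1; auto.
    apply ex_derive_continuous_R. eexists; eauto. }
  assert (Cg'' : continuity_2d_pt (fun s t => g'' (f s t)) s t).
  { apply continuity_2d_pt_comp1; auto. }
  pose proof (D2_comp1 _ _ _ _ _ _ _ A G2) as Dg'.
  split; [| split; [| split]].
  - apply D2_comp1; auto.
  - eapply D2_eq; [apply (D2_mult _ _ _ _ _ _ _ _ Dg' A1) | |]; cbv beta; ring.
  - eapply D2_eq; [apply (D2_mult _ _ _ _ _ _ _ _ Dg' A2) | |]; cbv beta; ring.
  - repeat split; apply continuity_2d_pt_plus; apply continuity_2d_pt_mult; auto;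
    apply continuity_2d_pt_mult; auto.
Qed.

Lemma jet2_plus D f f1 f2 f11 f12 f22 g g1 g2 g11 g12 g22 :
  jet2 D f f1 f2 f11 f12 f22 -> jet2 D g g1 g2 g11 g12 g22 ->
  jet2 D (fun s t => f s t + g s t)
    (fun s t => f1 s t + g1 s t) (fun s t => f2 s t + g2 s t) (fun s t => f11 s t + g11 s t)
    (fun s t => f12 s t + g12 s t) (fun s t => f22 s t + g22 s t).
Proof.
  intros H K s t Hd. destruct (H s t Hd) as (A & A1 & A2 & C11 & C12 & C22).
  destruct (K s t Hd) as (B & B1 & B2 & E11 & E12 & E22).
  repeat split; try apply D2_plus; try apply continuity_2d_pt_plus; auto.
Qed.

Lemma C2_on_jet2 W f :
  open (T := C_UniformSpace) W -> C2_on W f ->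
  exists f1 f2 f11 f12 f22, jet2 W f f1 f2 f11 f12 f22.
Proof.
  intros HW H.
  assert (L : forall (P : R -> R -> Prop) s t, W (s, t) -> (forall u v, W (u, v) -> P u v) -> locally_2d P s t).
  { intros P s t Hst HP. apply locally_2d_mono with (2 := open_locally_2d W (s, t) HW Hst).
    exact HP. }
  set (f1 := fun u v => Derive (fun z => f z v) u).
  set (f2 := fun u v => Derive (fun z => f u z) v).
  set (f11 := fun u v => Derive (fun z => f1 z v) u).
  set (f12 := fun u v => Derive (fun z => f1 u z) v).
  set (f21 := fun u v => Derive (fun z => f2 z v) u).
  set (f22 := fun u v => Derive (fun z => f2 u z) v).
  assert (X : forall s t, W (s, t) ->
    continuity_2d_pt f s t /\ ex_derive (fun z => f z t) s /\ ex_derive (fun z => f s z) t /\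
    continuity_2d_pt f1 s t /\ ex_derive (fun z => f1 z t) s /\ ex_derive (fun z => f1 s z) t /\
    continuity_2d_pt f2 s t /\ ex_derive (fun z => f2 z t) s /\ ex_derive (fun z => f2 s z) t /\
    continuity_2d_pt f11 s t /\ continuity_2d_pt f12 s t /\ continuity_2d_pt f21 s t /\ continuity_2d_pt f22 s t).
  { intros s t Hst. specialize (H s t Hst). simpl in H. unfold f1, f2, f11, f12, f21, f22. tauto. }
  assert (SZ : forall s t, W (s, t) -> f21 s t = f12 s t).
  { intros s t Hst. unfold f21, f12, f1, f2. apply Schwarz.
    - apply L; auto. intros u v Huv. destruct (X u v Huv) as (? & ? & ? & ? & ? & ? & ? & ? & ? & _). tauto.
    - pose proof (X s t Hst); tauto.
    - pose proof (X s t Hst); tauto. }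
  exists f1, f2, f11, f12, f22. intros s t Hst.
  destruct (X s t Hst) as (C0 & E1 & E2 & C1 & E11 & E12 & C2 & E21 & E22 & C11 & C12 & C21 & C22).
  split; [| split; [| split; [| auto]]].
  - apply D2_of_partials; [| | assumption].
    + apply L; auto. intros u v Huv. apply Derive_correct. pose proof (X u v Huv); tauto.
    + apply Derive_correct; assumption.
  - apply D2_of_partials; [| | assumption].
    + apply L; auto. intros u v Huv. apply Derive_correct. pose proof (X u v Huv); tauto.
    + apply Derive_correct; assumption.
  - rewrite <- SZ by auto. apply D2_of_partials; [| | assumption].
    + apply L; auto. intros u v Huv. apply Derive_correct. pose proof (X u v Huv); tauto.
    + apply Derive_correct; assumption.
Qed.

Lemma jet2_locally_Derive D f f1 f2 f11 f12 f22 s t :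
  open (T := C_UniformSpace) D -> jet2 D f f1 f2 f11 f12 f22 -> D (s, t) ->
  locally_2d (fun u v => f1 u v = Derive (fun z => f z v) u /\ f2 u v = Derive (fun z => f u z) v) s t.
Proof.
  intros HD H Hst. apply locally_2d_mono with (2 := open_locally_2d D (s, t) HD Hst).
  intros u v Huv. destruct (H u v Huv) as (A & _).
  split; symmetry; apply is_derive_unique; [eapply D2_derive_1 | eapply D2_derive_2]; eauto.
Qed.

Lemma jet2_C2_on D f f1 f2 f11 f12 f22 :
  open (T := C_UniformSpace) D -> jet2 D f f1 f2 f11 f12 f22 -> C2_on D f.
Proof.
  intros HD H s t Hst.
  pose proof (jet2_locally_Derive _ _ _ _ _ _ _ s t HD H Hst) as LD.
  destruct (jet2_continuity _ _ _ _ _ _ _ s t H Hst) as (C0 & C1 & C2).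
  destruct (H s t Hst) as (A & A1 & A2 & C11 & C12 & C22).
  assert (G : forall g h1 h2, locally_2d (fun u v => D (u, v) /\ D2 g u v (h1 u v) (h2 u v)) s t ->
     continuity_2d_pt g s t -> continuity_2d_pt h1 s t -> continuity_2d_pt h2 s t -> ex_diff_n g 1 s t).
  { intros g h1 h2 Lg Cg Ch1 Ch2.
    pose proof (locally_2d_singleton _ _ _ Lg) as [_ Dg].
    split; [auto |]. split; [eexists; eapply D2_derive_1; eauto |].
    split; [eexists; eapply D2_derive_2; eauto |].
    split; (split; [| exact I]).
    - apply continuity_2d_pt_ext_loc with h1; auto. apply locally_2d_mono with (2 := Lg).
      intros u v [_ K]. symmetry. apply is_derive_unique. eapply D2_derive_1; eauto.
    - apply continuity_2d_pt_ext_loc with h2; auto. apply locally_2d_mono with (2 := Lg).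
      intros u v [_ K]. symmetry. apply is_derive_unique. eapply D2_derive_2; eauto. }
  pose proof (open_locally_2d D (s, t) HD Hst) as LO. simpl in LO.
  assert (LL : forall g h1 h2, (forall u v, D (u, v) -> D2 g u v (h1 u v) (h2 u v)) ->
     locally_2d (fun u v => D (u, v) /\ D2 g u v (h1 u v) (h2 u v)) s t).
  { intros g h1 h2 K. apply locally_2d_mono with (2 := LO). intros; split; auto. }
  split; [auto |]. split; [eexists; eapply D2_derive_1; eauto |].
  split; [eexists; eapply D2_derive_2; eauto |]. split.
  - apply ex_diff_n_ext_loc with f1.
    + apply locally_2d_mono with (2 := LD). tauto.
    + apply (G f1 f11 f12); auto. apply LL. intros u v Huv. apply H; auto.
  - apply ex_diff_n_ext_loc with f2.
    + apply locally_2d_mono with (2 := LD). tauto.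
    + apply (G f2 f12 f22); auto. apply LL. intros u v Huv. apply H; auto.
Qed.

Lemma jet2_laplacian D f f1 f2 f11 f12 f22 s t :
  open (T := C_UniformSpace) D -> jet2 D f f1 f2 f11 f12 f22 -> D (s, t) ->
  laplacian f s t = f11 s t + f22 s t.
Proof.
  intros HD H Hst. pose proof (jet2_locally_Derive _ _ _ _ _ _ _ s t HD H Hst) as LD.
  destruct (H s t Hst) as (A & A1 & A2 & _).
  unfold laplacian, partial_derive. simpl. f_equal.
  - rewrite <- (is_derive_unique _ _ _ (D2_derive_1 _ _ _ _ _ A1)).
    apply Derive_ext_loc. apply locally_2d_1d_const_y in LD. revert LD. apply filter_imp.
    intros u [E _]. symmetry. exact E.
  - rewrite <- (is_derive_unique _ _ _ (D2_derive_2 _ _ _ _ _ A2)).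
    apply Derive_ext_loc. apply locally_2d_1d_const_x in LD. revert LD. apply filter_imp.
    intros u [_ E]. symmetry. exact E.
Qed.

(** * Local uniqueness for Liouville's equation *)

(** Free of the Cauchy data, so that it restricts to discs that do not meet [J]. *)
Definition liouville_solution (D : C -> Prop) (p : R -> R -> R) : Prop :=
  C2_on D p /\
  (forall s t, D (s, t) -> 0 < p s t) /\
  (forall s t, D (s, t) -> laplacian (fun x y => ln (p x y)) s t = - 2 * p s t).

(* Liouville's equation for [psi = f^(-2)], cleared of denominators. *)
Definition liouville_jet (D : C -> Prop) (f f1 f2 f11 f12 f22 : R -> R -> R) : Prop :=
  jet2 D f f1 f2 f11 f12 f22 /\
  forall s t, D (s, t) ->
    0 < f s t /\ f s t * (f11 s t + f22 s t) = 1 + f1 s t * f1 s t + f2 s t * f2 s t.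

Lemma is_derive_ln_at x : 0 < x -> is_derive ln x (/ x).
Proof. intros H. auto_derive; auto. ring. Qed.

Lemma is_derive_Rinv_at x : x <> 0 -> is_derive Rinv x (- / (x * x)).
Proof. intros H. auto_derive; auto. field; auto. Qed.

(** Written through [ln p] because the equation prescribes the Laplacian of that function. *)
Definition inv_sqrt_of (p : R -> R -> R) (s t : R) : R := exp (- / 2 * ln (p s t)).

Lemma inv_sqrt_of_sqr p s t : 0 < p s t -> inv_sqrt_of p s t * inv_sqrt_of p s t * p s t = 1.
Proof.
  intros H. unfold inv_sqrt_of. rewrite <- exp_plus.
  rewrite <- (exp_ln (p s t)) at 3 by auto. rewrite <- exp_plus, <- exp_0. f_equal. field.
Qed.

(** The clause on [f2] carries the normal derivative in the Cauchy data over from [p] to its inverse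
    square root. *)
Lemma liouville_solution_jet D p :
  open (T := C_UniformSpace) D -> liouville_solution D p ->
  exists f1 f2 f11 f12 f22, liouville_jet D (inv_sqrt_of p) f1 f2 f11 f12 f22 /\
    forall s t, D (s, t) -> f2 s t = - / 2 * inv_sqrt_of p s t * (partial_derive 0 1 p s t / p s t).
Proof.
  intros HD (HC & Hpos & HL).
  destruct (C2_on_jet2 D p HD HC) as (p1 & p2 & p11 & p12 & p22 & Hp).
  assert (Hu := jet2_comp1 D p p1 p2 p11 p12 p22 ln Rinv (fun x => - / (x * x)) Hp).
  assert (Hu' := Hu ltac:(intros s t Hst; specialize (Hpos s t Hst); split; [apply is_derive_ln_at; auto |];
    split; [apply is_derive_Rinv_at; lra |];
    apply ex_derive_continuous_R; auto_derive; nra)).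
  clear Hu.
  match type of Hu' with jet2 _ ?u ?a ?b ?c ?d ?e => set (u0 := u) in *; set (u1 := a) in *; set (u2 := b) in *;
    set (u11 := c) in *; set (u12 := d) in *; set (u22 := e) in * end.
  assert (Hf := jet2_comp1 D u0 u1 u2 u11 u12 u22 (fun x => exp (- / 2 * x)) (fun x => - / 2 * exp (- / 2 * x))
     (fun x => / 4 * exp (- / 2 * x)) Hu' ltac:(intros s t _; split; [auto_derive; auto; field |];
       split; [auto_derive; auto; field |];
       apply ex_derive_continuous_R; auto_derive; auto)).
  do 5 eexists. split; [split; [exact Hf |] |].
  - intros s t Hst. cbv beta. split; [apply exp_pos |].
    pose proof (inv_sqrt_of_sqr p s t (Hpos s t Hst)) as E. unfold inv_sqrt_of in E.
    pose proof (jet2_laplacian D u0 u1 u2 u11 u12 u22 s t HD Hu' Hst) as L.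
    rewrite (HL s t Hst) in L.
    change (ln (p s t)) with (u0 s t) in E.
    change (inv_sqrt_of p s t) with (exp (- / 2 * u0 s t)). set (e := exp (- / 2 * u0 s t)) in *.
    replace (u11 s t) with (- 2 * p s t - u22 s t) by lra.
    (* The part of the Laplacian linear in [u11 + u22 = - 2 * p] yields [e * e * p], which is 1; the
       part quadratic in [u1] and [u2] is the squared gradient of [f]. *)
    transitivity (e * e * p s t + (- / 2 * e * u1 s t) * (- / 2 * e * u1 s t) + (- / 2 * e * u2 s t) * (- / 2 * e * u2 s t)).
    + field.
    + rewrite E. ring.
  - intros s t Hst. cbv beta. unfold inv_sqrt_of. fold (u0 s t).
    assert (partial_derive 0 1 p s t = p2 s t) as ->.
    { unfold partial_derive. simpl. apply is_derive_unique. eapply D2_derive_2. apply Hp; auto. }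
    unfold u0, u2. field. specialize (Hpos s t Hst). lra.
Qed.

(* The derivative of [H] is [- 2 f_zz / f]; [H] itself is [u_z] plus the primitive of a closed form. *)
Lemma liouville_quadratic_differential q rho f f1 f2 f11 f12 f22 :
  liouville_jet (disc q rho) f f1 f2 f11 f12 f22 ->
  exists H : C -> C, C1_holomorphic (disc q rho) H
    (fun z => (- (f11 (fst z) (snd z) - f22 (fst z) (snd z)) / (2 * f (fst z) (snd z)),
               f12 (fst z) (snd z) / f (fst z) (snd z))).
Proof.
  intros [HJ HE].
  assert (Hc : forall s t, disc q rho (s, t) -> continuity_2d_pt (fun s t => / f s t) s t).
  { intros s t Hd. apply continuity_2d_pt_inv; [apply (proj1 (jet2_continuity _ _ _ _ _ _ _ _ _ HJ Hd)) |].
    destruct (HE s t Hd). lra. }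
  (* With [u_z = - 2 f_z / f] and [e^u = 1 / f^2] the closed form is [(dz' / 2 - 2 f_z^2 dz) / f^2].
     Its [s]-component is [X1 + i X2] and its [t]-component is [- X2 + i Y2]. *)
  set (X1 := fun s t => (1 - f1 s t * f1 s t + f2 s t * f2 s t) * / 2 * (/ f s t * / f s t)).
  set (X2 := fun s t => f1 s t * f2 s t * (/ f s t * / f s t)).
  set (Y2 := fun s t => - (1 + f1 s t * f1 s t - f2 s t * f2 s t) * / 2 * (/ f s t * / f s t)).
  (* The equalities [b = - c] and [d = e] are the closedness of the real and of the imaginary part.
     Both depend on the equation, used to eliminate [f11]. *)
  assert (Dif : forall s t, disc q rho (s, t) -> exists a b c d e k,
     D2 X1 s t a b /\ D2 X2 s t c d /\ D2 Y2 s t e k /\ b = - c /\ d = e /\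
     c = (f11 s t * f2 s t + f1 s t * f12 s t) * (/ f s t * / f s t) -
         2 * f1 s t * f2 s t * f1 s t * (/ f s t * / f s t * / f s t) /\
     d = (f12 s t * f2 s t + f1 s t * f22 s t) * (/ f s t * / f s t) -
         2 * f1 s t * f2 s t * f2 s t * (/ f s t * / f s t * / f s t)).
  { intros s t Hd. destruct (HJ s t Hd) as (A & A1 & A2 & C11 & C12 & C22). destruct (HE s t Hd) as [Hp HEq].
    pose proof (D2_inv _ _ _ _ _ A ltac:(lra)) as DI.
    pose proof (D2_sqr _ _ _ _ _ DI) as DI2.
    pose proof (D2_sqr _ _ _ _ _ A1) as S1. pose proof (D2_sqr _ _ _ _ _ A2) as S2.
    pose proof (D2_const 1 s t) as K1. pose proof (D2_const (/ 2) s t) as K2.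
    do 6 eexists. split; [| split; [| split]].
    - unfold X1. apply D2_mult; [apply D2_mult; [apply D2_plus; [apply D2_minus; [exact K1 | exact S1] | exact S2] | exact K2] | exact DI2].
    - unfold X2. apply D2_mult; [apply D2_mult; eassumption | exact DI2].
    - unfold Y2. apply D2_mult; [apply D2_mult; [apply D2_opp; apply D2_minus; [apply D2_plus; [exact K1 | exact S1] | exact S2] | exact K2] | exact DI2].
    - cbv beta.
      assert (E11 : f11 s t = (1 + f1 s t * f1 s t + f2 s t * f2 s t) / f s t - f22 s t).
      { rewrite <- HEq. field. lra. }
      rewrite !E11. repeat split; field; lra. }
  assert (Cont : forall s t, disc q rho (s, t) ->
     continuity_2d_pt f1 s t /\ continuity_2d_pt f2 s t /\ continuity_2d_pt f11 s t /\ continuity_2d_pt f12 s t /\ continuity_2d_pt f22 s t).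
  { intros s t Hd. destruct (HJ s t Hd) as (A & A1 & A2 & C11 & C12 & C22).
    repeat split; auto; eapply D2_continuity; eauto. }
  destruct (closed_form_primitive q rho X1 (fun s t => - X2 s t)
     (fun s t => - ((f11 s t * f2 s t + f1 s t * f12 s t) * (/ f s t * / f s t) -
         2 * f1 s t * f2 s t * f1 s t * (/ f s t * / f s t * / f s t)))) as [P1 HP1].
  { intros s t Hd. destruct (Dif s t Hd) as (a & b & c & d & e & k & D1 & D2' & D3 & E1 & E2 & E3 & E4).
    destruct (Cont s t Hd) as (c1 & c2 & c11 & c12 & c22). pose proof (Hc s t Hd) as ci.
    split; [eapply D2_continuity; eauto |].
    split; [apply continuity_2d_pt_opp; eapply D2_continuity; eauto |]. split.
    - apply continuity_2d_pt_opp, continuity_2d_pt_minus;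
      repeat (first [assumption | apply continuity_2d_pt_const | apply continuity_2d_pt_mult | apply continuity_2d_pt_plus]).
    - rewrite <- E3. split.
      + rewrite <- E1. eapply D2_derive_2; eauto.
      + apply (is_derive_opp_R (fun s => X2 s t)).
        eapply D2_derive_1; eauto. }
  destruct (closed_form_primitive q rho X2 Y2
     (fun s t => ((f12 s t * f2 s t + f1 s t * f22 s t) * (/ f s t * / f s t) -
         2 * f1 s t * f2 s t * f2 s t * (/ f s t * / f s t * / f s t)))) as [P2 HP2].
  { intros s t Hd. destruct (Dif s t Hd) as (a & b & c & d & e & k & D1 & D2' & D3 & E1 & E2 & E3 & E4).
    destruct (Cont s t Hd) as (c1 & c2 & c11 & c12 & c22). pose proof (Hc s t Hd) as ci.
    split; [eapply D2_continuity; eauto |].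
    split; [eapply D2_continuity; eauto |]. split.
    - apply continuity_2d_pt_minus;
      repeat (first [assumption | apply continuity_2d_pt_const | apply continuity_2d_pt_mult | apply continuity_2d_pt_plus]).
    - rewrite <- E4. split.
      + eapply D2_derive_2; eauto.
      + rewrite E2. eapply D2_derive_1; eauto. }
  exists (fun z => (- (f1 (fst z) (snd z) / f (fst z) (snd z)) + P1 (fst z) (snd z),
                    f2 (fst z) (snd z) / f (fst z) (snd z) + P2 (fst z) (snd z))).
  intros [s t] Hd. destruct (HJ s t Hd) as (A & A1 & A2 & C11 & C12 & C22). destruct (HE s t Hd) as [Hp HEq].
  assert (E11 : f11 s t = (1 + f1 s t * f1 s t + f2 s t * f2 s t) / f s t - f22 s t).
  { rewrite <- HEq. field. lra. }
  split.
  (* Neither summand is holomorphic by itself: the [z']-derivatives, [- e^u / 2] of [u_z] and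
     [e^u / 2] of the primitive, cancel. *)
  - apply cderiv_D2. simpl. split.
    + eapply D2_eq.
      * apply D2_plus; [apply D2_opp, D2_div; [eassumption | eassumption | lra] | apply HP1; auto].
      * unfold X1. rewrite E11. field. lra.
      * unfold X2. field. lra.
    + eapply D2_eq.
      * apply D2_plus; [apply D2_div; [eassumption | eassumption | lra] | apply HP2; auto].
      * unfold X2. field. lra.
      * unfold Y2. rewrite E11. field. lra.
  - apply ccont_iff_2d. simpl. pose proof (Hc s t Hd) as ci. split.
    + apply continuity_2d_pt_mult.
      * apply continuity_2d_pt_opp, continuity_2d_pt_minus; auto.
      * apply continuity_2d_pt_inv; [| lra]. apply continuity_2d_pt_mult; [apply continuity_2d_pt_const |].
        eapply D2_continuity; eauto.
    + apply continuity_2d_pt_mult; auto.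
Qed.

(** [E x * exp (- K * x)] has nonpositive derivative; since only the end point matters, one use of
    the mean value theorem suffices. *)
Lemma Gronwall_zero (E E' : R -> R) (K : R) :
  (forall x, 0 <= x <= 1 -> is_derive E x (E' x)) ->
  (forall x, 0 <= x <= 1 -> E' x <= K * E x) ->
  (forall x, 0 <= E x) -> E 0 = 0 -> E 1 = 0.
Proof.
  intros HD HK HP H0.
  destruct (MVT_gen (fun x => E x * exp (- K * x)) 0 1 (fun x => (E' x - K * E x) * exp (- K * x))) as (c & Hc & Hm).
  - intros x Hx. rewrite Rmin_left, Rmax_right in Hx by lra.
    specialize (HD x ltac:(lra)).
    replace ((E' x - K * E x) * exp (- K * x)) with (E' x * exp (- K * x) + E x * (- K * exp (- K * x))) by ring.
    apply (is_derive_mult_R E (fun x => exp (- K * x))); auto.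
    + auto_derive; auto. ring.
  - intros x Hx. rewrite Rmin_left, Rmax_right in Hx by lra.
    apply continuity_pt_filterlim. apply (continuous_mult (K := R_AbsRing) E (fun x => exp (- K * x))).
    + apply ex_derive_continuous_R. eexists; apply HD; lra.
    + apply ex_derive_continuous_R. auto_derive; auto.
  - rewrite Rmin_left, Rmax_right in Hc by lra. specialize (HK c Hc).
    rewrite H0 in Hm. pose proof (exp_pos (- K * c)). pose proof (exp_pos (- K * 1)). specialize (HP 1).
    assert ((E' c - K * E c) * exp (- K * c) <= 0) by nra.
    assert (E 1 * exp (- K * 1) <= 0) by lra. nra.
Qed.

(* [y1, y2, y3, y4] stands for the differences of [f, f_s, f_t, Laplace f]. *)
Lemma energy_bound A K al be k1 k2 y1 y2 y3 y4 :
  0 <= A -> 0 <= K -> Rabs al <= A -> Rabs be <= A -> Rabs k1 <= K -> Rabs k2 <= K ->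
  2 * y1 * (al * y2 + be * y3) + 2 * y2 * (al * (/ 2 * (y4 + k1 * y1)) + be * (k2 * y1)) +
  2 * y3 * (al * (k2 * y1) + be * (/ 2 * (y4 - k1 * y1))) +
  2 * y4 * (al * (k1 * y2 + 2 * k2 * y3) + be * (2 * k2 * y2 - k1 * y3))
  <= 12 * (A * (1 + K)) * (y1 * y1 + y2 * y2 + y3 * y3 + y4 * y4).
Proof.
  intros HA HK Ha Hb H1 H2.
  set (N := A * (1 + K)). set (E := y1 * y1 + y2 * y2 + y3 * y3 + y4 * y4).
  (* The left side is a combination of twelve products of this shape: four with weight 1/2, six with
     weight 1 and two with weight 2, in total 12. *)
  assert (M : forall c x y, Rabs c <= N -> 2 * (x * y) <= E -> - E <= 2 * (x * y) -> 2 * (c * (x * y)) <= N * E).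
  { intros c x y Hc Hxy Hxy'. replace (2 * (c * (x * y))) with (c * (2 * (x * y))) by ring.
    eapply Rle_trans; [apply Rle_abs |]. rewrite Rabs_mult. apply Rmult_le_compat; auto using Rabs_pos.
    apply Rabs_le. lra. }
  assert (N1 : forall a, Rabs a <= A -> Rabs a <= N) by (intros; unfold N; nra).
  assert (N2 : forall a k, Rabs a <= A -> Rabs k <= K -> Rabs (a * k) <= N).
  { intros a k Haa Hk. rewrite Rabs_mult. unfold N.
    apply Rle_trans with (A * K); [apply Rmult_le_compat; auto using Rabs_pos | nra]. }
  assert (Rg : forall x y, x * x + y * y <= E -> 2 * (x * y) <= E /\ - E <= 2 * (x * y)).
  { intros x y H. pose proof (Rle_0_sqr (x - y)). pose proof (Rle_0_sqr (x + y)).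
    unfold Rsqr in *. split; lra. }
  pose proof (Rle_0_sqr y1) as s1. pose proof (Rle_0_sqr y2) as s2.
  pose proof (Rle_0_sqr y3) as s3. pose proof (Rle_0_sqr y4) as s4. unfold Rsqr in s1, s2, s3, s4.
  assert (P12 : y1 * y1 + y2 * y2 <= E) by (unfold E; lra).
  assert (P13 : y1 * y1 + y3 * y3 <= E) by (unfold E; lra).
  assert (P24 : y2 * y2 + y4 * y4 <= E) by (unfold E; lra).
  assert (P34 : y3 * y3 + y4 * y4 <= E) by (unfold E; lra).
  apply Rg in P12, P13, P24, P34.
  assert (T1 := M al y1 y2 (N1 _ Ha) (proj1 P12) (proj2 P12)).
  assert (T2 := M be y1 y3 (N1 _ Hb) (proj1 P13) (proj2 P13)).
  assert (T3 := M al y2 y4 (N1 _ Ha) (proj1 P24) (proj2 P24)).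
  assert (T4 := M (al * k1) y1 y2 (N2 _ _ Ha H1) (proj1 P12) (proj2 P12)).
  assert (T5 := M (be * k2) y1 y2 (N2 _ _ Hb H2) (proj1 P12) (proj2 P12)).
  assert (T6 := M (al * k2) y1 y3 (N2 _ _ Ha H2) (proj1 P13) (proj2 P13)).
  assert (T7 := M be y3 y4 (N1 _ Hb) (proj1 P34) (proj2 P34)).
  assert (Hb' : Rabs (- be) <= A) by (rewrite Rabs_Ropp; auto).
  assert (T8 := M (- be * k1) y1 y3 (N2 _ _ Hb' H1) (proj1 P13) (proj2 P13)).
  assert (T9 := M (al * k1) y2 y4 (N2 _ _ Ha H1) (proj1 P24) (proj2 P24)).
  assert (T10 := M (al * k2) y3 y4 (N2 _ _ Ha H2) (proj1 P34) (proj2 P34)).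
  assert (T11 := M (be * k2) y2 y4 (N2 _ _ Hb H2) (proj1 P24) (proj2 P24)).
  assert (T12 := M (- be * k1) y3 y4 (N2 _ _ Hb' H1) (proj1 P34) (proj2 P34)).
  assert (HN : 0 <= N) by (unfold N; nra).
  assert (HE : 0 <= E) by (unfold E; lra).
  assert (0 <= N * E) by nra.
  lra.
Qed.

Lemma continuous_bounded_01 (u : R -> R) :
  (forall x, 0 <= x <= 1 -> continuous u x) -> exists K, 0 <= K /\ forall x, 0 <= x <= 1 -> Rabs (u x) <= K.
Proof.
  intros Hu. destruct (continuity_ab_maj (fun t => Rabs (u t)) 0 1) as [x Hx].
  - lra.
  - intros t Ht. apply continuity_pt_filterlim.
    apply (continuous_comp u Rabs); [apply Hu; auto | apply continuous_Rabs].
  - exists (Rabs (u x)). split; [apply Rabs_pos |]. intros t Ht. apply Hx; auto.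
Qed.

Lemma disc_ray q rho z x :
  disc q rho z -> 0 <= x <= 1 ->
  disc q rho (fst q + x * (fst z - fst q), snd q + x * (snd z - snd q)).
Proof.
  intros Hz Hx. destruct z as [a b], q as [c d]. simpl. apply (disc_coord (c, d) rho a b); auto; simpl.
  - replace (c + x * (a - c) - c) with (x * (a - c)) by ring. rewrite Rabs_mult, Rabs_pos_eq by lra.
    pose proof (Rabs_pos (a - c)). nra.
  - replace (d + x * (b - d) - d) with (x * (b - d)) by ring. rewrite Rabs_mult, Rabs_pos_eq by lra.
    pose proof (Rabs_pos (b - d)). nra.
Qed.

(* Once the quadratic differentials agree, [(f, f_s, f_t, Laplace f)] solves the same
   linear ODE along every ray for both solutions. *)
Lemma liouville_jet_ray q rho f f1 f2 f11 f12 f22 g g1 g2 g11 g12 g22 :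
  liouville_jet (disc q rho) f f1 f2 f11 f12 f22 ->
  liouville_jet (disc q rho) g g1 g2 g11 g12 g22 ->
  (forall s t, disc q rho (s, t) ->
     (f11 s t - f22 s t) / f s t = (g11 s t - g22 s t) / g s t /\ f12 s t / f s t = g12 s t / g s t) ->
  f (fst q) (snd q) = g (fst q) (snd q) -> f1 (fst q) (snd q) = g1 (fst q) (snd q) ->
  f2 (fst q) (snd q) = g2 (fst q) (snd q) ->
  forall s t, disc q rho (s, t) -> f s t = g s t.
Proof.
  intros [HJ HE] [GJ GE] HQ E0 E1 E2 s t Hd.
  set (al := s - fst q). set (be := t - snd q).
  set (ga := fun x => fst q + x * al). set (gb := fun x => snd q + x * be).
  assert (HR : forall x, 0 <= x <= 1 -> disc q rho (ga x, gb x)).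
  { intros x Hx. apply (disc_ray q rho (s, t)); auto. }
  assert (Da : forall x, is_derive ga x al) by (intros x; unfold ga; auto_derive; auto; ring).
  assert (Db : forall x, is_derive gb x be) by (intros x; unfold gb; auto_derive; auto; ring).
  (* The second derivatives are merely continuous, but the equation expresses the Laplacian through
     first-order quantities, and this expression is differentiable. *)
  set (lap := fun (h h1 h2 : R -> R -> R) s t => (1 + h1 s t * h1 s t + h2 s t * h2 s t) * / h s t).
  (* This closes the system: the gradient of the Laplacian is linear in [h1] and [h2], with
     coefficients made of the quadratic differential alone. *)
  assert (DL : forall h h1 h2 h11 h12 h22 s t, liouville_jet (disc q rho) h h1 h2 h11 h12 h22 -> disc q rho (s, t) ->
     lap h h1 h2 s t = h11 s t + h22 s t /\
     D2 (lap h h1 h2) s t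
       ((h11 s t - h22 s t) / h s t * h1 s t + 2 * (h12 s t / h s t) * h2 s t)
       (2 * (h12 s t / h s t) * h1 s t - (h11 s t - h22 s t) / h s t * h2 s t)).
  { clear. intros h h1 h2 h11 h12 h22 s t [HJ HE] Hd.
    destruct (HJ s t Hd) as (A & A1 & A2 & _). destruct (HE s t Hd) as [Hp HEq].
    assert (E11 : h11 s t = (1 + h1 s t * h1 s t + h2 s t * h2 s t) / h s t - h22 s t).
    { rewrite <- HEq. field. lra. }
    split.
    - unfold lap. rewrite E11. field. lra.
    - unfold lap. eapply D2_eq.
      + apply D2_mult; [| apply D2_inv; [eassumption | lra]].
        apply D2_plus; [apply D2_plus; [apply D2_const |] |]; apply D2_sqr; eassumption.
      + cbv beta. rewrite E11. field. lra.
      + cbv beta. rewrite E11. field. lra. }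
  set (k1 := fun x => (f11 (ga x) (gb x) - f22 (ga x) (gb x)) / f (ga x) (gb x)).
  set (k2 := fun x => f12 (ga x) (gb x) / f (ga x) (gb x)).
  set (y := fun (h k : R -> R -> R) x => h (ga x) (gb x) - k (ga x) (gb x)).
  assert (Dy : forall h a b k c d x, D2 h (ga x) (gb x) a b -> D2 k (ga x) (gb x) c d ->
     is_derive (y h k) x ((a * al + b * be) - (c * al + d * be))).
  { intros. unfold y. apply is_derive_minus_R;
    apply D2_path; auto. }
  set (y4 := y (lap f f1 f2) (lap g g1 g2)).
  set (En := fun x => y f g x * y f g x + y f1 g1 x * y f1 g1 x + y f2 g2 x * y f2 g2 x + y4 x * y4 x).
  assert (Bk : exists K, 0 <= K /\ forall x, 0 <= x <= 1 -> Rabs (k1 x) <= K /\ Rabs (k2 x) <= K).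
  { assert (Ct : forall h x, continuity_2d_pt h (ga x) (gb x) -> continuous (fun x => h (ga x) (gb x)) x).
    { intros h x Hh. apply continuity_2d_pt_filterlim in Hh.
      apply (continuous_comp_2 (U := R_UniformSpace) (V := R_UniformSpace) (W := R_UniformSpace) (X := R_UniformSpace) ga gb h).
      - apply ex_derive_continuous_R. eexists; apply Da.
      - apply ex_derive_continuous_R. eexists; apply Db.
      - exact Hh. }
    assert (Ci : forall x, 0 <= x <= 1 -> continuity_2d_pt (fun s t => / f s t) (ga x) (gb x)).
    { intros x Hx. apply continuity_2d_pt_inv.
      - apply (jet2_continuity _ _ _ _ _ _ _ _ _ HJ (HR x Hx)).
      - destruct (HE _ _ (HR x Hx)). lra. }
    destruct (continuous_bounded_01 k1) as (K1 & HK1 & B1).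
    { intros x Hx. apply (Ct (fun s t => (f11 s t - f22 s t) / f s t)).
      destruct (HJ _ _ (HR x Hx)) as (_ & _ & _ & c11 & c12 & c22).
      apply continuity_2d_pt_mult; [apply continuity_2d_pt_minus; auto | auto]. }
    destruct (continuous_bounded_01 k2) as (K2 & HK2 & B2).
    { intros x Hx. apply (Ct (fun s t => f12 s t / f s t)).
      destruct (HJ _ _ (HR x Hx)) as (_ & _ & _ & c11 & c12 & c22).
      apply continuity_2d_pt_mult; auto. }
    exists (K1 + K2). split; [lra |]. intros x Hx. specialize (B1 x Hx). specialize (B2 x Hx). split; lra. }
  destruct Bk as (K & HK & Bk).
  set (A := Rabs al + Rabs be). assert (HA : 0 <= A) by (pose proof (Rabs_pos al); pose proof (Rabs_pos be); unfold A; lra).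
  assert (Ha : Rabs al <= A) by (pose proof (Rabs_pos be); unfold A; lra).
  assert (Hb : Rabs be <= A) by (pose proof (Rabs_pos al); unfold A; lra).
  assert (Dsq : forall u x d, is_derive u x d -> is_derive (fun x => u x * u x) x (2 * u x * d)).
  { intros u x d Hu. replace (2 * u x * d) with (d * u x + u x * d) by ring.
    apply is_derive_mult_R; auto. }
  set (En' := fun x => 2 * y f g x * (al * y f1 g1 x + be * y f2 g2 x) +
     2 * y f1 g1 x * (al * (/ 2 * (y4 x + k1 x * y f g x)) + be * (k2 x * y f g x)) +
     2 * y f2 g2 x * (al * (k2 x * y f g x) + be * (/ 2 * (y4 x - k1 x * y f g x))) +
     2 * y4 x * (al * (k1 x * y f1 g1 x + 2 * k2 x * y f2 g2 x) + be * (2 * k2 x * y f1 g1 x - k1 x * y f2 g2 x))).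
  assert (Z : En 1 = 0).
  { apply (Gronwall_zero En En' (12 * (A * (1 + K)))).
    - intros x Hx. specialize (HR x Hx).
      destruct (HJ _ _ HR) as (F & F1 & F2 & _). destruct (GJ _ _ HR) as (G & G1 & G2 & _).
      destruct (DL f f1 f2 f11 f12 f22 _ _ (conj HJ HE) HR) as [LF DF].
      destruct (DL g g1 g2 g11 g12 g22 _ _ (conj GJ GE) HR) as [LG DG].
      destruct (HQ _ _ HR) as [Q1 Q2]. destruct (HE _ _ HR) as [Pf _]. destruct (GE _ _ HR) as [Pg _].
      fold (k1 x) in Q1, DF. fold (k2 x) in Q2, DF. rewrite <- Q1, <- Q2 in DG.
      assert (e1 : f11 (ga x) (gb x) - f22 (ga x) (gb x) = k1 x * f (ga x) (gb x)) by (unfold k1; field; lra).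
      assert (e2 : f12 (ga x) (gb x) = k2 x * f (ga x) (gb x)) by (unfold k2; field; lra).
      assert (e3 : g11 (ga x) (gb x) - g22 (ga x) (gb x) = k1 x * g (ga x) (gb x)) by (rewrite Q1; field; lra).
      assert (e4 : g12 (ga x) (gb x) = k2 x * g (ga x) (gb x)) by (rewrite Q2; field; lra).
      replace (En' x) with
        (2 * y f g x * ((f1 (ga x) (gb x) * al + f2 (ga x) (gb x) * be) - (g1 (ga x) (gb x) * al + g2 (ga x) (gb x) * be)) +
         2 * y f1 g1 x * ((f11 (ga x) (gb x) * al + f12 (ga x) (gb x) * be) - (g11 (ga x) (gb x) * al + g12 (ga x) (gb x) * be)) +
         2 * y f2 g2 x * ((f12 (ga x) (gb x) * al + f22 (ga x) (gb x) * be) - (g12 (ga x) (gb x) * al + g22 (ga x) (gb x) * be)) +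
         2 * y4 x * (((k1 x * f1 (ga x) (gb x) + 2 * k2 x * f2 (ga x) (gb x)) * al +
                     (2 * k2 x * f1 (ga x) (gb x) - k1 x * f2 (ga x) (gb x)) * be) -
                    ((k1 x * g1 (ga x) (gb x) + 2 * k2 x * g2 (ga x) (gb x)) * al +
                     (2 * k2 x * g1 (ga x) (gb x) - k1 x * g2 (ga x) (gb x)) * be))).
      + unfold En. apply is_derive_plus_R;
        [apply is_derive_plus_R;
         [apply is_derive_plus_R |] |];
        apply Dsq; apply Dy; assumption.
      + unfold En'. unfold y4, y. rewrite LF, LG, e2, e4.
        replace (f11 (ga x) (gb x)) with (f22 (ga x) (gb x) + k1 x * f (ga x) (gb x)) by lra.
        replace (g11 (ga x) (gb x)) with (g22 (ga x) (gb x) + k1 x * g (ga x) (gb x)) by lra.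
        field.
    - intros x Hx. destruct (Bk x Hx). apply energy_bound; auto.
    - intros x. unfold En. nra.
    (* At the centre the fourth component is determined by the other three through [lap]. *)
    - assert (G0 : ga 0 = fst q) by (unfold ga; ring). assert (G0' : gb 0 = snd q) by (unfold gb; ring).
      unfold En, y4, y, lap. rewrite G0, G0', E0, E1, E2. ring. }
  assert (y f g 1 = 0).
  { unfold En in Z. pose proof (Rle_0_sqr (y f1 g1 1)). pose proof (Rle_0_sqr (y f2 g2 1)).
    pose proof (Rle_0_sqr (y4 1)). pose proof (Rle_0_sqr (y f g 1)). unfold Rsqr in *.
    assert (y f g 1 * y f g 1 = 0) by lra. apply Rmult_integral in H3. tauto. }
  unfold y in H. replace (ga 1) with s in H by (unfold ga, al; ring).
  replace (gb 1) with t in H by (unfold gb, be; ring). lra.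
Qed.

Lemma is_derive_unique_loc (u v : R -> R) x a b :
  locally x (fun y => u y = v y) -> is_derive u x a -> is_derive v x b -> a = b.
Proof.
  intros L Hu Hv. apply is_derive_unique in Hv. rewrite <- Hv. symmetry. apply is_derive_unique.
  apply is_derive_ext_loc with u; auto.
Qed.

(** On the horizontal segment through the centre the Cauchy data fix all second derivatives of the
    inverse square roots: tangential differentiation gives [f1], [f11] and [f12], the equation gives
    [f22]. So the quadratic differentials agree there, hence on the disc. The centre is arbitrary
    because the continuation argument uses discs off the real axis. *)
Theorem liouville_local_uniqueness q rho d psi phi :
  liouville_solution (disc q rho) psi -> liouville_solution (disc q rho) phi ->
  0 < d ->
  (forall x, Rabs (x - fst q) < d ->
     psi x (snd q) = phi x (snd q) /\ partial_derive 0 1 psi x (snd q) = partial_derive 0 1 phi x (snd q)) ->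
  forall s t, disc q rho (s, t) -> psi s t = phi s t.
Proof.
  intros Hpsi Hphi Hd0 Hin s t Hst.
  assert (Hrho : 0 < rho). { unfold disc in Hst. pose proof (Cmod_ge_0 ((s, t) - q)). lra. }
  destruct (liouville_solution_jet _ _ (disc_is_open q rho) Hpsi) as (f1 & f2 & f11 & f12 & f22 & HF & Hf2).
  destruct (liouville_solution_jet _ _ (disc_is_open q rho) Hphi) as (g1 & g2 & g11 & g12 & g22 & HG & Hg2).
  set (f := inv_sqrt_of psi) in *. set (g := inv_sqrt_of phi) in *.
  set (e := Rmin d rho).
  assert (He : 0 < e) by (apply Rmin_pos; auto).
  pose proof (Rmin_l d rho) as el. pose proof (Rmin_r d rho) as er. fold e in el, er.
  destruct q as [a b]. simpl in Hin.
  assert (SD : forall x, Rabs (x - a) < e -> disc (a, b) rho (x, b)).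
  { intros x Hx. unfold disc. eapply Rle_lt_trans; [apply Cmod_le_Rabs_sum |]. simpl.
    replace (b + - b) with 0 by ring. rewrite Rabs_R0. unfold Rminus in Hx. lra. }
  assert (SL : forall x, Rabs (x - a) < e -> locally x (fun y => Rabs (y - a) < e)).
  { intros x Hx. exists (mkposreal (e - Rabs (x - a)) ltac:(lra)). intros y Hy.
    change (Rabs (y - x) < e - Rabs (x - a)) in Hy.
    replace (y - a) with ((y - x) + (x - a)) by ring. eapply Rle_lt_trans; [apply Rabs_triang |]. lra. }
  destruct HF as [FJ FE]. destruct HG as [GJ GE].
  assert (S0 : forall x, Rabs (x - a) < e -> f x b = g x b).
  { intros x Hx. unfold f, g, inv_sqrt_of. destruct (Hin x ltac:(lra)) as [-> _]. reflexivity. }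
  assert (S2 : forall x, Rabs (x - a) < e -> f2 x b = g2 x b).
  { intros x Hx. rewrite (Hf2 x b), (Hg2 x b) by auto. destruct (Hin x ltac:(lra)) as [K1 K2].
    fold f g. rewrite S0, K1, K2 by auto. reflexivity. }
  assert (Ds : forall (h k : R -> R -> R) x (p q : R), Rabs (x - a) < e ->
     (forall x, Rabs (x - a) < e -> h x b = k x b) ->
     is_derive (fun x => h x b) x p -> is_derive (fun x => k x b) x q -> p = q).
  { intros h k x p q Hx E. apply is_derive_unique_loc.
    generalize (SL x Hx). apply filter_imp. exact E. }
  assert (S1 : forall x, Rabs (x - a) < e -> f1 x b = g1 x b).
  { intros x Hx. apply (Ds f g x _ _ Hx S0); eapply D2_derive_1; [apply FJ | apply GJ]; auto. }
  assert (S11 : forall x, Rabs (x - a) < e -> f11 x b = g11 x b).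
  { intros x Hx. apply (Ds f1 g1 x _ _ Hx S1); eapply D2_derive_1; [apply FJ | apply GJ]; auto. }
  assert (S12 : forall x, Rabs (x - a) < e -> f12 x b = g12 x b).
  { intros x Hx. apply (Ds f2 g2 x _ _ Hx S2); eapply D2_derive_1; [apply FJ | apply GJ]; auto. }
  (* The only second derivative transversal to the segment; the equation can be solved for it
     because [f] is positive. *)
  assert (S22 : forall x, Rabs (x - a) < e -> f22 x b = g22 x b).
  { intros x Hx. destruct (FE x b (SD x Hx)) as [Pf Ef]. destruct (GE x b (SD x Hx)) as [Pg Eg].
    rewrite (S0 x Hx), (S1 x Hx), (S2 x Hx), (S11 x Hx), <- Eg in Ef.
    apply Rmult_eq_reg_l in Ef; lra. }
  destruct (liouville_quadratic_differential (a, b) rho f f1 f2 f11 f12 f22 (conj FJ FE)) as [H1 HH1].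
  destruct (liouville_quadratic_differential (a, b) rho g g1 g2 g11 g12 g22 (conj GJ GE)) as [H2 HH2].
  match type of HH1 with C1_holomorphic _ _ ?q => set (Q1 := q) in * end.
  match type of HH2 with C1_holomorphic _ _ ?q => set (Q2 := q) in * end.
  assert (HH : C1_holomorphic (disc (a, b) rho) (fun z => H1 z - H2 z)%C (fun z => Q1 z - Q2 z)%C).
  { intros z Hz. destruct (HH1 z Hz), (HH2 z Hz). split; [apply cderiv_minus; auto | apply ccont_minus; auto]. }
  (* [Q1 - Q2] is so far just the continuous derivative of a holomorphic function; it has to be
     holomorphic itself before the identity theorem applies to it. *)
  destruct (holomorphic_derivative _ _ _ _ HH) as [H3 HH3].
  assert (QZ : forall z, disc (a, b) rho z -> (Q1 z - Q2 z)%C = 0).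
  { apply (holomorphic_identity (a, b) rho _ _ e HH3 He).
    intros x Hx. replace ((a, b) + RtoC x)%C with (a + x, b) by (apply injective_projections; simpl; ring).
    assert (Hx' : Rabs (a + x - a) < e) by (replace (a + x - a) with x by ring; auto).
    unfold Q1, Q2. simpl. rewrite (S0 _ Hx'), (S11 _ Hx'), (S12 _ Hx'), (S22 _ Hx'). ring. }
  assert (Hff : f s t = g s t).
  { assert (H00 : Rabs (a - a) < e) by (rewrite Rminus_diag, Rabs_R0; auto).
    apply (liouville_jet_ray (a, b) rho f f1 f2 f11 f12 f22 g g1 g2 g11 g12 g22); auto.
    - split; auto.
    - split; auto.
    - intros u v Huv. specialize (QZ (u, v) Huv). destruct (FE u v Huv) as [Pf _]. destruct (GE u v Huv) as [Pg _].
      unfold Q1, Q2 in QZ. simpl in QZ.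
      pose proof (f_equal fst QZ) as q1. pose proof (f_equal snd QZ) as q2. simpl in q1, q2.
      assert (T : forall h h11 h22 : R, 0 < h -> (h11 - h22) / h = -2 * (- (h11 - h22) / (2 * h))) by (intros; field; lra).
      split; [| lra]. rewrite (T _ _ _ Pf), (T _ _ _ Pg). lra. }
  destruct Hpsi as (_ & Ppsi & _). destruct Hphi as (_ & Pphi & _).
  pose proof (inv_sqrt_of_sqr psi s t (Ppsi s t Hst)) as I1.
  pose proof (inv_sqrt_of_sqr phi s t (Pphi s t Hst)) as I2.
  fold f in I1. fold g in I2. rewrite <- Hff in I2.
  destruct (FE s t Hst) as [Pf _].
  apply (Rmult_eq_reg_l (f s t * f s t)); [lra | nra].
Qed.

(** * Path integrals and primitives *)

(** Equal to [6 * x * (1 - x)] on the unit interval, where its integral is 1, and to 0 elsewhere;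
    the absolute value makes continuity immediate. *)
Definition bump (x : R) : R := 3 * (x * (1 - x) + Rabs (x * (1 - x))).

Definition smoothstep (x : R) : R := RInt bump 0 x.

Lemma continuous_bump x : continuous bump x.
Proof.
  assert (H : continuous (fun x => x * (1 - x)) x).
  { apply ex_derive_continuous_R. auto_derive; auto. }
  apply (continuous_scal (K := R_AbsRing) (V := R_NormedModule) (fun _ => 3)); [apply continuous_const |].
  apply (continuous_plus (K := R_AbsRing) (V := R_NormedModule)); auto.
  apply (continuous_comp (fun x => x * (1 - x)) Rabs); auto. apply continuous_Rabs.
Qed.

Lemma ex_RInt_bump a b : ex_RInt bump a b.
Proof. apply (ex_RInt_continuous (V := R_CompleteNormedModule)). intros; apply continuous_bump. Qed.

Lemma bump_out x : x <= 0 \/ 1 <= x -> bump x = 0.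
Proof.
  intros H. unfold bump. rewrite Rabs_left1; [ring |]. destruct H; nra.
Qed.

Lemma bump_in x : 0 <= x <= 1 -> bump x = 6 * x * (1 - x).
Proof. intros H. unfold bump. rewrite Rabs_pos_eq; [ring | nra]. Qed.

Lemma bump_ge_0 x : 0 <= bump x.
Proof. unfold bump. pose proof (Rabs_maj2 (x * (1 - x))). lra. Qed.

Lemma is_derive_smoothstep x : is_derive smoothstep x (bump x).
Proof.
  apply (is_derive_RInt (V := R_NormedModule) bump smoothstep 0 x).
  - apply filter_forall. intros y. apply (RInt_correct (V := R_CompleteNormedModule)), ex_RInt_bump.
  - apply continuous_bump.
Qed.

Lemma smoothstep_neg x : x <= 0 -> smoothstep x = 0.
Proof.
  intros H. unfold smoothstep. rewrite (RInt_ext _ (fun _ => 0)).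
  - rewrite RInt_const. apply Rmult_0_r.
  - intros t Ht. rewrite Rmin_right, Rmax_left in Ht by lra. apply bump_out. lra.
Qed.

Lemma smoothstep_1 : smoothstep 1 = 1.
Proof.
  unfold smoothstep. rewrite (RInt_ext _ (fun x => 6 * x * (1 - x))).
  - apply is_RInt_unique.
    replace 1 with (minus ((fun x => 3 * x ^ 2 - 2 * x ^ 3) 1) ((fun x => 3 * x ^ 2 - 2 * x ^ 3) 0)) at 2
      by (unfold minus, plus, opp; simpl; ring).
    apply (is_RInt_derive (V := R_CompleteNormedModule) (fun x => 3 * x ^ 2 - 2 * x ^ 3)).
    + intros x _. auto_derive; auto. ring.
    + intros x _. apply ex_derive_continuous_R. auto_derive; auto.
  - intros t Ht. rewrite Rmin_left, Rmax_right in Ht by lra. apply bump_in. lra.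
Qed.

Lemma smoothstep_sub a b : smoothstep b - smoothstep a = RInt bump a b.
Proof.
  unfold smoothstep. rewrite <- (RInt_Chasles bump 0 a b) by apply ex_RInt_bump.
  unfold plus; simpl. ring.
Qed.

Lemma smoothstep_ge_1 x : 1 <= x -> smoothstep x = 1.
Proof.
  intros H. rewrite <- smoothstep_1. apply Rminus_diag_uniq. rewrite smoothstep_sub.
  rewrite (RInt_ext _ (fun _ => 0)).
  - rewrite RInt_const. apply Rmult_0_r.
  - intros t Ht. rewrite Rmin_left, Rmax_right in Ht by lra. apply bump_out. lra.
Qed.

Lemma smoothstep_mono a b : a <= b -> smoothstep a <= smoothstep b.
Proof.
  intros H. apply Rminus_le_0. rewrite smoothstep_sub.
  apply RInt_ge_0; auto. apply ex_RInt_bump. intros; apply bump_ge_0.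
Qed.

Lemma smoothstep_range x : 0 <= smoothstep x <= 1.
Proof.
  split.
  - destruct (Rle_dec x 0); [rewrite smoothstep_neg; lra |].
    rewrite <- (smoothstep_neg 0) by lra. apply smoothstep_mono; lra.
  - destruct (Rle_dec 1 x); [rewrite smoothstep_ge_1; lra |].
    rewrite <- smoothstep_1. apply smoothstep_mono; lra.
Qed.

Lemma pderiv_comp_real g u t d e :
  pderiv g (u t) d -> is_derive u t e -> pderiv (fun x => g (u x)) t (RtoC e * d)%C.
Proof.
  intros [A B] H. destruct d as [p q]. simpl in A, B. split; simpl.
  - replace (e * p - 0 * q) with (e * p) by ring.
    apply (is_derive_comp_R (fun s => fst (g s)) u); auto.
  - replace (e * q + 0 * p) with (e * q) by ring.
    apply (is_derive_comp_R (fun s => snd (g s)) u); auto.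
Qed.

Lemma CInt_comp f (g dg : R -> R) a b :
  (forall x, Rmin a b <= x <= Rmax a b -> pcont f (g x)) ->
  (forall x, Rmin a b <= x <= Rmax a b -> is_derive g x (dg x) /\ continuous dg x) ->
  CInt (fun x => RtoC (dg x) * f (g x))%C a b = CInt f (g a) (g b).
Proof.
  intros Hf Hg. unfold CInt. apply injective_projections; simpl.
  - rewrite <- (RInt_comp (V := R_CompleteNormedModule) (fun t => fst (f t)) g dg a b); auto.
    + apply RInt_ext. intros x _. unfold scal; simpl; unfold mult; simpl. ring.
    + intros x Hx. specialize (Hf x Hx). apply pcont_iff in Hf. apply Hf.
  - rewrite <- (RInt_comp (V := R_CompleteNormedModule) (fun t => snd (f t)) g dg a b); auto.
    + apply RInt_ext. intros x _. unfold scal; simpl; unfold mult; simpl. ring.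
    + intros x Hx. specialize (Hf x Hx). apply pcont_iff in Hf. apply Hf.
Qed.

Lemma CInt_Chasles f a b c :
  pcont_on f a b -> pcont_on f b c -> (CInt f a b + CInt f b c)%C = CInt f a c.
Proof.
  intros H1 H2. destruct (pcont_ex_RInt _ _ _ H1), (pcont_ex_RInt _ _ _ H2).
  unfold CInt. apply injective_projections; simpl; apply (RInt_Chasles (V := R_CompleteNormedModule)); auto.
Qed.

Section Append.

Variables (U : C -> Prop) (r G : C -> C) (p z w : C) (gamma dgamma : R -> C).
Hypothesis Hr : forall v, U v -> ccont r v.
Hypothesis HG : integral_from U r p G.
Hypothesis Hpath : C1_path U gamma dgamma p z.
Hypothesis Hseg : forall x, 0 <= x <= 1 -> U (z + RtoC x * (w - z))%C.

(* The smooth step slows both pieces down to speed zero at the junction. *)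
Let Ga (x : R) : C := (gamma (smoothstep (2 * x)) + RtoC (smoothstep (2 * x - 1)) * (w - z))%C.
Let dGa (x : R) : C :=
  (RtoC (2 * bump (2 * x)) * dgamma (smoothstep (2 * x)) + RtoC (2 * bump (2 * x - 1)) * (w - z))%C.

Let is_derive_left x : is_derive (fun x => smoothstep (2 * x)) x (2 * bump (2 * x)).
Proof.
  apply (is_derive_comp_R smoothstep (fun x => 2 * x)).
  - apply is_derive_smoothstep.
  - auto_derive; auto. ring.
Qed.

Let is_derive_right x : is_derive (fun x => smoothstep (2 * x - 1)) x (2 * bump (2 * x - 1)).
Proof.
  apply (is_derive_comp_R smoothstep (fun x => 2 * x - 1)).
  - apply is_derive_smoothstep.
  - auto_derive; auto. ring.
Qed.

Let continuous_left x : continuous (fun x => 2 * bump (2 * x)) x.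
Proof.
  apply (continuous_scal (K := R_AbsRing) (V := R_NormedModule) (fun _ => 2)); [apply continuous_const |].
  apply (continuous_comp (fun x => 2 * x) bump); [| apply continuous_bump].
  apply ex_derive_continuous_R. auto_derive; auto.
Qed.

Let continuous_right x : continuous (fun x => 2 * bump (2 * x - 1)) x.
Proof.
  apply (continuous_scal (K := R_AbsRing) (V := R_NormedModule) (fun _ => 2)); [apply continuous_const |].
  apply (continuous_comp (fun x => 2 * x - 1) bump); [| apply continuous_bump].
  apply ex_derive_continuous_R. auto_derive; auto.
Qed.

Let pcont_RtoC u x : continuous u x -> pcont (fun x => RtoC (u x)) x.
Proof. intros H. apply pcont_iff. simpl. split; [exact H | apply continuous_const]. Qed.

Lemma pderiv_gamma x : pderiv gamma x (dgamma x).
Proof. destruct Hpath as (_ & _ & _ & H & _). apply pderiv_is_derive, H. Qed.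

Lemma pcont_dgamma x : pcont dgamma x.
Proof. destruct Hpath as (_ & _ & _ & _ & H). apply H. Qed.

Lemma C1_path_append : C1_path U Ga dGa p w.
Proof.
  destruct Hpath as (H0 & H1 & HU & _). unfold Ga, dGa. split; [| split; [| split; [| split]]].
  - rewrite (smoothstep_neg (2 * 0)), (smoothstep_neg (2 * 0 - 1)), H0 by lra. ring.
  - rewrite (smoothstep_ge_1 (2 * 1)), (smoothstep_ge_1 (2 * 1 - 1)), H1 by lra. ring.
  - intros x Hx. destruct (Rle_dec x (/ 2)) as [h | h].
    + rewrite (smoothstep_neg (2 * x - 1)) by lra.
      replace (gamma (smoothstep (2 * x)) + 0 * (w - z))%C with (gamma (smoothstep (2 * x))) by ring.
      apply HU. apply smoothstep_range.
    + rewrite (smoothstep_ge_1 (2 * x)), H1 by lra. apply Hseg, smoothstep_range.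
  - intros x. apply pderiv_is_derive. apply pderiv_plus.
    + apply pderiv_comp_real with (u := fun x => smoothstep (2 * x)); [apply pderiv_gamma | apply is_derive_left].
    + eapply pderiv_eq; [apply pderiv_mult; [apply pderiv_RtoC, is_derive_right | apply pderiv_const] |].
      cbv beta. ring.
  - intros x. apply (pcont_plus (fun x => RtoC (2 * bump (2 * x)) * dgamma (smoothstep (2 * x)))%C).
    + apply pcont_mult; [apply pcont_RtoC, continuous_left |].
      apply (continuous_comp (U := R_UniformSpace) (V := R_UniformSpace) (W := C_UniformSpace) (fun x => smoothstep (2 * x)) dgamma).
      * apply ex_derive_continuous_R. eexists; apply is_derive_left.
      * apply pcont_dgamma.
    + apply pcont_mult; [apply pcont_RtoC, continuous_right | apply pcont_const].
Qed.

Lemma pcont_segment x : pcont (fun u => z + RtoC u * (w - z))%C x.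
Proof.
  apply pcont_plus; [apply pcont_const |]. apply pcont_mult; [| apply pcont_const].
  apply pcont_RtoC. apply continuous_id.
Qed.

(** A [C1_path] has no corners, so a segment is attached after reparametrising by [smoothstep]. On
    each half of the parameter interval one of the two pieces is at rest, and substitution undoes
    the change of speed on the other. *)
Lemma integral_append :
  G w = (G z + CInt (fun u => r (z + RtoC u * (w - z))) 0 1 * (w - z))%C.
Proof.
  pose proof C1_path_append as HP. pose proof HP as (_ & _ & HU & HD & HC).
  pose proof (is_RInt_CInt _ _ _ _ (HG _ _ _ HP)) as E. rewrite E.
  rewrite (is_RInt_CInt _ _ _ _ (HG _ _ _ Hpath)).
  assert (PG : forall x, 0 <= x <= 1 -> pcont (fun x => r (Ga x) * dGa x)%C x).
  { intros x Hx. apply pcont_mult; [| apply HC]. apply pcont_comp; [apply Hr, HU; auto |].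
    eapply pderiv_pcont. apply pderiv_is_derive. apply HD. }
  rewrite <- (CInt_Chasles _ 0 (/ 2) 1).
  2: { intros t Ht. rewrite Rmin_left, Rmax_right in Ht by lra. apply PG; lra. }
  2: { intros t Ht. rewrite Rmin_left, Rmax_right in Ht by lra. apply PG; lra. }
  pose proof Hpath as (H0 & H1 & HUg & _). f_equal.
  - transitivity (CInt (fun x => RtoC (2 * bump (2 * x)) * ((fun s => r (gamma s) * dgamma s) (smoothstep (2 * x))))%C 0 (/ 2)).
    + apply CInt_ext. intros x Hx. rewrite Rmin_left, Rmax_right in Hx by lra.
      unfold Ga, dGa. rewrite (smoothstep_neg (2 * x - 1)), (bump_out (2 * x - 1)) by lra.
      replace (gamma (smoothstep (2 * x)) + 0 * (w - z))%C with (gamma (smoothstep (2 * x))) by ring.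
      rewrite Rmult_0_r. ring.
    + rewrite (CInt_comp (fun s => r (gamma s) * dgamma s)%C (fun x => smoothstep (2 * x)) (fun x => 2 * bump (2 * x))).
      * rewrite (smoothstep_neg (2 * 0)), (smoothstep_ge_1 (2 * / 2)) by lra. reflexivity.
      * intros x _. apply pcont_mult; [| apply pcont_dgamma]. apply pcont_comp.
        -- apply Hr, HUg, smoothstep_range.
        -- eapply pderiv_pcont, pderiv_gamma.
      * intros x _. split; [apply is_derive_left | apply continuous_left].
  - rewrite Cmult_comm. rewrite <- CInt_scal.
    2: { intros x Hx. rewrite Rmin_left, Rmax_right in Hx by lra.
         apply pcont_comp; [apply Hr, Hseg; auto | apply pcont_segment]. }
    transitivity (CInt (fun x => RtoC (2 * bump (2 * x - 1)) *
       ((fun u => (w - z) * r (z + RtoC u * (w - z))) (smoothstep (2 * x - 1))))%C (/ 2) 1).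
    + apply CInt_ext. intros x Hx. rewrite Rmin_left, Rmax_right in Hx by lra.
      unfold Ga, dGa. rewrite (smoothstep_ge_1 (2 * x)), (bump_out (2 * x)), H1 by lra.
      rewrite Rmult_0_r. ring.
    + rewrite (CInt_comp (fun u => (w - z) * r (z + RtoC u * (w - z)))%C (fun x => smoothstep (2 * x - 1)) (fun x => 2 * bump (2 * x - 1))).
      * rewrite (smoothstep_neg (2 * / 2 - 1)), (smoothstep_ge_1 (2 * 1 - 1)) by lra. reflexivity.
      * intros x _. apply pcont_mult; [apply pcont_const |].
        apply pcont_comp with (g := fun u => (z + RtoC u * (w - z))%C).
        -- apply Hr, Hseg, smoothstep_range.
        -- apply pcont_segment.
      * intros x _. split; [apply is_derive_right | apply continuous_right].
Qed.

End Append.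

Lemma C1_path_const U p : U p -> C1_path U (fun _ => p) (fun _ => RtoC 0) p p.
Proof.
  intros Hp. split; [| split; [| split; [| split]]]; auto.
  - intros x. apply pderiv_is_derive, pderiv_const.
  - intros x. apply pcont_const.
Qed.

Lemma disc_segment z e w x : disc z e w -> 0 <= x <= 1 -> disc z e (z + RtoC x * (w - z))%C.
Proof.
  unfold disc. intros Hw Hx. replace (z + RtoC x * (w - z) - z)%C with (RtoC x * (w - z))%C by ring.
  rewrite Cmod_mult, Cmod_R, Rabs_pos_eq by lra. pose proof (Cmod_ge_0 (w - z)). nra.
Qed.

(** By [integral_append] the increment of [G] from [z] to [w] is [w - z] times the mean of [r] over
    the segment, and continuity of [r] makes this mean tend to [r z]. *)
Theorem integral_from_primitive U r G p :
  open (T := C_UniformSpace) U -> connected_set U -> U p ->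
  (forall z, U z -> ccont r z) -> integral_from U r p G ->
  forall z, U z -> cderiv G z (r z).
Proof.
  intros HO HC Hp Hr HG.
  (* [integral_from] constrains [G] only at end points of paths. The set reached is open with open
     complement in [U], so connectedness makes it all of [U]. *)
  set (reach := fun z => U z /\ exists gamma dgamma, C1_path U gamma dgamma p z).
  assert (Rp : reach p).
  { split; auto. exists (fun _ => p), (fun _ => 0).
    apply C1_path_const; auto. }
  assert (step : forall z w e, reach z -> (forall v, disc z e v -> U v) -> disc z e w ->
     reach w /\ G w = (G z + CInt (fun u => r (z + RtoC u * (w - z))) 0 1 * (w - z))%C).
  { intros z w e [Hz (ga & dga & Hpath)] He Hw.
    assert (Hs : forall x, 0 <= x <= 1 -> U (z + RtoC x * (w - z))%C).
    { intros x Hx. apply He, disc_segment; auto. }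
    split.
    - split; [auto |]. do 2 eexists. apply (C1_path_append U p z w ga dga Hpath Hs).
    - apply (integral_append U r G p z w ga dga Hr HG Hpath Hs). }
  assert (All : forall z, U z -> reach z).
  { intros z Hz. apply NNPP. intros Hn.
    destruct (HC reach (fun z => U z /\ ~ reach z)) as (v & _ & Hv & _ & Hv').
    - intros v Hv. apply locally_disc. destruct (open_disc U v HO (proj1 Hv)) as (e & He & HU).
      exists e. split; auto. intros w Hw. apply (step v w e); auto.
    - intros v [Hv Hv']. apply locally_disc. destruct (open_disc U v HO Hv) as (e & He & HU).
      exists (e / 2). split; [lra |]. intros w Hw. split; [apply HU; unfold disc; lra |].
      intros Rw. apply Hv'. apply (step w v (e / 2)); auto.
      + intros u Hu. apply HU. unfold disc in *. pose proof (Cmod_sub_triangle u w v). lra.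
      + unfold disc. rewrite Cmod_sub_sym. exact Hw.
    - intros v Hv. destruct (classic (reach v)); auto.
    - exists p; auto.
    - exists z; auto.
    - tauto. }
  intros z Hz. apply cderiv_eps. intros eps Heps.
  (* The half compensates the factor 2 of [CInt_bound]. *)
  destruct (Hr z Hz (eps / 2) ltac:(lra)) as (d1 & Hd1 & Hc).
  destruct (open_disc U z HO Hz) as (d2 & Hd2 & HU).
  exists (Rmin d1 d2). split; [apply Rmin_pos; auto |]. intros w Hw.
  assert (W1 : disc z d1 w) by (unfold disc; eapply Rlt_le_trans; [exact Hw | apply Rmin_l]).
  assert (W2 : disc z d2 w) by (unfold disc; eapply Rlt_le_trans; [exact Hw | apply Rmin_r]).
  destruct (step z w d2 (All z Hz) HU W2) as [_ E].
  assert (PC : forall x, 0 <= x <= 1 -> pcont (fun u => r (z + RtoC u * (w - z)))%C x).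
  { intros x Hx. apply pcont_comp with (g := fun u => (z + RtoC u * (w - z))%C).
    - apply Hr, HU, disc_segment; auto.
    - apply pcont_segment. }
  assert (E2 : (CInt (fun u => r (z + RtoC u * (w - z))) 0 1 - r z =
     CInt (fun u => r (z + RtoC u * (w - z)) + - r z) 0 1)%C).
  { rewrite CInt_plus.
    - unfold Cminus. f_equal. unfold CInt. simpl. apply injective_projections; simpl;
      rewrite RInt_const; unfold scal; simpl; unfold mult; simpl; ring.
    - intros x Hx. rewrite Rmin_left, Rmax_right in Hx by lra. apply PC; auto.
    - intros x Hx. apply pcont_const. }
  rewrite E.
  replace (G z + CInt (fun u => r (z + RtoC u * (w - z))) 0 1 * (w - z) - G z - r z * (w - z))%C
    with ((CInt (fun u => r (z + RtoC u * (w - z))) 0 1 - r z) * (w - z))%C by ring.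
  rewrite E2, Cmod_mult. apply Rmult_le_compat_r; [apply Cmod_ge_0 |].
  replace eps with (2 * ((1 - 0) * (eps / 2))) by field.
  apply CInt_bound; [lra | |].
  - intros x Hx. rewrite Rmin_left, Rmax_right in Hx by lra. apply pcont_plus; [apply PC; auto | apply pcont_const].
  - intros x Hx. left. apply (Hc (z + RtoC x * (w - z))%C). apply (disc_segment z d1 w x); auto.
Qed.

(** * The explicit solution *)

Lemma C1_holomorphic_derive U F F' :
  open (T := C_UniformSpace) U -> C1_holomorphic U F F' -> C1_holomorphic U F' (C_derive F').
Proof.
  intros HO HF z Hz. destruct (open_disc U z HO Hz) as (e & He & HU).
  destruct (holomorphic_derivative z e F F') as [F'' H].
  { intros w Hw. apply HF. auto. }
  assert (E : forall w, disc z e w -> C_derive F' w = F'' w).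
  { intros w Hw. apply is_C_derive_unique. apply H. auto. }
  assert (Hzz : disc z e z) by (unfold disc; rewrite Cmod_minus_self; auto).
  split.
  - rewrite E by auto. apply H. auto.
  - apply ccont_ext_disc with F'' e; auto.
    + intros w Hw. symmetry. auto.
    + apply H. auto.
Qed.

Lemma jet2_ext D f g f1 f2 f11 f12 f22 :
  open (T := C_UniformSpace) D -> (forall s t, D (s, t) -> f s t = g s t) ->
  jet2 D f f1 f2 f11 f12 f22 -> jet2 D g f1 f2 f11 f12 f22.
Proof.
  intros HO HE H s t Hd. destruct (H s t Hd) as (A & K). split; auto.
  apply differentiable_pt_lim_ext with f; auto.
  apply locally_2d_mono with (2 := open_locally_2d D (s, t) HO Hd).
  intros u v Huv. auto.
Qed.

Lemma jet2_sqr D f f1 f2 f11 f12 f22 :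
  jet2 D f f1 f2 f11 f12 f22 ->
  jet2 D (fun s t => f s t * f s t) (fun s t => 2 * f s t * f1 s t) (fun s t => 2 * f s t * f2 s t)
    (fun s t => 2 * f1 s t * f1 s t + 2 * f s t * f11 s t)
    (fun s t => 2 * f1 s t * f2 s t + 2 * f s t * f12 s t)
    (fun s t => 2 * f2 s t * f2 s t + 2 * f s t * f22 s t).
Proof.
  intros H. apply (jet2_comp1 D f f1 f2 f11 f12 f22 (fun x => x * x) (fun x => 2 * x) (fun _ => 2)); auto.
  intros s t _. split; [auto_derive; auto; ring |]. split; [auto_derive; auto; ring |]. apply continuous_const.
Qed.

Lemma holomorphic_jets U F F' F'' :
  C1_holomorphic U F F' -> C1_holomorphic U F' F'' ->
  jet2 U (fun s t => fst (F (s, t))) (fun s t => fst (F' (s, t))) (fun s t => - snd (F' (s, t)))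
    (fun s t => fst (F'' (s, t))) (fun s t => - snd (F'' (s, t))) (fun s t => - fst (F'' (s, t))) /\
  jet2 U (fun s t => snd (F (s, t))) (fun s t => snd (F' (s, t))) (fun s t => fst (F' (s, t)))
    (fun s t => snd (F'' (s, t))) (fun s t => fst (F'' (s, t))) (fun s t => - snd (F'' (s, t))).
Proof.
  intros H1 H2. split; intros s t Hd; destruct (H1 _ Hd) as [D1 _]; destruct (H2 _ Hd) as [D2' Cc];
  apply cderiv_D2 in D1, D2'; apply ccont_iff_2d in Cc; simpl in D1, D2', Cc;
  destruct D1 as [A B]; destruct D2' as [A' B']; destruct Cc as [c1 c2];
  repeat split; auto using continuity_2d_pt_opp.
  apply D2_opp. exact B'.
Qed.

Lemma Cmod_Cexp z : Cmod (Cexp z) = exp (Re z).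
Proof.
  unfold Cexp, Cmod. simpl.
  pose proof (sin2_cos2 (Im z)) as E. unfold Rsqr in E.
  replace (exp (Re z) * cos (Im z) * (exp (Re z) * cos (Im z) * 1) +
     exp (Re z) * sin (Im z) * (exp (Re z) * sin (Im z) * 1)) with
    (exp (Re z) * exp (Re z) * (sin (Im z) * sin (Im z) + cos (Im z) * cos (Im z))) by ring.
  rewrite E, Rmult_1_r. apply sqrt_square. left; apply exp_pos.
Qed.

Lemma cderiv_Cexp z : cderiv Cexp z (Cexp z).
Proof.
  apply cderiv_D2. unfold Cexp. simpl.
  assert (E : D2 (fun u v : R => exp u) (fst z) (snd z) (exp (fst z)) 0).
  { eapply D2_eq; [apply (D2_comp1 exp); [apply D2_fst | apply is_derive_exp] | |]; ring. }
  assert (Cs : D2 (fun u v : R => cos v) (fst z) (snd z) 0 (- sin (snd z))).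
  { eapply D2_eq; [apply (D2_comp1 cos); [apply D2_snd | apply is_derive_cos] | |]; ring. }
  assert (Sn : D2 (fun u v : R => sin v) (fst z) (snd z) 0 (cos (snd z))).
  { eapply D2_eq; [apply (D2_comp1 sin); [apply D2_snd | apply is_derive_sin] | |]; ring. }
  split.
  - eapply D2_eq; [apply D2_mult; [exact E | exact Cs] | |]; simpl; unfold Re, Im; ring.
  - eapply D2_eq; [apply D2_mult; [exact E | exact Sn] | |]; simpl; unfold Re, Im; ring.
Qed.

(** Twice the hyperbolic cosine. *)
Definition expsum (x : R) : R := exp x + exp (- x).

Lemma expsum_pos x : 0 < expsum x.
Proof. unfold expsum. pose proof (exp_pos x). pose proof (exp_pos (- x)). lra. Qed.

(** The logarithm of [1 / cosh^2], which solves the one-dimensional Liouville equation: its second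
    derivative is [- 2 / cosh^2]. *)
Definition log_sech_sqr (x : R) : R := ln 4 + -2 * ln (expsum x).

Lemma is_derive_log_sech_sqr x :
  is_derive log_sech_sqr x (-2 * (exp x - exp (- x)) / expsum x).
Proof.
  pose proof (expsum_pos x) as H. unfold log_sech_sqr, expsum in *. auto_derive; auto. field. lra.
Qed.

Lemma is_derive2_log_sech_sqr x :
  is_derive (fun x => -2 * (exp x - exp (- x)) / expsum x) x (-8 / (expsum x * expsum x)).
Proof.
  pose proof (expsum_pos x) as H. unfold expsum in *. auto_derive; [lra |].
  assert (E : exp x * exp (- x) = 1) by (rewrite <- exp_plus, Rplus_opp_r, exp_0; auto).
  replace (-8) with (-8 * (exp x * exp (- x))) by (rewrite E; ring). field. lra.
Qed.

Section Explicit.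

Variables (U : C -> Prop) (r G : C -> C).
Hypothesis HU : open (T := C_UniformSpace) U.
Hypothesis HG : C1_holomorphic U G r.

Let phi : R -> R -> R := liouville_formula (fun z : C => Cexp (Ci * G z)%C).
(** At a zero of [r] the formula takes the value 0, so the equation for its logarithm is considered
    off the zeros only. *)
Let V (z : C) : Prop := U z /\ r z <> 0.

(** With [v = Im G] one has [|g| = exp (- v)] and [|g_z| = |r| * exp (- v)]; the powers of
    [exp (- v)] combine into [expsum v]. *)
Lemma liouville_formula_explicit s t :
  U (s, t) ->
  phi s t = 4 * (fst (r (s, t)) * fst (r (s, t)) + snd (r (s, t)) * snd (r (s, t))) /
     (expsum (snd (G (s, t))) * expsum (snd (G (s, t)))).
Proof.
  intros Hst. unfold phi, liouville_formula.
  assert (D : cderiv (fun z => Cexp (Ci * G z)%C) (s, t) (Cexp (Ci * G (s, t)) * (Ci * r (s, t)))%C).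
  { apply (cderiv_comp (fun z => Ci * G z)%C Cexp); [| apply cderiv_Cexp].
    apply cderiv_scal. apply HG. auto. }
  rewrite (is_C_derive_unique _ _ _ D).
  rewrite !Cmod_mult, Cmod_Ci, Cmod_Cexp, Rmult_1_l.
  replace (Re (Ci * G (s, t))%C) with (- snd (G (s, t))) by (unfold Re; simpl; ring).
  set (v := snd (G (s, t))). unfold expsum.
  assert (E : exp v = / exp (- v)) by (rewrite exp_Ropp, Rinv_inv; auto).
  rewrite Rpow_mult_distr. rewrite (Cmod2_alt (r (s, t))). unfold Re, Im.
  rewrite E. pose proof (exp_pos (- v)). set (x := exp (- v)) in *.
  field. split; [nra |]. nra.
Qed.

(** This includes the zeros of [r], where [liouville_formula_jet] is silent; the continuation
    argument takes limits there. *)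
Lemma liouville_formula_continuity s t : U (s, t) -> continuity_2d_pt phi s t.
Proof.
  intros Hst. apply continuity_2d_pt_ext_loc with
    (fun s t => 4 * (fst (r (s, t)) * fst (r (s, t)) + snd (r (s, t)) * snd (r (s, t))) *
     / (expsum (snd (G (s, t))) * expsum (snd (G (s, t))))).
  - apply locally_2d_mono with (2 := open_locally_2d U (s, t) HU Hst).
    intros u v Huv. symmetry. apply liouville_formula_explicit; auto.
  - destruct (HG _ Hst) as [D Cr]. apply cderiv_ccont in D. apply ccont_iff_2d in D, Cr. simpl in D, Cr.
    destruct D as [_ D]. destruct Cr as [C1 C2].
    apply continuity_2d_pt_mult.
    + apply continuity_2d_pt_mult; [apply continuity_2d_pt_const |].
      apply continuity_2d_pt_plus; apply continuity_2d_pt_mult; auto.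
    + assert (K : continuity_2d_pt (fun s t => expsum (snd (G (s, t)))) s t).
      { apply continuity_2d_pt_comp1; auto. unfold expsum.
        apply ex_derive_continuous_R. auto_derive; auto. }
      pose proof (expsum_pos (snd (G (s, t)))).
      apply continuity_2d_pt_inv; [apply continuity_2d_pt_mult; auto | nra].
Qed.

Lemma nonzero_domain_open : open (T := C_UniformSpace) V.
Proof.
  intros z [Hz Hr]. apply locally_disc. destruct (open_disc U z HU Hz) as (d & Hd & HdU).
  assert (Hm : 0 < Cmod (r z)) by (apply Cmod_gt_0; auto).
  destruct (proj2 (HG z Hz) (Cmod (r z)) Hm) as (e & He & HeR).
  exists (Rmin d e). split; [apply Rmin_pos; auto |]. intros w Hw. split.
  - apply HdU. unfold disc. eapply Rlt_le_trans; [exact Hw | apply Rmin_l].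
  - intros E. specialize (HeR w (Rlt_le_trans _ _ _ Hw (Rmin_r _ _))). rewrite E in HeR.
    replace (0 - r z)%C with (- r z)%C in HeR by ring. rewrite Cmod_opp in HeR. lra.
Qed.

(** [ln phi] is the sum of [ln (|r| ^ 2)], harmonic off the zeros of [r], and [log_sech_sqr (Im G)].
    As [Im G] is harmonic with squared gradient [|r| ^ 2], the Laplacian of the sum is
    [- 2 * |r| ^ 2 / cosh^2 (Im G)]. The second clause is the logarithmic derivative in [t], to be
    evaluated on [J]. *)
Lemma liouville_formula_jet :
  liouville_solution V phi /\
  forall s t, V (s, t) -> partial_derive 0 1 phi s t = phi s t *
    (2 * (snd (r (s, t)) * fst (C_derive r (s, t)) - fst (r (s, t)) * snd (C_derive r (s, t))) /
       (fst (r (s, t)) * fst (r (s, t)) + snd (r (s, t)) * snd (r (s, t))) +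
     (-2 * (exp (snd (G (s, t))) - exp (- snd (G (s, t)))) / expsum (snd (G (s, t)))) * fst (r (s, t))).
Proof.
  pose proof nonzero_domain_open as HV.
  assert (HGV : C1_holomorphic V G r) by (intros z [Hz _]; auto).
  pose proof (C1_holomorphic_derive V G r HV HGV) as HrV.
  pose proof (C1_holomorphic_derive V r _ HV HrV) as Hr'V.
  destruct (holomorphic_jets V G r _ HGV HrV) as [_ Jv].
  destruct (holomorphic_jets V r _ _ HrV Hr'V) as [Ja Jb].
  set (al := fun s t => fst (r (s, t))) in *. set (be := fun s t => snd (r (s, t))) in *.
  set (v := fun s t => snd (G (s, t))) in *.
  pose proof (jet2_plus _ _ _ _ _ _ _ _ _ _ _ _ _ (jet2_sqr _ _ _ _ _ _ _ Ja) (jet2_sqr _ _ _ _ _ _ _ Jb)) as JN.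
  set (N := fun s t => al s t * al s t + be s t * be s t).
  assert (HN : forall s t, V (s, t) -> 0 < N s t).
  { intros s t [_ Hn]. unfold N, al, be. apply Cmod_gt_0 in Hn.
    pose proof (Cmod2_alt (r (s, t))) as E. unfold Re, Im in E. simpl in E.
    assert (0 < Cmod (r (s, t)) * Cmod (r (s, t))) by nra. lra. }
  pose proof (jet2_comp1 _ _ _ _ _ _ _ ln Rinv (fun x => - / (x * x)) JN) as JlN.
  match type of JlN with ?A -> _ => assert (HA : A) end.
  { intros s t Hst. pose proof (HN s t Hst) as H. unfold N in H. split; [apply is_derive_ln_at; auto |].
    split; [apply is_derive_Rinv_at; lra |].
    apply ex_derive_continuous_R; auto_derive; nra. }
  specialize (JlN HA). clear HA.
  pose proof (jet2_comp1 _ _ _ _ _ _ _ log_sech_sqr (fun x => -2 * (exp x - exp (- x)) / expsum x)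
     (fun x => -8 / (expsum x * expsum x)) Jv) as JE.
  match type of JE with ?A -> _ => assert (HA : A) end.
  { intros s t Hst. split; [apply is_derive_log_sech_sqr |]. split; [apply is_derive2_log_sech_sqr |].
    apply ex_derive_continuous_R.
    pose proof (expsum_pos (v s t)) as H. unfold expsum in *. auto_derive. nra. }
  specialize (JE HA). clear HA.
  pose proof (jet2_plus _ _ _ _ _ _ _ _ _ _ _ _ _ JlN JE) as Ju.
  assert (Eu : forall s t, V (s, t) -> phi s t = exp (ln (N s t) + log_sech_sqr (v s t))).
  { intros s t Hst. rewrite (liouville_formula_explicit s t (proj1 Hst)).
    fold (al s t) (be s t) (v s t). fold (N s t). pose proof (HN s t Hst).
    pose proof (expsum_pos (v s t)). unfold log_sech_sqr.
    replace (-2 * ln (expsum (v s t))) with (- (ln (expsum (v s t)) + ln (expsum (v s t)))) by ring.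
    rewrite <- ln_mult by auto. rewrite !exp_plus, exp_Ropp, !exp_ln by (try lra; nra). field. lra. }
  assert (Hpos : forall s t, V (s, t) -> 0 < phi s t).
  { intros s t Hst. rewrite Eu by auto. apply exp_pos. }
  pose proof (jet2_comp1 _ _ _ _ _ _ _ exp exp exp Ju) as Jphi.
  match type of Jphi with ?A -> _ => assert (HA : A) end.
  { intros s t Hst. split; [apply is_derive_exp |]. split; [apply is_derive_exp |].
    apply ex_derive_continuous_R. auto_derive; auto. }
  specialize (Jphi HA). clear HA.
  apply (jet2_ext _ _ phi _ _ _ _ _ HV) in Jphi; [| intros s t Hst; symmetry; apply Eu; auto].
  assert (Jl := Ju). apply (jet2_ext _ _ (fun s t => ln (phi s t)) _ _ _ _ _ HV) in Jl.
  2: { intros s t Hst. rewrite Eu by auto. rewrite ln_exp. reflexivity. }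
  split; [split; [| split; [exact Hpos |]] |].
  - eapply jet2_C2_on; [exact HV | exact Jphi].
  - intros s t Hst. rewrite (jet2_laplacian _ _ _ _ _ _ _ s t HV Jl Hst).
    rewrite (liouville_formula_explicit s t (proj1 Hst)).
    fold (al s t) (be s t) (v s t). pose proof (HN s t Hst) as Hn. unfold N in Hn.
    pose proof (expsum_pos (v s t)). field. split; lra.
  - intros s t Hst.
    assert (E1 : partial_derive 0 1 phi s t = Derive (fun y => phi s y) t) by reflexivity.
    rewrite E1. destruct (Jphi s t Hst) as (A & _). apply D2_derive_2 in A.
    apply is_derive_unique in A. etransitivity; [exact A |]. rewrite Eu by auto.
    fold (al s t) (be s t) (v s t). pose proof (HN s t Hst) as Hn.
    pose proof (expsum_pos (v s t)). unfold N in *.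
    field. lra.
Qed.

Lemma liouville_formula_solution : liouville_solution V phi.
Proof. apply liouville_formula_jet. Qed.

(** Along [J] the derivative [r] of [G] is real, so [Im G] is constant there, equal to its value 0
    at [s0]; this gives the value [a] and kills the hyperbolic term of the [t]-derivative. The other
    term vanishes because [r] and its derivative are real along [J]. *)
Lemma liouville_formula_cauchy (J : R -> Prop) (a : R -> R) (s0 : R) :
  open_interval J -> (forall s, J s -> 0 < a s) -> J s0 -> (forall s, J s -> U (s, 0)) ->
  (forall s, J s -> r (s, 0) = RtoC (sqrt (a s))) -> G (RtoC s0) = 0 ->
  forall s, J s -> V (s, 0) /\ phi s 0 = a s /\ partial_derive 0 1 phi s 0 = 0.
Proof.
  intros [HJo HJc] Ha Hs0 HJU Hr HG0.
  assert (HV : forall s, J s -> V (s, 0)).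
  { intros s Hs. split; auto. rewrite Hr by auto. intros E. apply RtoC_inj in E.
    pose proof (sqrt_lt_R0 (a s) (Ha s Hs)). lra. }
  assert (Dv : forall s, J s -> is_derive (fun s => snd (G (s, 0))) s 0).
  { intros s Hs. destruct (HG _ (HJU s Hs)) as [D _]. apply cderiv_D2 in D. destruct D as [_ D].
    rewrite Hr in D by auto. simpl in D. exact (D2_derive_1 _ _ _ _ _ D). }
  assert (Hv : forall s, J s -> snd (G (s, 0)) = 0).
  { intros s Hs. unfold RtoC in HG0.
    assert (E0 : snd (G (s0, 0)) = 0) by (rewrite HG0; reflexivity).
    transitivity (snd (G (s0, 0))); [| exact E0].
    destruct (Rtotal_order s s0) as [h | [-> | h]]; auto.
    - apply (eq_is_derive (V := R_NormedModule) (fun s => snd (G (s, 0)))); auto.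
      intros t Ht. apply Dv. apply (HJc s s0); auto.
    - symmetry. apply (eq_is_derive (V := R_NormedModule) (fun s => snd (G (s, 0)))); auto.
      intros t Ht. apply Dv. apply (HJc s0 s); auto. }
  intros s Hs. split; [auto |]. pose proof (sqrt_lt_R0 (a s) (Ha s Hs)) as Hq.
  assert (Hes : expsum 0 = 2) by (unfold expsum; rewrite Ropp_0, exp_0; ring).
  split.
  - rewrite liouville_formula_explicit by auto. rewrite Hv, Hr by auto. simpl.
    rewrite Hes. pose proof (sqrt_sqrt (a s) (Rlt_le _ _ (Ha s Hs))). field_simplify. simpl. lra.
  - assert (Hb : snd (C_derive r (s, 0)) = 0).
    { destruct (C1_holomorphic_derive U G r HU HG _ (HJU s Hs)) as [D _].
      apply cderiv_D2 in D. destruct D as [_ D]. apply D2_derive_1 in D. simpl in D.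
      apply (is_derive_unique_loc (fun u => snd (r (u, 0))) (fun _ => 0) s); auto.
      - generalize (HJo s Hs). apply filter_imp. intros u Hu. rewrite Hr by auto. reflexivity.
      - apply is_derive_const_R. }
    rewrite (proj2 liouville_formula_jet) by auto. rewrite Hb, Hv, Hr, Ropp_0, exp_0, Hes by auto.
    unfold RtoC, fst, snd. field. lra.
Qed.

End Explicit.

(** * Existence of the holomorphic square root and of its primitive *)

(** Along the segment the indicator function of [A] is locally constant, so its derivative is 0 and
    its two end values agree. *)
Lemma connected_set_segment W A B z w :
  open (T := C_UniformSpace) A -> open (T := C_UniformSpace) B ->
  (forall v, W v -> A v \/ B v) -> (forall v, W v -> ~ (A v /\ B v)) ->
  (forall x, 0 <= x <= 1 -> W (z + RtoC x * (w - z))%C) -> A z -> A w.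
Proof.
  intros HA HB Hcov Hdis Hseg Hz.
  (* [smoothstep] clamps the parameter to the unit interval, so the curve stays in [W] for every
     real [x] and the end points need no one-sided argument. *)
  set (g := fun x => (z + RtoC (smoothstep x) * (w - z))%C).
  assert (Hg : forall x, W (g x)) by (intros; apply Hseg, smoothstep_range).
  assert (Cg : forall x, pcont g x).
  { intros x. apply pcont_plus; [apply pcont_const |]. apply pcont_mult; [| apply pcont_const].
    eapply pderiv_pcont. apply pderiv_RtoC, is_derive_smoothstep. }
  set (h := fun x => if excluded_middle_informative (A (g x)) then 1 else 0).
  assert (Dh : forall x, is_derive h x zero).
  { intros x. apply is_derive_ext_loc with (fun _ => h x).
    2: apply is_derive_const_R.
    destruct (Hcov _ (Hg x)) as [K | K].
    - assert (L : locally x (fun y => A (g y))) by (apply (Cg x), HA, K).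
      revert L. apply filter_imp. intros y Hy. unfold h.
      destruct (excluded_middle_informative (A (g x))); [| tauto].
      destruct (excluded_middle_informative (A (g y))); tauto.
    - assert (L : locally x (fun y => B (g y))) by (apply (Cg x), HB, K).
      revert L. apply filter_imp. intros y Hy. unfold h.
      pose proof (Hdis _ (Hg x)). pose proof (Hdis _ (Hg y)).
      destruct (excluded_middle_informative (A (g x))); [tauto |].
      destruct (excluded_middle_informative (A (g y))); tauto. }
  assert (E : h 0 = h 1) by (apply (eq_is_derive (V := R_NormedModule) h); [intros; apply Dh | lra]).
  unfold h in E.
  assert (G0 : g 0 = z) by (unfold g; rewrite smoothstep_neg by lra; ring).
  assert (G1 : g 1 = w) by (unfold g; rewrite smoothstep_1; ring).
  rewrite G0, G1 in E.
  destruct (excluded_middle_informative (A z)); [| tauto].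
  destruct (excluded_middle_informative (A w)); [auto | lra].
Qed.

(** Two points are joined by three segments: down to the axis, along [J], and up again. *)
Lemma vertically_convex_connected (J : R -> Prop) (W : C -> Prop) :
  is_connected J -> (forall s, J s -> W (s, 0)) ->
  (forall z, W z -> J (fst z) /\ forall x, 0 <= x <= 1 -> W (fst z, x * snd z)) ->
  connected_set W.
Proof.
  intros HJ HJW HW A B HA HB Hcov [z [Hz Az]] [w [Hw Bw]].
  apply NNPP. intros Hn.
  assert (Hdis : forall v, W v -> ~ (A v /\ B v)).
  { intros v Hv [Av Bv]. apply Hn. exists v. auto. }
  assert (step : forall u v, (forall x, 0 <= x <= 1 -> W (u + RtoC x * (v - u))%C) -> A u -> A v).
  { intros u v Hs. apply (connected_set_segment W A B); auto. }
  apply (Hdis w Hw). split; auto.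
  destruct (HW z Hz) as [Jz Vz]. destruct (HW w Hw) as [Jw Vw].
  apply (step (fst w, 0)).
  { intros x Hx. replace (_ + _)%C with (fst w, x * snd w)
      by (apply injective_projections; simpl; ring). apply Vw; auto. }
  apply (step (fst z, 0)).
  { intros x Hx. replace (_ + _)%C with (fst z + x * (fst w - fst z), 0)
      by (apply injective_projections; simpl; ring). apply HJW.
    destruct (Rle_dec (fst z) (fst w)).
    - apply (HJ (fst z) (fst w)); auto. split; nra.
    - apply (HJ (fst w) (fst z)); auto. split; nra. }
  apply (step z); auto.
  intros x Hx. replace (_ + _)%C with (fst z, (1 - x) * snd z)
      by (apply injective_projections; simpl; ring). apply Vz. lra.
Qed.

(** The principal branch on the right half-plane; elsewhere the second coordinate is not the
    principal argument. *)
Definition Clog (w : C) : C := (/ 2 * ln (fst w * fst w + snd w * snd w), atan (snd w / fst w)).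

Lemma cderiv_Clog w : 0 < fst w -> cderiv Clog w (/ w)%C.
Proof.
  intros H. apply cderiv_D2. destruct w as [x y]. simpl in *.
  assert (HN : 0 < x * x + y * y) by nra.
  split.
  - eapply D2_eq.
    + apply D2_scal. apply (D2_comp1 ln).
      * apply D2_plus; apply D2_sqr; [apply D2_fst | apply D2_snd].
      * apply is_derive_ln_at. exact HN.
    + cbv beta. field. nra.
    + cbv beta. field. nra.
  - eapply D2_eq.
    + apply (D2_comp1 atan); [apply D2_div; [apply D2_snd | apply D2_fst | lra] | apply is_derive_atan].
    + cbv beta. unfold Rsqr. field. split; nra.
    + cbv beta. unfold Rsqr. field. split; nra.
Qed.

Lemma Cexp_half_Clog_real x : 0 < x -> Cexp (/ 2 * Clog (RtoC x))%C = RtoC (sqrt x).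
Proof.
  intros H.
  assert (E : (/ RtoC 2 * Clog (RtoC x))%C = RtoC (/ 2 * ln x)).
  { rewrite <- RtoC_inv by lra. unfold Clog. simpl.
    replace (0 / x) with 0 by (field; lra). rewrite atan_0, Rmult_0_l, Rplus_0_r, ln_mult by auto.
    apply injective_projections; simpl; field. }
  rewrite E. unfold Cexp, RtoC. simpl. rewrite cos_0, sin_0. f_equal; [| ring].
  rewrite Rmult_1_r. symmetry. apply sqrt_lem_1; [lra | left; apply exp_pos |].
  rewrite <- exp_plus. replace (/ 2 * ln x + / 2 * ln x) with (ln x) by field. apply exp_ln; auto.
Qed.

(** Values are prescribed on the whole real diameter, which lies in [J]; they are what forces two
    germs to agree. *)
Definition sqrt_germ (J : R -> Prop) (a : R -> R) (x0 rho : R) (F F' : C -> C) : Prop :=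
  J x0 /\ 0 < rho /\ C1_holomorphic (disc (RtoC x0) rho) F F' /\
  forall x, Rabs (x - x0) < rho -> J x /\ F (RtoC x) = RtoC (sqrt (a x)).

Lemma real_PS_value (c : nat -> R) (x l : R) :
  is_pseries c x l -> PS (fun n => RtoC (c n)) (RtoC x) = RtoC l.
Proof.
  intros H. unfold PS.
  assert (E : forall n, (RtoC (c n) * RtoC x ^ n)%C = RtoC (c n * x ^ n)).
  { intros n. rewrite RtoC_mult, RtoC_pow. reflexivity. }
  rewrite (CSeries_ext _ _ E).
  unfold CSeries, RtoC. simpl. f_equal.
  - apply is_pseries_unique in H. exact H.
  - rewrite (Series_ext _ (fun n => 0 * 1)) by (intros; ring). rewrite Series_scal_l. ring.
Qed.

(** The power series of [a] at [x0] converges for complex arguments too, and [Cexp (/ 2 * Clog z)]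
    is a holomorphic square root wherever its sum has positive real part. *)
Lemma sqrt_germ_exists J a x0 :
  open_interval J -> (forall s, J s -> 0 < a s) -> real_analytic_on J a -> J x0 ->
  exists rho F F', sqrt_germ J a x0 rho F F'.
Proof.
  intros [HJo _] Ha Han Hx0.
  destruct (Han x0 Hx0) as [c [d1 Hc]]. destruct (HJo x0 Hx0) as [d2 Hd2].
  (* The real point [x0 + r] lies strictly inside the interval of convergence, so the terms of the
     series at radius [r] are bounded. *)
  set (r := d1 / 2). assert (Hr : 0 < r) by (pose proof (cond_pos d1); unfold r; lra).
  assert (HcB : coef_bounded (fun n => RtoC (c n)) r).
  { split; auto.
    assert (Hs : is_pseries c r (a (x0 + r))).
    { replace r with (x0 + r - x0) at 1 by ring. apply Hc. change (Rabs (x0 + r - x0) < d1).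
      replace (x0 + r - x0) with r by ring. rewrite Rabs_pos_eq by lra. unfold r. pose proof (cond_pos d1). lra. }
    assert (Hes : ex_series (fun n => c n * r ^ n)).
    { apply ex_pseries_R. eexists; eauto. }
    apply ex_series_lim_0 in Hes.
    destruct (filterlim_bounded (K := R_AbsRing) (V := R_NormedModule) (fun n => c n * r ^ n)) as [M HM].
    { exists 0. exact Hes. }
    exists (Rabs M + 1). split; [pose proof (Rabs_pos M); lra |]. intros n.
    rewrite Cmod_R. rewrite <- (Rabs_pos_eq (r ^ n)) by (apply pow_le; lra). rewrite <- Rabs_mult.
    eapply Rle_trans; [apply HM |]. pose proof (Rle_abs M). lra. }
  set (A := fun z => PS (fun n => RtoC (c n)) (z - RtoC x0)%C).
  set (A' := fun z => PS (PS' (fun n => RtoC (c n))) (z - RtoC x0)%C).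
  assert (HA : C1_holomorphic (disc (RtoC x0) r) A A') by (apply PS_C1_holomorphic; auto).
  assert (HAr : forall x, Rabs (x - x0) < r -> A (RtoC x) = RtoC (a x)).
  { intros x Hx. unfold A. rewrite <- RtoC_minus. apply real_PS_value. apply Hc.
    change (Rabs (x - x0) < d1). unfold r in Hx. pose proof (cond_pos d1). lra. }
  assert (H0 : disc (RtoC x0) r (RtoC x0)) by (unfold disc; rewrite Cmod_minus_self; auto).
  (* A deviation smaller than [a x0] keeps the real part of [A] positive. *)
  destruct (cderiv_ccont _ _ _ (proj1 (HA _ H0)) (a x0) (Ha x0 Hx0)) as (e & He & HcA).
  set (rho := Rmin (Rmin r e) d2).
  assert (Hrho : 0 < rho) by (repeat apply Rmin_pos; auto; apply cond_pos).
  assert (R1 : rho <= r) by (eapply Rle_trans; apply Rmin_l).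
  assert (R2 : rho <= e) by (eapply Rle_trans; [apply Rmin_l | apply Rmin_r]).
  assert (R3 : rho <= d2) by apply Rmin_r.
  assert (Pos : forall z, disc (RtoC x0) rho z -> 0 < fst (A z)).
  { intros z Hz. unfold disc in Hz. specialize (HcA z ltac:(lra)).
    rewrite (HAr x0) in HcA by (rewrite Rminus_diag, Rabs_R0; auto).
    pose proof (Cmod_ge_fst (A z - RtoC (a x0))) as K.
    change (fst (A z - RtoC (a x0))%C) with (fst (A z) + - a x0) in K.
    assert (K' : Rabs (fst (A z) + - a x0) < a x0) by lra. apply Rabs_def2 in K'. lra. }
  exists rho, (fun z => Cexp (/ 2 * Clog (A z)))%C,
    (fun z => Cexp (/ 2 * Clog (A z)) * (/ 2 * (/ A z * A' z)))%C.
  split; [auto | split; [auto | split]].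
  - intros z Hz. assert (Hz' : disc (RtoC x0) r z) by (unfold disc in *; lra).
    destruct (HA z Hz') as [D Cc]. specialize (Pos z Hz).
    assert (N : A z <> 0) by (intros E; rewrite E in Pos; simpl in Pos; lra).
    assert (D1 : cderiv (fun z => Cexp (/ 2 * Clog (A z)))%C z (Cexp (/ 2 * Clog (A z)) * (/ 2 * (/ A z * A' z)))%C).
    { apply (cderiv_comp (fun z => / 2 * Clog (A z))%C Cexp); [| apply cderiv_Cexp].
      apply cderiv_scal. apply (cderiv_comp A Clog); auto. apply cderiv_Clog; auto. }
    split; [exact D1 |]. apply ccont_mult; [eapply cderiv_ccont; exact D1 |].
    apply ccont_mult; [apply ccont_const |]. apply ccont_mult; [| exact Cc].
    apply ccont_inv; auto. eapply cderiv_ccont; exact D.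
  - intros x Hx. split; [apply Hd2; change (Rabs (x - x0) < d2); lra |].
    rewrite HAr by lra. apply Cexp_half_Clog_real. apply Ha, Hd2. change (Rabs (x - x0) < d2). lra.
Qed.

(** Diamonds overlap better than discs: for [z] in two of them, some disc about the foot
    [(fst z, 0)] contains [z] and lies in both of the discs carrying the germs. Its centre is on the
    axis, so the identity theorem compares the germs at [z]. *)
Definition diamond (x rho : R) (z : C) : Prop := Rabs (fst z - x) + Rabs (snd z) < rho.

Lemma disc_center_diamond x rho s z :
  disc (s, 0) (rho - Rabs (s - x)) z -> disc (RtoC x) rho z.
Proof.
  unfold disc. intros H. pose proof (Cmod_sub_triangle z (s, 0) (RtoC x)) as T.
  replace ((s, 0) - RtoC x)%C with (RtoC (s - x)) in T by (apply injective_projections; simpl; ring).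
  rewrite Cmod_R in T. lra.
Qed.

Lemma diamond_disc x rho z : diamond x rho z -> disc (RtoC x) rho z.
Proof.
  unfold diamond, disc. intros H. eapply Rle_lt_trans; [apply Cmod_le_Rabs_sum |].
  simpl. rewrite Ropp_0, Rplus_0_r. exact H.
Qed.

Lemma diamond_open x rho : open (T := C_UniformSpace) (diamond x rho).
Proof.
  intros z Hz. apply locally_disc. unfold diamond in *.
  exists ((rho - (Rabs (fst z - x) + Rabs (snd z))) / 2). split; [lra |]. intros w Hw.
  pose proof (Cmod_ge_fst (w - z)) as K1. pose proof (Cmod_ge_snd (w - z)) as K2. simpl in K1, K2.
  replace (fst w - x) with ((fst w + - fst z) + (fst z - x)) by ring.
  replace (snd w) with ((snd w + - snd z) + snd z) by ring.
  pose proof (Rabs_triang (fst w + - fst z) (fst z - x)).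
  pose proof (Rabs_triang (snd w + - snd z) (snd z)). lra.
Qed.

Lemma sqrt_germ_agree J a x rho F F' y sigma H H' z :
  sqrt_germ J a x rho F F' -> sqrt_germ J a y sigma H H' ->
  diamond x rho z -> diamond y sigma z -> F z = H z.
Proof.
  intros (_ & _ & HF & RF) (_ & _ & HH & RH) Dx Dy. unfold diamond in *.
  set (s := fst z) in *. set (tau := Rmin (rho - Rabs (s - x)) (sigma - Rabs (s - y))).
  assert (Ht1 : tau <= rho - Rabs (s - x)) by apply Rmin_l.
  assert (Ht2 : tau <= sigma - Rabs (s - y)) by apply Rmin_r.
  assert (Ht : Rabs (snd z) < tau) by (apply Rmin_glb_lt; lra).
  assert (HD : C1_holomorphic (disc (s, 0) tau) (fun z => F z - H z)%C (fun z => F' z - H' z)%C).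
  { intros w Hw. destruct (HF w) as [A1 A2].
    { apply disc_center_diamond with s. unfold disc in *; lra. }
    destruct (HH w) as [B1 B2].
    { apply disc_center_diamond with s. unfold disc in *; lra. }
    split; [apply cderiv_minus; auto | apply ccont_minus; auto]. }
  assert (Z : (F z - H z)%C = 0).
  { apply (holomorphic_identity (s, 0) tau _ _ tau HD).
    - pose proof (Rabs_pos (snd z)). lra.
    - intros u Hu. replace ((s, 0) + RtoC u)%C with (RtoC (s + u)) by (apply injective_projections; simpl; ring).
      destruct (RF (s + u)) as [_ E1].
      { replace (s + u - x) with ((s - x) + u) by ring. pose proof (Rabs_triang (s - x) u). lra. }
      destruct (RH (s + u)) as [_ E2].
      { replace (s + u - y) with ((s - y) + u) by ring. pose proof (Rabs_triang (s - y) u). lra. }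
      rewrite E1, E2. ring.
    - unfold disc. eapply Rle_lt_trans; [apply Cmod_le_Rabs_sum |]. simpl. fold s.
      rewrite Ropp_0, Rplus_0_r, Rplus_opp_r, Rabs_R0. lra. }
  replace (F z) with (F z - H z + H z)%C by ring. rewrite Z. ring.
Qed.

Lemma holomorphic_primitive q rho F F' :
  C1_holomorphic (disc q rho) F F' -> exists P, forall z, disc q rho z -> cderiv P z (F z).
Proof.
  intros HF.
  destruct (closed_form_primitive q rho (fun s t => fst (F (s, t))) (fun s t => - snd (F (s, t)))
     (fun s t => - snd (F' (s, t)))) as [P1 H1].
  { intros s t Hd. destruct (HF _ Hd) as [D Cc]. pose proof (cderiv_ccont _ _ _ D) as C0.
    apply cderiv_D2 in D. apply ccont_iff_2d in Cc, C0. simpl in D, Cc, C0.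
    destruct D as [A B]. destruct Cc, C0.
    split; [| split; [| split; [| split]]]; auto using continuity_2d_pt_opp.
    - exact (D2_derive_2 _ _ _ _ _ A).
    - apply D2_opp in B. exact (D2_derive_1 _ _ _ _ _ B). }
  destruct (closed_form_primitive q rho (fun s t => snd (F (s, t))) (fun s t => fst (F (s, t)))
     (fun s t => fst (F' (s, t)))) as [P2 H2].
  { intros s t Hd. destruct (HF _ Hd) as [D Cc]. pose proof (cderiv_ccont _ _ _ D) as C0.
    apply cderiv_D2 in D. apply ccont_iff_2d in Cc, C0. simpl in D, Cc, C0.
    destruct D as [A B]. destruct Cc, C0.
    split; [| split; [| split; [| split]]]; auto.
    - exact (D2_derive_2 _ _ _ _ _ B).
    - exact (D2_derive_1 _ _ _ _ _ A). }
  exists (fun z => (P1 (fst z) (snd z), P2 (fst z) (snd z))).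
  intros [s t] Hz. apply cderiv_D2. simpl. split; [apply H1 | apply H2]; auto.
Qed.

(** [U] is the union of all diamonds of germs. Agreement of germs makes [r] single-valued, and
    vertical convexity of diamonds makes [U] connected and supplies a path for the definition of
    [G]. *)
Lemma sqrt_data_exists J a s0 :
  open_interval J -> (forall s, J s -> 0 < a s) -> real_analytic_on J a -> J s0 ->
  exists U r G, sqrt_data J a s0 U r G.
Proof.
  intros HJ Ha Han Hs0. pose proof HJ as [HJo HJc].
  set (germ := fun z w => exists x rho F F', sqrt_germ J a x rho F F' /\ diamond x rho z /\ F z = w).
  set (U := fun z => exists w, germ z w).
  set (r := fun z => epsilon (inhabits (RtoC 0)) (germ z)).
  assert (Hr : forall x rho F F' z, sqrt_germ J a x rho F F' -> diamond x rho z -> r z = F z).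
  { intros x rho F F' z HF Hz.
    assert (Hg : germ z (r z)).
    { apply epsilon_spec. exists (F z), x, rho, F, F'. auto. }
    destruct Hg as (y & sigma & H & H' & HH & Hy & E). rewrite <- E.
    apply (sqrt_germ_agree J a y sigma H H' x rho F F'); auto. }
  assert (HU : forall z, U z -> exists x rho F F', sqrt_germ J a x rho F F' /\ diamond x rho z).
  { intros z (w & x & rho & F & F' & HF & Hz & _). exists x, rho, F, F'. auto. }
  assert (HU' : forall x rho F F' z, sqrt_germ J a x rho F F' -> diamond x rho z -> U z).
  { intros x rho F F' z HF Hz. exists (F z), x, rho, F, F'. auto. }
  assert (HUo : open (T := C_UniformSpace) U).
  { intros z Hz. destruct (HU z Hz) as (x & rho & F & F' & HF & Hd).
    generalize (diamond_open x rho z Hd). apply filter_imp. intros w Hw. apply (HU' x rho F F'); auto. }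
  assert (HJU : forall s, J s -> U (s, 0)).
  { intros s Hs. destruct (sqrt_germ_exists J a s HJ Ha Han Hs) as (rho & F & F' & HF).
    apply (HU' s rho F F'); auto. unfold diamond. simpl. rewrite Rminus_diag, !Rabs_R0.
    destruct HF as (_ & Hp & _). lra. }
  assert (HUv : forall z, U z -> J (fst z) /\ forall x, 0 <= x <= 1 -> U (fst z, x * snd z)).
  { intros z Hz. destruct (HU z Hz) as (x & rho & F & F' & HF & Hd). unfold diamond in Hd.
    pose proof (Rabs_pos (snd z)). split.
    - destruct HF as (_ & _ & _ & HR). apply HR. lra.
    - intros y Hy. apply (HU' x rho F F'); auto. unfold diamond. simpl.
      rewrite Rabs_mult, (Rabs_pos_eq y) by lra. nra. }
  assert (HUc : connected_set U) by (apply (vertically_convex_connected J); auto).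
  assert (Hrd : forall z, U z -> exists d, cderiv r z d).
  { intros z Hz. destruct (HU z Hz) as (x & rho & F & F' & HF & Hd).
    exists (F' z). destruct (open_disc _ z (diamond_open x rho) Hd) as (e & He & Hde).
    apply cderiv_ext_disc with F e; auto.
    - intros w Hw. symmetry. apply (Hr x rho F F'); auto.
    - destruct HF as (_ & _ & HF & _). apply HF. apply diamond_disc; auto. }
  assert (Hrc : forall z, U z -> ccont r z) by (intros z Hz; apply ex_cderiv_ccont; auto).
  (* The integral of [r] along [J] to the foot of [z] and then vertically; this path stays in
     [U]. *)
  set (G := fun z => (CInt (fun s => r (s, 0)) s0 (fst z) + Ci * CInt (fun t => r (fst z, t)) 0 (snd z))%C).
  assert (pc1 : forall s, J s -> pcont (fun s => r (s, 0)) s).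
  { intros s Hs. apply pcont_comp with (g := fun s => (s, 0)).
    - apply Hrc, HJU; auto.
    - apply pcont_iff. simpl. split; [apply continuous_id | apply continuous_const]. }
  assert (pc2 : forall s t, U (s, t) -> pcont (fun t => r (s, t)) t).
  { intros s t Hz. apply pcont_comp with (g := fun t => (s, t)).
    - apply Hrc; auto.
    - apply pcont_iff. simpl. split; [apply continuous_const | apply continuous_id]. }
  assert (Jb : forall u v x, J u -> J v -> Rmin u v <= x <= Rmax u v -> J x).
  { intros u v x Hu Hv Hx. unfold Rmin, Rmax in Hx. destruct (Rle_dec u v).
    - apply (HJc u v); auto.
    - apply (HJc v u); auto. }
  assert (HGd : forall z, U z -> cderiv G z (r z)).
  { intros z Hz. destruct (HU z Hz) as (x & rho & F & F' & HF & Hd).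
    pose proof HF as (Jx & Hrho & HFh & HFr).
    destruct (holomorphic_primitive _ _ _ _ HFh) as [P HP].
    (* On a diamond [G] differs from a primitive of the local germ by a constant, the part of the
       path from [s0] to [x] being common to all points. *)
    assert (EG : forall w, diamond x rho w -> G w = (P w + (CInt (fun s => r (s, 0)) s0 x - P (RtoC x)))%C).
    { intros w Hw. destruct w as [s t]. unfold diamond in Hw. simpl in Hw. unfold G. simpl.
      pose proof (Rabs_pos t). pose proof (Rabs_pos (s - x)).
      assert (Js : J s) by (apply HFr; lra).
      assert (Hh : forall u, Rmin x s <= u <= Rmax x s -> diamond x rho (u, 0)).
      { intros u Hu. apply between_Rabs in Hu. unfold diamond. simpl. rewrite Rabs_R0. lra. }
      assert (Hvv : forall v, Rmin 0 t <= v <= Rmax 0 t -> diamond x rho (s, v)).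
      { intros v Hv. apply between_Rabs in Hv. rewrite !Rminus_0_r in Hv. unfold diamond. simpl. lra. }
      rewrite <- (CInt_Chasles _ s0 x s).
      2: { intros u Hu. apply pc1, (Jb s0 x); auto. }
      2: { intros u Hu. apply pc1, (Jb x s); auto. }
      assert (I1 : CInt (fun s => r (s, 0)) x s = (P (s, 0%R) - P (RtoC x))%C).
      { apply (CInt_pderiv (fun u => P (u, 0%R))).
        - intros u Hu. specialize (Hh u Hu). rewrite (Hr x rho F F' _ HF Hh).
          eapply pderiv_eq; [apply (pderiv_comp P (fun u => RtoC u)) |].
          + apply HP, diamond_disc. exact Hh.
          + apply pderiv_RtoC_id.
          + apply Cmult_1_r.
        - intros u Hu. apply pc1, (Jb x s); auto. }
      assert (I2 : (Ci * CInt (fun t => r (s, t)) 0 t)%C = (P (s, t) - P (s, 0%R))%C).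
      { rewrite <- CInt_scal.
        2: { intros v Hv. apply pc2. apply (HU' x rho F F'); auto. }
        apply (CInt_pderiv (fun v => P (s, v))).
        - intros v Hv. specialize (Hvv v Hv). rewrite (Hr x rho F F' _ HF Hvv).
          eapply pderiv_eq; [apply (pderiv_comp P (fun v => (s, v))) |].
          + apply HP, diamond_disc. exact Hvv.
          + instantiate (1 := Ci). split; simpl.
            * apply is_derive_const_R.
            * apply (is_derive_id (K := R_AbsRing)).
          + ring.
        - intros v Hv. apply pcont_mult; [apply pcont_const |]. apply pc2. apply (HU' x rho F F'); auto. }
      rewrite I1, I2. ring. }
    destruct (open_disc _ z (diamond_open x rho) Hd) as (e & He & Hde).
    rewrite (Hr x rho F F' z HF Hd).
    apply cderiv_ext_disc with (fun w => P w + (CInt (fun s => r (s, 0)) s0 x - P (RtoC x)))%C e; auto.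
    - intros w Hw. symmetry. apply EG. auto.
    - eapply cderiv_eq; [apply cderiv_plus; [apply HP, diamond_disc; auto | apply cderiv_const] |]. ring. }
  exists U, r, G. split; [split; [exact HUo | split; [exact HUc | exact HJU]] | split].
  - split.
    + intros z Hz. destruct (Hrd z Hz) as [d Hd]. exists d. exact Hd.
    + intros s Hs. destruct (sqrt_germ_exists J a s HJ Ha Han Hs) as (rho & F & F' & HF).
      rewrite (Hr s rho F F'); auto.
      * apply HF. rewrite Rminus_diag, Rabs_R0. apply HF.
      * unfold diamond. simpl. rewrite Rminus_diag, !Rabs_R0. destruct HF as (_ & Hp & _). lra.
  (* Path independence is the fundamental theorem of calculus for the primitive [G], normalised by
     [G (RtoC s0) = 0]. *)
  - intros z ga dga (H0 & H1 & HUg & HD & HC).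
    assert (G0 : G (RtoC s0) = 0).
    { unfold G, CInt. simpl. rewrite !RInt_point. unfold zero; simpl. apply injective_projections; simpl; ring. }
    assert (pcr : pcont_on (fun x => r (ga x) * dga x)%C 0 1).
    { intros x Hx. rewrite Rmin_left, Rmax_right in Hx by lra. apply pcont_mult; [| apply HC].
      apply pcont_comp; [apply Hrc, HUg; auto |]. eapply pderiv_pcont. apply pderiv_is_derive. apply HD. }
    assert (E : CInt (fun x => r (ga x) * dga x)%C 0 1 = G z).
    { rewrite (CInt_pderiv (fun x => G (ga x))); auto.
      - rewrite H1, H0, G0. ring.
      - intros x Hx. rewrite Rmin_left, Rmax_right in Hx by lra.
        apply pderiv_comp; [apply HGd, HUg; auto | apply pderiv_is_derive; apply HD]. }
    rewrite <- E. apply CInt_is_RInt. exact pcr.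
Qed.

(** * The Cauchy problem *)

Lemma liouville_solution_subset D D' p :
  (forall z, D z -> D' z) -> liouville_solution D' p -> liouville_solution D p.
Proof.
  intros H (H1 & H2 & H3). split; [| split].
  - intros s t Hst. apply H1. auto.
  - intros s t Hst. apply H2. auto.
  - intros s t Hst. apply H3. auto.
Qed.

(** [V] is only known to be open. Discs centred on [J] whose shadow on the axis stays in [J] have a
    vertically convex, hence connected, union. *)
Lemma disc_domain_around (J : R -> Prop) (V : C -> Prop) :
  open_interval J -> open (T := C_UniformSpace) V -> (forall s, J s -> V (s, 0)) ->
  exists W, domain_around J W /\ forall z, W z -> V z.
Proof.
  intros [HJo HJc] HV HJV.
  set (W := fun z => exists s e, J s /\ (forall x, Rabs (x - s) < e -> J x) /\
     (forall w, disc (s, 0) e w -> V w) /\ disc (s, 0) e z).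
  assert (HJW : forall s, J s -> W (s, 0)).
  { intros s Hs. destruct (HJo s Hs) as [e1 H1]. destruct (open_disc V _ HV (HJV s Hs)) as (e2 & He2 & H2).
    assert (He : 0 < Rmin e1 e2) by (apply Rmin_pos; auto; apply cond_pos).
    pose proof (Rmin_l e1 e2). pose proof (Rmin_r e1 e2).
    exists s, (Rmin e1 e2). split; [auto | split; [| split]].
    - intros x Hx. apply H1. change (Rabs (x - s) < e1). lra.
    - intros w Hw. apply H2. unfold disc in *. lra.
    - unfold disc. rewrite Cmod_minus_self. auto. }
  exists W. split; [split; [| split; [| exact HJW]] |].
  - intros z (s & e & Hs & HJe & HVe & Hz).
    generalize (disc_is_open _ _ z Hz). apply filter_imp. intros w Hw. exists s, e. auto.
  - apply (vertically_convex_connected J); auto.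
    intros z (s & e & Hs & HJe & HVe & Hz). split.
    + apply HJe. unfold disc in Hz. pose proof (Cmod_ge_fst (z - (s, 0))) as K. simpl in K. unfold Rminus. lra.
    + intros x Hx. exists s, e. split; [auto | split; [auto | split; [auto |]]].
      destruct z as [u v]. apply (disc_coord (s, 0) e u v); auto; simpl; [lra |].
      rewrite !Rminus_0_r, Rabs_mult, (Rabs_pos_eq x) by lra. pose proof (Rabs_pos v). nra.
  - intros z (s & e & Hs & HJe & HVe & Hz). auto.
Qed.

Lemma partial_derive_01_ext_disc q rho f g s t :
  disc q rho (s, t) -> (forall u v, disc q rho (u, v) -> f u v = g u v) ->
  partial_derive 0 1 f s t = partial_derive 0 1 g s t.
Proof.
  intros Hd HE. unfold partial_derive. simpl. apply Derive_ext_loc.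
  pose proof (disc_locally_2d _ _ _ _ Hd) as L. apply locally_2d_1d_const_x in L.
  revert L. apply filter_imp. auto.
Qed.

(* [V] is the part of the domain where [phi] is known to solve the equation;
   [phi] vanishes off [V], so a positive limit point of the coincidence set lies in [V]. *)
Lemma liouville_unique_continuation (W V : C -> Prop) (psi phi : R -> R -> R) z0 e0 :
  open (T := C_UniformSpace) W -> connected_set W -> open (T := C_UniformSpace) V ->
  liouville_solution W psi -> liouville_solution V phi ->
  (forall s t, W (s, t) -> continuity_2d_pt phi s t) ->
  (forall s t, W (s, t) -> phi s t <> 0 -> V (s, t)) ->
  W z0 -> 0 < e0 -> (forall s t, disc z0 e0 (s, t) -> psi s t = phi s t) ->
  forall s t, W (s, t) -> psi s t = phi s t.
Proof.
  intros HWo HWc HVo Hpsi Hphi Hcont HV Hz0 He0 H0.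
  set (agree := fun z => exists e, 0 < e /\ forall s t, disc z e (s, t) -> psi s t = phi s t).
  assert (Ao : open (T := C_UniformSpace) agree).
  { intros z (e & He & Hz). apply locally_disc. exists (e / 2). split; [lra |]. intros w Hw.
    exists (e / 2). split; [lra |]. intros s t Hd. apply Hz. unfold disc in *.
    pose proof (Cmod_sub_triangle (s, t) w z). lra. }
  (* Closedness of the open coincidence set in [W]: continuity gives equality at [p], positivity of
     [psi] then puts [p] in [V], where local uniqueness is available. *)
  assert (Limit : forall p, W p -> (forall d, 0 < d -> exists q, disc p d q /\ agree q) -> agree p).
  { intros [a b] Hp Hlim.
    assert (E : psi a b = phi a b).
    { apply NNPP. intros Hne.
      assert (Cd : continuity_2d_pt (fun s t => psi s t - phi s t) a b).
      { apply continuity_2d_pt_minus; [| apply Hcont; auto].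
        apply (proj1 (proj1 Hpsi a b Hp)). }
      apply continuity_2d_pt_neq_0 in Cd; [| lra].
      apply (locally_2d_disc (fun w => psi (fst w) (snd w) - phi (fst w) (snd w) <> 0) (a, b)) in Cd.
      destruct Cd as (d & Hd & Hn). destruct (Hlim d Hd) as ([s t] & Hq & (e & He & Hqe)).
      apply (Hn (s, t) Hq). simpl. rewrite (Hqe s t); [ring |].
      unfold disc. rewrite Cmod_minus_self. auto. }
    assert (Vp : V (a, b)).
    { apply HV; auto. rewrite <- E. destruct Hpsi as (_ & P & _). specialize (P a b Hp). lra. }
    destruct (open_disc W _ HWo Hp) as (d1 & Hd1 & HdW).
    destruct (open_disc V _ HVo Vp) as (d2 & Hd2 & HdV).
    (* The disc of radius [d] about a point [q] closer than [d] to [p] contains [p] and still lies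
       in both [W] and [V]. *)
    set (d := Rmin d1 d2 / 2). assert (Hm : 0 < Rmin d1 d2) by (apply Rmin_pos; auto).
    pose proof (Rmin_l d1 d2). pose proof (Rmin_r d1 d2).
    destruct (Hlim d ltac:(unfold d; lra)) as (q & Hq & (e & He & Hqe)).
    assert (Sub : forall w, disc q d w -> disc (a, b) (2 * d) w).
    { intros w Hw. unfold disc in *. pose proof (Cmod_sub_triangle w q (a, b)). lra. }
    assert (Hq' : disc q d (a, b)) by (unfold disc in *; rewrite Cmod_sub_sym; auto).
    assert (Eq : forall s t, disc q d (s, t) -> psi s t = phi s t).
    (* Agreement on a small disc about [q] provides equal Cauchy data on a horizontal segment
       through [q]; uniqueness spreads it to the larger disc. *)
    { apply (liouville_local_uniqueness q d e).
      - apply liouville_solution_subset with W; auto. intros w Hw. apply HdW.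
        specialize (Sub w Hw). unfold disc, d in *. lra.
      - apply liouville_solution_subset with V; auto. intros w Hw. apply HdV.
        specialize (Sub w Hw). unfold disc, d in *. lra.
      - exact He.
      - intros x Hx. assert (Hxe : disc q e (x, snd q)).
        { unfold disc. eapply Rle_lt_trans; [apply Cmod_le_Rabs_sum |]. simpl.
          rewrite Rplus_opp_r, Rabs_R0, Rplus_0_r. exact Hx. }
        split; [apply Hqe; auto |]. apply partial_derive_01_ext_disc with q e; auto. }
    exists (d - Cmod ((a, b) - q)). split; [unfold disc in Hq'; lra |].
    intros s t Hd. apply Eq. unfold disc in *. pose proof (Cmod_sub_triangle (s, t) (a, b) q). lra. }
  assert (All : forall z, W z -> agree z).
  { intros z Hz. apply NNPP. intros Hn.
    destruct (HWc agree (fun z => W z /\ ~ agree z)) as (v & _ & Hv & _ & Hv'); auto.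
    - intros p [Hp Hpn]. destruct (open_disc W _ HWo Hp) as (d1 & Hd1 & HdW).
      apply locally_disc. apply NNPP. intros Hne. apply Hpn, Limit; auto.
      intros d Hd. apply NNPP. intros Hnq. apply Hne. exists (Rmin d d1).
      split; [apply Rmin_pos; auto |]. intros w Hw.
      pose proof (Rmin_l d d1). pose proof (Rmin_r d d1). split.
      + apply HdW. unfold disc. lra.
      + intros Aw. apply Hnq. exists w. split; auto. unfold disc. lra.
    - intros v Hv. destruct (classic (agree v)); auto.
    - exists z0. split; auto. exists e0. auto.
    - exists z. auto. }
  intros s t Hst. destruct (All _ Hst) as (e & He & H). apply H.
  unfold disc. rewrite Cmod_minus_self. auto.
Qed.

Theorem corollary4 :
  forall (J : R -> Prop) (a : R -> R) (s0 : R),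
    open_interval J ->
    (forall s : R, J s -> 0 < a s) ->
    real_analytic_on J a ->
    J s0 ->
    (exists (U : C -> Prop) (r G : C -> C), sqrt_data J a s0 U r G) /\
    (forall (U : C -> Prop) (r G : C -> C),
       sqrt_data J a s0 U r G ->
       let phi := liouville_formula (fun z : C => Cexp (Ci * G z)%C) in
       (exists W : C -> Prop,
          domain_around J W /\ (forall z : C, W z -> U z) /\
          liouville_cauchy_solution J a W phi) /\
       (forall (W : C -> Prop) (psi : R -> R -> R),
          domain_around J W -> (forall z : C, W z -> U z) ->
          liouville_cauchy_solution J a W psi ->
          forall s t : R, W (s, t) -> psi s t = phi s t)).
Proof.
  intros J a s0 HJ Ha Han Hs0. split; [apply sqrt_data_exists; auto |].
  intros U r G ((HUo & HUc & HJU) & (Hrh & Hrs) & HG) phi.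
  assert (Hrc : forall z, U z -> ccont r z).
  { intros z Hz. destruct (Hrh z Hz) as [d Hd]. eapply cderiv_ccont. exact Hd. }
  (* [r] is known to be complex differentiable, with no continuity of its derivative; the regularity
     theory is applied to its primitive [G] instead. *)
  assert (HGh : C1_holomorphic U G r).
  { intros z Hz. split; auto. apply (integral_from_primitive U r G (RtoC s0)); auto. apply HJU; auto. }
  assert (HG0 : G (RtoC s0) = 0).
  (* The constant path fixes the value of [G] at the base point. *)
  { rewrite (is_RInt_CInt _ _ _ _ (HG (RtoC s0) (fun _ => RtoC s0) (fun _ => RtoC 0)
      (C1_path_const U _ (HJU s0 Hs0)))).
    rewrite (CInt_ext _ (fun _ => RtoC 0)) by (intros; ring).
      rewrite (CInt_pderiv (fun _ => RtoC 0)); [ring | |]; intros t _; [apply pderiv_const | apply pcont_const]. }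
  set (V := fun z => U z /\ r z <> 0).
  pose proof (nonzero_domain_open U r G HUo HGh : open (T := C_UniformSpace) V) as HVo.
  pose proof (liouville_formula_solution U r G HUo HGh : liouville_solution V phi) as Hphi.
  pose proof (liouville_formula_cauchy U r G HUo HGh J a s0 HJ Ha Hs0 HJU Hrs HG0) as Hcau.
  fold phi in Hcau.
  split.
  - destruct (disc_domain_around J V HJ HVo) as (W & HW & HWV).
    { intros s Hs. apply (Hcau s Hs). }
    exists W. split; [exact HW | split; [intros z Hz; apply HWV; auto |]].
    destruct (liouville_solution_subset W V phi HWV Hphi) as (S1 & S2 & S3).
    split; [exact S1 | split; [exact S2 | split; [exact S3 |]]].
    intros s Hs. apply (Hcau s Hs).
  - intros W psi (HWo & HWc & HJW) HWU (S1 & S2 & S3 & S4).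
    assert (Hpsi : liouville_solution W psi) by (split; auto).
    destruct (open_disc W _ HWo (HJW s0 Hs0)) as (d1 & Hd1 & HdW).
    destruct (open_disc V _ HVo (proj1 (Hcau s0 Hs0))) as (d2 & Hd2 & HdV).
    destruct (proj1 HJ s0 Hs0) as [d3 HdJ].
    set (d := Rmin (Rmin d1 d2) d3).
    assert (Hd : 0 < d) by (repeat apply Rmin_pos; auto; apply cond_pos).
    assert (D1 : d <= d1) by (eapply Rle_trans; apply Rmin_l).
    assert (D2' : d <= d2) by (eapply Rle_trans; [apply Rmin_l | apply Rmin_r]).
    assert (D3 : d <= d3) by apply Rmin_r.
    apply (liouville_unique_continuation W V psi phi (s0, 0) d); auto.
    + intros s t Hst. apply (liouville_formula_continuity U r G HUo HGh). auto.
    + intros s t Hst Hn. split; auto. intros E. apply Hn.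
      unfold phi. rewrite (liouville_formula_explicit U r G HGh) by auto. rewrite E. simpl.
      unfold Rdiv. ring.
    (* The continuation starts from a disc about the base point, small enough to lie in [W] and [V]
       and to have its real diameter in [J]. *)
    + apply (liouville_local_uniqueness (s0, 0) d d); auto.
      * apply liouville_solution_subset with W; auto. intros w Hw. apply HdW. unfold disc in *. lra.
      * apply liouville_solution_subset with V; auto. intros w Hw. apply HdV. unfold disc in *. lra.
      * intros x Hx. simpl in *. assert (Jx : J x) by (apply HdJ; change (Rabs (x - s0) < d3); lra).
        destruct (S4 x Jx) as [A1 A2]. destruct (Hcau x Jx) as (_ & B1 & B2). split; congruence.
Qed.
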